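(* Let $k$ be a field of characteristic $p>0$, $G$ a finite group and $N$ a normal subgroup of $G$ of $p$-power index. Then, for any two-term simple-minded collection $\mathcal{X}$ in $D^b(\mathrm{mod}\,kG)$, the set $\mathrm{Res}\,\mathcal{X}$ is a two-term simple-minded collection in $D^b(\mathrm{mod}\,kN)$.
   Context: For a finite dimensional $k$-algebra $\Lambda$, $\mathrm{mod}\,\Lambda$ is the category of finitely generated left $\Lambda$-modules and $D^b(\mathrm{mod}\,\Lambda)$ its bounded derived category with shift $[1]$. A set $\mathcal{X}$ of isomorphism classes of objects in $D^b(\mathrm{mod}\,\Lambda)$ is a simple-minded collection if: (1) $\mathrm{End}_{D^b(\mathrm{mod}\,\Lambda)}(X)$ is a division $k$-algebra for every $X\in\mathcal{X}$; (2) $\mathrm{Hom}_{D^b(\mathrm{mod}\,\Lambda)}(X_1,X_2)=0$ for all $X_1\ne X_2$ in $\mathcal{X}$; (3) $\mathrm{Hom}_{D^b(\mathrm{mod}\,\Lambda)}(X_1,X_2[n])=0$ for all $X_1,X_2\in\mathcal{X}$ and all integers $n<0$; (4) the smallest thick subcategory of $D^b(\mathrm{mod}\,\Lambda)$ containing $\mathcal{X}$ is $D^b(\mathrm{mod}\,\Lambda)$. It is two-term if $H^i(X)=0$ for all $X\in\mathcal{X}$ and all $i\ne-1,0$. The (exact) restriction functor $\mathrm{Res}:\mathrm{mod}\,kG\to\mathrm{mod}\,kN$ induces a functor $\mathrm{Res}:D^b(\mathrm{mod}\,kG)\to D^b(\mathrm{mod}\,kN)$, and $\mathrm{Res}\,\mathcal{X}$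 denotes the set of isomorphism classes of indecomposable direct summands of the objects $\mathrm{Res}\,X$, $X\in\mathcal{X}$. *)

(* Defs.v *)
(* MathComp.  Finitely generated kG-modules are MathComp's bundled matrix
   representations [representation k G].  MathComp matrices act on row vectors,
   so the left kG-module carried by M : representation k G is the space of
   row vectors with g . v = v *m M g^-1, and a kG-linear map M -> L is a matrix
   f with M g *m f = f *m L g for all g in G. *)
From HB Require Import structures.
From mathcomp Require Import all_boot all_order all_algebra.
From mathcomp Require Import all_fingroup all_solvable.
From mathcomp Require Import mxrepresentation character.

Set Implicit Arguments.
Unset Strict Implicit.
Unset Printing Implicit Defensive.

Import GRing.Theory.
Local Open Scope ring_scope.

Section DerivedCategory.

Variables (k : fieldType) (gT : finGroupType) (G : {group gT}).

Local Notation module := (representation k G).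

Definition module_hom (M L : module) (f : 'M[k]_(rdegree M, rdegree L)) : Prop :=
  {in G, forall g, M g *m f = f *m L g}.

(* Bounded cochain complexes.  The differential is a family indexed by all
   pairs of degrees, with d^i = bc_diff i (i + 1) and every other entry zero:
   this way shifting a complex needs no cast along i + n + 1 = i + 1 + n. *)
Record bcomplex := BComplex {
  bc_obj :> int -> module;
  bc_diff : forall i j, 'M[k]_(rdegree (bc_obj i), rdegree (bc_obj j));
  bc_diff_hom : forall i j, module_hom (bc_diff i j);
  bc_diff_shape : forall i j, j != i + 1 -> bc_diff i j = 0;
  bc_diff_sq : forall i j l, bc_diff i j *m bc_diff j l = 0;
  bc_bounded : exists b : nat, forall i, (b < `|i|)%N -> rdegree (bc_obj i) = 0%N
}.

Implicit Types X Y Z W : bcomplex.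

Record chain_map X Y := ChainMap {
  cm_mx :> forall i, 'M[k]_(rdegree (X i), rdegree (Y i));
  cm_hom : forall i, module_hom (cm_mx i);
  cm_comm : forall i j, cm_mx i *m bc_diff Y i j = bc_diff X i j *m cm_mx j
}.

Lemma chain_id_hom X i : module_hom (1%:M : 'M[k]_(rdegree (X i))).
Proof. by move=> g _; rewrite mulmx1 mul1mx. Qed.

Lemma chain_id_comm X i j : 1%:M *m bc_diff X i j = bc_diff X i j *m 1%:M.
Proof. by rewrite mulmx1 mul1mx. Qed.

Definition chain_id X : chain_map X X :=
  ChainMap (@chain_id_hom X) (@chain_id_comm X).

Lemma chain_zero_hom X Y i :
  module_hom (0 : 'M[k]_(rdegree (X i), rdegree (Y i))).
Proof. by move=> g _; rewrite mulmx0 mul0mx. Qed.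

Lemma chain_zero_comm X Y i j :
  (0 : 'M_(rdegree (X i), _)) *m bc_diff Y i j = bc_diff X i j *m 0.
Proof. by rewrite mulmx0 mul0mx. Qed.

Definition chain_zero X Y : chain_map X Y :=
  ChainMap (@chain_zero_hom X Y) (@chain_zero_comm X Y).

Section Comp.

Variables (X Y Z : bcomplex) (g : chain_map Y Z) (f : chain_map X Y).

Lemma chain_comp_hom i : module_hom (f i *m g i).
Proof.
move=> x Gx; rewrite mulmxA (cm_hom f i Gx).
by rewrite -[LHS]mulmxA (cm_hom g i Gx) mulmxA.
Qed.

Lemma chain_comp_comm i j :
  f i *m g i *m bc_diff Z i j = bc_diff X i j *m (f j *m g j).
Proof. by rewrite -mulmxA cm_comm mulmxA cm_comm mulmxA. Qed.

(* g after f; the matrices compose in the opposite order. *)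
Definition chain_comp : chain_map X Z := ChainMap chain_comp_hom chain_comp_comm.

End Comp.

Definition homotopic X Y (f g : chain_map X Y) : Prop :=
  exists h : forall i j, 'M[k]_(rdegree (X i), rdegree (Y j)),
    (forall i j, module_hom (h i j)) /\
    (forall i, f i - g i = bc_diff X i (i + 1) *m h (i + 1) i
                           + h i (i - 1) *m bc_diff Y (i - 1) i).

(* H^i(X) is the quotient of the row space of [cocycles X i] by that of
   [coboundaries X i]. *)
Definition cocycles X i := kermx (bc_diff X i (i + 1)).
Definition coboundaries X i := bc_diff X (i - 1) i.

Definition cohomology_zero X i : Prop := (cocycles X i <= coboundaries X i)%MS.

(* The two clauses say that H^i(s) is injective, resp. surjective. *)
Definition quasi_iso X Y (s : chain_map X Y) : Prop :=
  forall i,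
    (forall v : 'rV[k]_(rdegree (X i)), (v <= cocycles X i)%MS ->
       (v *m s i <= coboundaries Y i)%MS -> (v <= coboundaries X i)%MS) /\
    (forall w : 'rV[k]_(rdegree (Y i)), (w <= cocycles Y i)%MS ->
       exists2 v : 'rV[k]_(rdegree (X i)), (v <= cocycles X i)%MS
         & (w - v *m s i <= coboundaries Y i)%MS).

Lemma chain_id_qis X : quasi_iso (chain_id X).
Proof.
move=> i; split=> [v _ | w Zw]; first by rewrite mulmx1.
by exists w; rewrite //= mulmx1 subrr sub0mx.
Qed.

Lemma coboundaries_map X Y (s : chain_map X Y) i (v : 'rV_(rdegree (X i))) :
  (v <= coboundaries X i)%MS -> (v *m s i <= coboundaries Y i)%MS.
Proof. by case/submxP=> u ->; rewrite -mulmxA -cm_comm mulmxA submxMl. Qed.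

Lemma cocycles_map X Y (s : chain_map X Y) i (v : 'rV_(rdegree (X i))) :
  (v <= cocycles X i)%MS -> (v *m s i <= cocycles Y i)%MS.
Proof.
by move=> /sub_kermxP Zv; apply/sub_kermxP; rewrite -mulmxA cm_comm mulmxA Zv mul0mx.
Qed.

Lemma chain_comp_qis X Y Z (t : chain_map Y Z) (s : chain_map X Y) :
  quasi_iso t -> quasi_iso s -> quasi_iso (chain_comp t s).
Proof.
move=> qt qs i; have [injt surt] := qt i; have [injs surs] := qs i.
split=> [v Zv | w /surt[u Zu Bw]].
  by rewrite mulmxA => Bv; apply: injs (injt _ _ Bv) => //; apply: cocycles_map.
have [v Zv Bu] := surs u Zu; exists v => //=.
rewrite (_ : w - _ = (w - u *m t i) + (u - v *m s i) *m t i).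
  by rewrite addmx_sub ?coboundaries_map.
by rewrite mulmxBl mulmxA addrA subrK.
Qed.

(* D^b(mod kG) as the localization of the homotopy category of bounded complexes
   at the quasi-isomorphisms: a morphism X -> Y is a class, for [roof_eq], of
   roofs X <-roof_den- apex -roof_num-> Y. *)
Record roof X Y := Roof {
  roof_apex : bcomplex;
  roof_den : chain_map roof_apex X;
  roof_num : chain_map roof_apex Y;
  roof_qis : quasi_iso roof_den
}.

Definition roof_eq X Y (r1 r2 : roof X Y) : Prop :=
  exists (W : bcomplex) (u1 : chain_map W (roof_apex r1))
         (u2 : chain_map W (roof_apex r2)),
    [/\ quasi_iso (chain_comp (roof_den r1) u1),
        homotopic (chain_comp (roof_den r1) u1) (chain_comp (roof_den r2) u2)
      & homotopic (chain_comp (roof_num r1) u1) (chain_comp (roof_num r2) u2)].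

Definition roof_of_chain X Y (f : chain_map X Y) : roof X Y :=
  Roof f (@chain_id_qis X).

Definition roof_id X : roof X X := roof_of_chain (chain_id X).
Definition roof_zero X Y : roof X Y := roof_of_chain (chain_zero X Y).

(* [is_comp g f h]: h is the composite of f : X -> Y followed by g : Y -> Z,
   computed by completing apex f -> Y <- apex g to a homotopy commutative
   square whose side s is a quasi-isomorphism. *)
Definition is_comp X Y Z (g : roof Y Z) (f : roof X Y) (h : roof X Z) : Prop :=
  exists (W : bcomplex) (s : chain_map W (roof_apex f))
         (t : chain_map W (roof_apex g)) (qs : quasi_iso s),
    homotopic (chain_comp (roof_num f) s) (chain_comp (roof_den g) t) /\
    roof_eq h (Roof (chain_comp (roof_num g) t)
                    (chain_comp_qis (@roof_qis _ _ f) qs)).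

Definition mutually_inverse X Y (f : roof X Y) (g : roof Y X) : Prop :=
  is_comp g f (roof_id X) /\ is_comp f g (roof_id Y).

Definition D_iso X Y : Prop :=
  exists (f : roof X Y) (g : roof Y X), mutually_inverse f g.

Definition D_Hom_zero X Y : Prop := forall r : roof X Y, roof_eq r (roof_zero X Y).

Definition D_End_division X : Prop :=
  ~ roof_eq (roof_id X) (roof_zero X X) /\
  (forall f : roof X X, ~ roof_eq f (roof_zero X X) ->
     exists g : roof X X, mutually_inverse f g).

Program Definition bc_zero : bcomplex :=
  @BComplex (fun=> grepr0) (fun _ _ => 0) _ _ _ _.
Next Obligation. by move=> i j g _; rewrite mulmx0 mul0mx. Qed.
Next Obligation. by []. Qed.
Next Obligation. by move=> i j l; rewrite mulmx0. Qed.
Next Obligation. by exists 0%N. Qed.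

Section Sum.

Variables X Y : bcomplex.

Let obj i := dadd_grepr (X i) (Y i).
Let diff i j : 'M[k]_(rdegree (obj i), rdegree (obj j)) :=
  block_mx (bc_diff X i j) 0 0 (bc_diff Y i j).

Lemma bc_sum_hom i j : module_hom (diff i j).
Proof.
move=> g Gg; rewrite /= !mulmx_block !(mulmx0, mul0mx, addr0, add0r).
by rewrite !bc_diff_hom.
Qed.

Lemma bc_sum_shape i j : j != i + 1 -> diff i j = 0.
Proof. by move=> ij; rewrite /diff !bc_diff_shape // block_mx0. Qed.

Lemma bc_sum_sq i j l : diff i j *m diff j l = 0.
Proof.
rewrite mulmx_block !(mulmx0, mul0mx, addr0, add0r) !bc_diff_sq.
exact: block_mx0.
Qed.

Lemma bc_sum_bounded :
  exists b : nat, forall i, (b < `|i|)%N -> rdegree (obj i) = 0%N.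
Proof.
have [b Xb] := bc_bounded X; have [c Yc] := bc_bounded Y.
exists (maxn b c) => i; rewrite gtn_max => /andP[bi ci] /=.
by rewrite Xb ?Yc.
Qed.

Definition bc_sum : bcomplex :=
  BComplex bc_sum_hom bc_sum_shape bc_sum_sq bc_sum_bounded.

End Sum.

Section Shift.

Variables (X : bcomplex) (n : int).

Let diff i j := (-1) ^+ `|n|%N *: bc_diff X (i + n) (j + n).

Lemma bc_shift_hom i j : module_hom (diff i j).
Proof. by move=> g Gg; rewrite -scalemxAl -scalemxAr bc_diff_hom. Qed.

Lemma bc_shift_shape i j : j != i + 1 -> diff i j = 0.
Proof.
by move=> ij; rewrite /diff bc_diff_shape ?scaler0 // addrAC (inj_eq (addIr n)).
Qed.

Lemma bc_shift_sq i j l : diff i j *m diff j l = 0.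
Proof. by rewrite -scalemxAl -scalemxAr bc_diff_sq !scaler0. Qed.

Lemma bc_shift_bounded :
  exists b : nat, forall i, (b < `|i|)%N -> rdegree (X (i + n)) = 0%N.
Proof.
have [b Xb] := bc_bounded X; exists (b + `|n|)%N => i bi.
apply: Xb; rewrite -(ltn_add2r `|n|); apply: leq_trans bi _.
have := leqD_dist (i + n) 0 n.
by rewrite addrK subr0 sub0r abszN.
Qed.

(* X[n], with X[n]^i = X^(i + n) and differential (-1)^n d. *)
Definition bc_shift : bcomplex :=
  @BComplex (fun i => X (i + n)) diff bc_shift_hom bc_shift_shape bc_shift_sq
    bc_shift_bounded.

End Shift.

Section Cone.

Variables (X Y : bcomplex) (f : chain_map X Y).

Let obj i := dadd_grepr (X (i + 1)) (Y i).

(* f^(i + 1) viewed as a map X^(i + 1) -> Y^j when j = i + 1, where the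
   [conform_mx] is the identity cast, and 0 otherwise. *)
Let off i j : 'M[k]_(rdegree (X (i + 1)), rdegree (Y j)) :=
  if j == i + 1 then conform_mx 0 (f (i + 1)) else 0.

Let diff i j : 'M[k]_(rdegree (obj i), rdegree (obj j)) :=
  block_mx (- bc_diff X (i + 1) (j + 1)) (off i j) 0 (bc_diff Y i j).

Lemma bc_cone_hom i j : module_hom (diff i j).
Proof.
move=> g Gg; rewrite /= !mulmx_block !(mulmx0, mul0mx, addr0, add0r).
rewrite mulmxN mulNmx !bc_diff_hom //; congr block_mx.
rewrite /off; case: eqP => [->|_]; last by rewrite mulmx0 mul0mx.
by rewrite conform_mx_id cm_hom.
Qed.

Lemma bc_cone_shape i j : j != i + 1 -> diff i j = 0.
Proof.
move=> ij; rewrite /diff /off (negPf ij) !bc_diff_shape //.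
  by rewrite oppr0 block_mx0.
by rewrite (inj_eq (addIr 1)).
Qed.

Lemma bc_cone_sq i j l : diff i j *m diff j l = 0.
Proof.
have [-> | /bc_cone_shape->] := eqVneq j (i + 1); last by rewrite mul0mx.
have [-> | /bc_cone_shape->] := eqVneq l (i + 1 + 1); last by rewrite mulmx0.
rewrite mulmx_block !(mulmx0, mul0mx, addr0, add0r).
rewrite mulmxN mulNmx opprK !bc_diff_sq /off !eqxx !conform_mx_id.
by rewrite mulNmx -cm_comm addNr block_mx0.
Qed.

Lemma bc_cone_bounded :
  exists b : nat, forall i, (b < `|i|)%N -> rdegree (obj i) = 0%N.
Proof.
have [b Xb] := bc_bounded (bc_shift X 1); have [c Yc] := bc_bounded Y.
exists (maxn b c) => i; rewrite gtn_max => /andP[bi ci] /=.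
by rewrite Yc // addn0; apply: Xb.
Qed.

(* Cone(f)^i = X^(i + 1) (+) Y^i with d(x, y) = (- d x, f x + d y). *)
Definition bc_cone : bcomplex :=
  BComplex bc_cone_hom bc_cone_shape bc_cone_sq bc_cone_bounded.

End Cone.

(* A sequence A -> B -> C -> A[1] of D^b(mod kG) is a distinguished triangle
   when it is isomorphic to the standard triangle of some chain map f; the
   third condition below is therefore the closure under distinguished
   triangles, for a class which is closed under isomorphism. *)
Record thick (P : bcomplex -> Prop) : Prop := Thick {
  thick_zero : P bc_zero;
  thick_iso : forall X Y, D_iso X Y -> P X -> P Y;
  thick_cone : forall X Y (f : chain_map X Y), P X -> P Y -> P (bc_cone f);
  thick_shift : forall X (n : int), P X -> P (bc_shift X n);
  thick_summand : forall X Y, P (bc_sum X Y) -> P X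
}.

Definition D_indecomposable X : Prop :=
  ~ D_iso X bc_zero /\
  (forall Y Z, D_iso X (bc_sum Y Z) -> D_iso Y bc_zero \/ D_iso Z bc_zero).

Definition D_summand X Y : Prop := exists Z, D_iso Y (bc_sum X Z).

(* A set of isomorphism classes of objects is a predicate on complexes which is
   closed under isomorphism in D^b(mod kG). *)
Record simple_minded_collection (S : bcomplex -> Prop) : Prop := SMC {
  smc_classes : forall X Y, D_iso X Y -> S X -> S Y;
  smc_division : forall X, S X -> D_End_division X;
  smc_orthogonal : forall X Y, S X -> S Y -> ~ D_iso X Y -> D_Hom_zero X Y;
  smc_negative : forall X Y (n : int), S X -> S Y -> n < 0 ->
    D_Hom_zero X (bc_shift Y n);
  smc_generates : forall P, thick P -> (forall X, S X -> P X) -> forall Y, P Y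
}.

Definition two_term (S : bcomplex -> Prop) : Prop :=
  forall X, S X -> forall i : int, i != -1 -> i != 0 -> cohomology_zero X i.

End DerivedCategory.

Section Restriction.

Variables (k : fieldType) (gT : finGroupType) (G N : {group gT}).
Hypothesis sNG : N \subset G.

Definition res_module (M : representation k G) : representation k N :=
  Representation (subg_repr M sNG).

Section Complex.

Variable X : bcomplex k G.

Lemma bc_res_hom i j :
  @module_hom k gT N (res_module (X i)) (res_module (X j)) (bc_diff X i j).
Proof. by move=> g Ng; apply: bc_diff_hom; apply: (subsetP sNG). Qed.

(* Restriction is exact, so the induced functor between the bounded derived
   categories is its termwise application to complexes. *)
Definition bc_res : bcomplex k N :=
  @BComplex k gT N (fun i => res_module (X i)) (fun i j => bc_diff X i j)
    bc_res_hom (@bc_diff_shape _ _ _ X) (@bc_diff_sq _ _ _ X) (bc_bounded X).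

End Complex.

Definition res_collection (S : bcomplex k G -> Prop) : bcomplex k N -> Prop :=
  fun Y => D_indecomposable Y /\ exists2 X, S X & D_summand Y (bc_res X).

End Restriction.

(* Main.v *)
(** Write P = G/N, and let E be the endomorphism ring of Res X in D^b(mod kN) for X in
   the collection.  The Mackey-type point is that, since P is a p-group in
   characteristic p, a nonzero subgroup of Hom(Res X, Res Y) which is stable under
   conjugation by G contains the restriction of a nonzero G-map X -> Y, as soon as
   the relevant homotopies are traces.  Hence Hom(Res X, Res Y[n]) vanishes whenever
   Hom(X, Y[n]) does (n <= 0).  Applied to the Jacobson radical of E it shows that E
   is semisimple: a nonzero radical would contain a nonzero element of the division
   ring End(X).  So nonzero maps between indecomposable summands of Res X are
   isomorphisms.  Finally every Y in D^b(mod kN) is a summand of Res (Ind Y), which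
   gives generation.

   Morphisms of D^b are computed as homotopy classes of chain maps out of good
   truncations of projective resolutions. *)
Require Import Defs.
From mathcomp Require Import all_boot all_order all_algebra.
From mathcomp Require Import all_fingroup all_solvable.
From mathcomp Require Import mxrepresentation character.
From mathcomp Require Import zify.
From Stdlib Require Import Classical IndefiniteDescription.

Set Implicit Arguments.
Unset Strict Implicit.
Unset Printing Implicit Defensive.

Import GRing.Theory.
Local Open Scope ring_scope.

(** * Chain homotopies and quasi-isomorphisms *)

(** The invariants of the [p]-group [G / N] on [Hom(Res X, Res Y)] are homotopy classes, and an
    invariant class need not contain a [G]-map. The descent therefore works with actual matrices:
    for [g] generating a quotient of order [p], the operator [D = g - 1] satisfies [D^p = 0]
    strictly on equivariant chain maps, and [D^(p - 1)] is the relative trace. When the last nonzero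
    iterate of [D] is null-homotopic, its homotopy is itself of the form [D^(p - 1) h'], and this is
    used to change the starting map by a boundary. Bounded projective resolutions do not exist in
    general, so a truncated resolution keeps one arbitrary term, in its lowest degree [a]. Lifts and
    homotopies still exist there because the targets vanish below degree [a]. Hence the thresholds
    [exists a0, forall a, a <= a0 -> ...], which let finitely many complexes share one [a]. *)

Section Homotopy.

Variables (k : fieldType) (gT : finGroupType) (G : {group gT}).
Implicit Types X Y Z W : bcomplex k G.

(** Stated for a family of matrices rather than a chain map: [homotopic f g] is then by conversion
    [null_homotopic (fun i => f i - g i)], and differences need not be repackaged as chain maps. *)
Definition null_homotopic X Y (f : forall i, 'M[k]_(rdegree (X i), rdegree (Y i))) :=
  exists h : forall i j, 'M[k]_(rdegree (X i), rdegree (Y j)),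
    (forall i j, module_hom (h i j)) /\
    (forall i, f i = bc_diff X i (i + 1) *m h (i + 1) i
                     + h i (i - 1) *m bc_diff Y (i - 1) i).

Lemma module_hom0 (M L : representation k G) : @module_hom k gT G M L 0.
Proof. by move=> g _; rewrite mulmx0 mul0mx. Qed.

Lemma module_homD (M L : representation k G) f g :
  @module_hom k gT G M L f -> @module_hom k gT G M L g -> @module_hom k gT G M L (f + g).
Proof. by move=> Hf Hg x Gx; rewrite mulmxDr mulmxDl Hf ?Hg. Qed.

Lemma module_homN (M L : representation k G) f :
  @module_hom k gT G M L f -> @module_hom k gT G M L (- f).
Proof. by move=> Hf x Gx; rewrite mulmxN mulNmx Hf. Qed.

Lemma module_homB (M L : representation k G) f g :
  @module_hom k gT G M L f -> @module_hom k gT G M L g -> @module_hom k gT G M L (f - g).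
Proof. by move=> Hf Hg; apply: module_homD => //; apply: module_homN. Qed.

Lemma module_homM (M L K : representation k G) f g :
  @module_hom k gT G M L f -> @module_hom k gT G L K g -> @module_hom k gT G M K (f *m g).
Proof. by move=> Hf Hg x Gx; rewrite mulmxA Hf // -[LHS]mulmxA Hg // mulmxA. Qed.

Lemma module_hom1 (M : representation k G) : @module_hom k gT G M M 1%:M.
Proof. by move=> x Gx; rewrite mulmx1 mul1mx. Qed.

Lemma comm_of_succ X Y (f : forall i, 'M[k]_(rdegree (X i), rdegree (Y i))) :
  (forall i, f i *m bc_diff Y i (i + 1) = bc_diff X i (i + 1) *m f (i + 1)) ->
  forall i j, f i *m bc_diff Y i j = bc_diff X i j *m f j.
Proof.
move=> Hf i j; have [->|ij] := eqVneq j (i + 1); first exact: Hf.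
by rewrite !bc_diff_shape // mulmx0 mul0mx.
Qed.

Lemma null_ext X Y (f g : forall i, 'M[k]_(rdegree (X i), rdegree (Y i))) :
  (forall i, f i = g i) -> null_homotopic f -> null_homotopic g.
Proof. by move=> fg [h [Hh Eh]]; exists h; split=> // i; rewrite -fg. Qed.

Lemma null0 X Y (f : forall i, 'M[k]_(rdegree (X i), rdegree (Y i))) :
  (forall i, f i = 0) -> null_homotopic f.
Proof.
move=> f0; exists (fun _ _ => 0); split=> [i j|i]; first exact: module_hom0.
by rewrite f0 mulmx0 mul0mx addr0.
Qed.

Lemma nullB X Y (f g : forall i, 'M[k]_(rdegree (X i), rdegree (Y i))) :
  null_homotopic f -> null_homotopic g -> null_homotopic (fun i => f i - g i).
Proof.
case=> h [Hh Eh] [h' [Hh' Eh']]; exists (fun i j => h i j - h' i j); split.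
  by move=> i j; apply: module_homB.
by move=> i; rewrite Eh Eh' mulmxBr mulmxBl addrACA opprD.
Qed.

Lemma nullN X Y (f : forall i, 'M[k]_(rdegree (X i), rdegree (Y i))) :
  null_homotopic f -> null_homotopic (fun i => - f i).
Proof.
move=> Hf; have H0 : null_homotopic (fun i => f i - f i).
  by apply: null0 => i; rewrite subrr.
by apply: null_ext (nullB H0 Hf) => i; rewrite subrr sub0r.
Qed.

Lemma nullD X Y (f g : forall i, 'M[k]_(rdegree (X i), rdegree (Y i))) :
  null_homotopic f -> null_homotopic g -> null_homotopic (fun i => f i + g i).
Proof.
by move=> Hf /nullN Hg; apply: null_ext (nullB Hf Hg) => i; rewrite opprK.
Qed.

Lemma null_mull W X Y (a : chain_map W X)
    (f : forall i, 'M[k]_(rdegree (X i), rdegree (Y i))) :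
  null_homotopic f -> null_homotopic (fun i => a i *m f i).
Proof.
case=> h [Hh Eh]; exists (fun i j => a i *m h i j); split=> [i j|i].
  by apply: module_homM; [exact: cm_hom | exact: Hh].
by rewrite Eh mulmxDr !mulmxA cm_comm.
Qed.

Lemma null_mulr X Y Z (f : forall i, 'M[k]_(rdegree (X i), rdegree (Y i)))
    (b : chain_map Y Z) :
  null_homotopic f -> null_homotopic (fun i => f i *m b i).
Proof.
case=> h [Hh Eh]; exists (fun i j => h i j *m b j); split=> [i j|i].
  by apply: module_homM; [exact: Hh | exact: cm_hom].
by rewrite Eh mulmxDl -!mulmxA cm_comm.
Qed.

Lemma homotopic_refl X Y (f : chain_map X Y) : homotopic f f.
Proof. by apply: null0 => i; rewrite subrr. Qed.

Lemma homotopic_ext X Y (f g : chain_map X Y) : (forall i, f i = g i) -> homotopic f g.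
Proof. by move=> fg; apply: null0 => i; rewrite fg subrr. Qed.

Lemma homotopic_sym X Y (f g : chain_map X Y) : homotopic f g -> homotopic g f.
Proof. by move=> /nullN H; apply: null_ext H => i; rewrite opprB. Qed.

Lemma homotopic_trans X Y (f g h : chain_map X Y) :
  homotopic f g -> homotopic g h -> homotopic f h.
Proof. by move=> H /(nullD H); apply: null_ext => i; rewrite addrA subrK. Qed.

Lemma homotopic_comp X Y Z (f f' : chain_map X Y) (g g' : chain_map Y Z) :
  homotopic f f' -> homotopic g g' -> homotopic (chain_comp g f) (chain_comp g' f').
Proof.
move=> Hf Hg; have := nullD (null_mulr g Hf) (null_mull f' Hg).
by apply: null_ext => i; rewrite /= mulmxBl mulmxBr addrA subrK.
Qed.

(** The two clauses of [quasi_iso] are separated because a composite passes injectivity to its first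
    factor and surjectivity to its last. *)
Definition coh_inj X Y (s : chain_map X Y) := forall i (v : 'rV[k]_(rdegree (X i))),
  (v <= cocycles X i)%MS -> (v *m s i <= coboundaries Y i)%MS -> (v <= coboundaries X i)%MS.

Definition coh_surj X Y (s : chain_map X Y) := forall i (w : 'rV[k]_(rdegree (Y i))),
  (w <= cocycles Y i)%MS -> exists2 v : 'rV[k]_(rdegree (X i)),
  (v <= cocycles X i)%MS & (w - v *m s i <= coboundaries Y i)%MS.

Lemma qisP X Y (s : chain_map X Y) : quasi_iso s <-> coh_inj s /\ coh_surj s.
Proof.
split=> [H|[H1 H2] i]; first by split=> i; case: (H i).
by split; [apply: H1 | apply: H2]. Qed.

Lemma null_coh X Y (f : forall i, 'M[k]_(rdegree (X i), rdegree (Y i))) i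
    (v : 'rV[k]_(rdegree (X i))) :
  null_homotopic f -> (v <= cocycles X i)%MS -> (v *m f i <= coboundaries Y i)%MS.
Proof.
case=> h [_ ->] /sub_kermxP Zv.
by rewrite mulmxDr mulmxA Zv mul0mx add0r mulmxA submxMl.
Qed.

Lemma coh_inj_homotopic X Y (s t : chain_map X Y) : homotopic s t -> coh_inj s -> coh_inj t.
Proof.
move=> st Hs i v Zv Bv; apply: Hs => //.
by rewrite -(subrK (v *m t i) (v *m s i)) addmx_sub // -mulmxBr (null_coh st).
Qed.

Lemma coh_surj_homotopic X Y (s t : chain_map X Y) :
  homotopic s t -> coh_surj s -> coh_surj t.
Proof.
move=> st Hs i w /Hs[v Zv Bv]; exists v => //.
rewrite -(subrK (v *m s i) w) -addrA addmx_sub // -mulmxBr.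
exact: (null_coh st).
Qed.

Lemma qis_homotopic X Y (s t : chain_map X Y) : homotopic s t -> quasi_iso s -> quasi_iso t.
Proof.
move=> st /qisP[si ss]; apply/qisP; split.
  exact: coh_inj_homotopic st si.
exact: coh_surj_homotopic st ss.
Qed.

Lemma coh_inj_comp X Y Z (t : chain_map Y Z) (s : chain_map X Y) :
  coh_inj (chain_comp t s) -> coh_inj s.
Proof.
by move=> H i v Zv Bv; apply: H => //=; rewrite mulmxA coboundaries_map.
Qed.

Lemma coh_surj_comp X Y Z (t : chain_map Y Z) (s : chain_map X Y) :
  coh_surj (chain_comp t s) -> coh_surj t.
Proof.
move=> H i w /H[v Zv /= Bv]; exists (v *m s i); first exact: cocycles_map.
by rewrite -mulmxA.
Qed.

Lemma qis_right X Y Z (t : chain_map Y Z) (s : chain_map X Y) :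
  quasi_iso (chain_comp t s) -> quasi_iso t -> quasi_iso s.
Proof.
move=> /qisP[tsi tss] /qisP[ti ts]; apply/qisP; split.
  exact: coh_inj_comp tsi.
move=> i w Zw; have [v Zv Bv] := tss i _ (cocycles_map t Zw).
exists v => //; apply: ti; last by rewrite mulmxBl -mulmxA.
by rewrite addmx_sub // eqmx_opp cocycles_map.
Qed.

Lemma coh_inj_left X Y Z (t : chain_map Y Z) (s : chain_map X Y) :
  coh_inj (chain_comp t s) -> quasi_iso s -> coh_inj t.
Proof.
move=> tsi /qisP[si ss] i w Zw Bw; have [v Zv Bv] := ss i w Zw.
rewrite -(subrK (v *m s i) w) addmx_sub //; apply: coboundaries_map.
apply: tsi => //=.
rewrite mulmxA -(subKr (w *m t i) (v *m s i *m t i)) -mulmxBl addmx_sub //.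
by rewrite eqmx_opp coboundaries_map.
Qed.

Lemma qis_left X Y Z (t : chain_map Y Z) (s : chain_map X Y) :
  quasi_iso (chain_comp t s) -> quasi_iso s -> quasi_iso t.
Proof.
move=> /qisP[tsi tss] qs; apply/qisP; split; first exact: coh_inj_left tsi qs.
exact: coh_surj_comp tss.
Qed.

(** [coboundaries X (i + 1)] starts in degree [i + 1 - 1], which equals [i] only propositionally. *)
Lemma coboundariesS X i m (v : 'M[k]_(m, rdegree (X (i + 1)))) :
  (v <= coboundaries X (i + 1))%MS = (v <= bc_diff X i (i + 1))%MS.
Proof. by rewrite /coboundaries addrK. Qed.

Definition acyclic X := forall i, cohomology_zero X i.

End Homotopy.
Lemma zero_rows (k : fieldType) m n (A B : 'M[k]_(m, n)) : m = 0%N -> A = B.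
Proof. by move=> m0; subst m; rewrite [A]flatmx0 [B]flatmx0. Qed.

Lemma zero_cols (k : fieldType) m n (A B : 'M[k]_(m, n)) : n = 0%N -> A = B.
Proof. by move=> n0; subst n; rewrite [A]thinmx0 [B]thinmx0. Qed.

(** * Relative traces and projectivity *)

Section RelativeTrace.

Variables (k : fieldType) (gT : finGroupType) (G : {group gT}).
Implicit Types (M L K : representation k G) (H : {group gT}).

(** The trace from the trivial subgroup to [H], for the conjugation action on linear maps. *)
Definition rtrace M L (H : {set gT}) (u : 'M[k]_(rdegree M, rdegree L)) :=
  \sum_(g in H) M g^-1%g *m u *m L g.

Lemma rtrace_hom M L H (u : 'M[k]_(rdegree M, rdegree L)) :
  H \subset G -> {in H, forall x, M x *m rtrace H u = rtrace H u *m L x}.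
Proof.
move=> sHG x Hx; have Gx := subsetP sHG x Hx.
rewrite mulmx_sumr mulmx_suml (reindex_inj (mulIg x)) /=.
apply: eq_big => [g|g]; first by rewrite groupMr.
rewrite groupMr // => Hg; have Gg := subsetP sHG g Hg.
by rewrite invMg !repr_mxM ?groupV // !mulmxA -(repr_mxM M Gx) ?groupV // mulgV repr_mx1 mul1mx.
Qed.

Lemma rtraceMr M L K H (u : 'M[k]_(rdegree M, rdegree L)) (f : 'M[k]_(rdegree L, rdegree K)) :
  {in H, forall x, L x *m f = f *m K x} -> rtrace H u *m f = rtrace H (u *m f).
Proof.
move=> Hf; rewrite mulmx_suml; apply: eq_bigr => g Hg.
by rewrite -!mulmxA Hf.
Qed.

Lemma rtraceMl M L K H (f : 'M[k]_(rdegree K, rdegree M)) (u : 'M[k]_(rdegree M, rdegree L)) :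
  {in H, forall x, K x *m f = f *m M x} -> f *m rtrace H u = rtrace H (f *m u).
Proof.
move=> Hf; rewrite mulmx_sumr; apply: eq_bigr => g Hg.
by rewrite !mulmxA Hf // groupV.
Qed.

(* Higman's criterion, taken as the definition of projectivity. *)
Definition projective M := exists e : 'M[k]_(rdegree M), @rtrace M M G e = 1%:M.

(** The row space condition gives a linear lift [u] of [h]. Traces commute with module maps on both
    sides, so [rtrace G (e *m u)] followed by [f] is [rtrace G e *m h = h]. *)
Lemma projective_lift M L K (f : 'M[k]_(rdegree L, rdegree K))
    (h : 'M[k]_(rdegree M, rdegree K)) :
  projective M -> @module_hom k gT G L K f -> @module_hom k gT G M K h ->
  (h <= f)%MS -> exists2 u, @module_hom k gT G M L u & u *m f = h.
Proof.
case=> e He Hf Hh /submxP[u hu]; exists (@rtrace M L G (e *m u)).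
  exact: rtrace_hom.
rewrite rtraceMr // -mulmxA -hu -[RHS]mul1mx -He; symmetry; exact: rtraceMr.
Qed.

Lemma projective_retract M L (a : 'M[k]_(rdegree M, rdegree L)) b :
  @module_hom k gT G M L a -> @module_hom k gT G L M b -> a *m b = 1%:M ->
  projective L -> projective M.
Proof.
move=> Ha Hb ab [e He]; exists (a *m e *m b).
rewrite -(@rtraceMr M L M G (a *m e) b Hb).
by rewrite -(@rtraceMl L L M G a e Ha) He mulmx1.
Qed.

Lemma projective_zero M : rdegree M = 0%N -> projective M.
Proof.
by move=> M0; exists 0; exact: zero_rows.
Qed.

End RelativeTrace.

Lemma dependent_choice_int (T : int -> Type) (P : forall i, T i -> Prop) :
  (forall i, exists x, P i x) -> exists x : forall i, T i, forall i, P i (x i).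
Proof.
move=> H; exists (fun i => proj1_sig (constructive_indefinite_description _ (H i))).
by move=> i; case: constructive_indefinite_description.
Qed.

(** [Q] is the invariant that allows one more step down, [R] the relation wanted between
    neighbouring degrees. Outside the range from [a] to [b] nothing has to be solved, so finitely
    many steps remain. Each step alters one degree of a family defined everywhere, so no value has
    to be cast from degree [i + 1 - 1] to [i]. *)
Lemma descending_choice (T : int -> Type) (Q : forall i, T i -> Prop)
    (R : forall i, T i -> T (i + 1) -> Prop) (a b : int) :
  (forall i, exists x : T i, b <= i -> Q i x) ->
  (forall i (x : T i) y, Q i x -> b <= i -> R i x y) ->
  (forall i (x : T i) y, i < a -> R i x y) ->
  (forall i (y : T (i + 1)), Q (i + 1) y -> exists x, Q i x /\ R i x y) ->
  exists x : forall i, T i, forall i, R i (x i) (x (i + 1)).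
Proof.
move=> Qtop Rtop Rbot step.
have ind n : exists x : forall i, T i,
    forall i, b - n%:Z <= i -> Q i (x i) /\ R i (x i) (x (i + 1)).
  elim: n => [|n [x Hx]].
    have [x Hx] := dependent_choice_int Qtop; exists x => i; rewrite subr0 => bi.
    by split; [exact: Hx | apply: Rtop => //; exact: Hx].
  (* The new family agrees with [x] down to [b - n], and its value in degree [b - n - 1] comes from
     [step]. *)
  pose P i (z : T i) := (b - n%:Z <= i -> z = x i) /\
    (i = b - n.+1%:Z -> Q i z /\ R i z (x (i + 1))).
  have [|z Hz] := @dependent_choice_int T P.
    move=> i; have [bi|bi] := boolP (b - n%:Z <= i).
      by exists (x i); split=> // ib; exfalso; lia.
    have [ib|ib] := eqVneq i (b - n.+1%:Z); last first.
      by exists (x i); split=> // /eqP; rewrite (negPf ib).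
    have [|z Hz] := step i (x (i + 1)).
      by apply: (proj1 (Hx _ _)); lia.
    by exists z; split=> // bi'; exfalso; lia.
  exists z => i bi.
  have zS : z (i + 1) = x (i + 1) by apply: (proj1 (Hz _)); lia.
  have [bi'|bi'] := boolP (b - n%:Z <= i).
    by rewrite zS (proj1 (Hz i)) //; apply: Hx.
  by rewrite zS; apply: (proj2 (Hz i)); lia.
have [x Hx] := ind `|b - a|%N; exists x => i.
have [ia|ia] := boolP (i < a); first exact: Rbot.
by apply: (proj2 (Hx i _)); lia.
Qed.

(** * Lifting along quasi-isomorphisms *)

Section Lifting.

Variables (k : fieldType) (gT : finGroupType) (G : {group gT}).
Implicit Types X Y Z W : bcomplex k G.

Definition below (a : int) X := forall i, i < a -> rdegree (X i) = 0%N.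

(* Good truncations of projective resolutions; the term of degree [a] is arbitrary. *)
Definition nice (a : int) X := below a X /\ forall i, a < i -> projective (X i).

(* Acyclicity of the mapping cone of [s]. *)
Lemma qis_cone_exact W Z (s : chain_map W Z) i r
    (x : 'M[k]_(r, rdegree (W (i + 1)))) (y : 'M[k]_(r, rdegree (Z i))) :
  quasi_iso s -> x *m bc_diff W (i + 1) (i + 1 + 1) = 0 ->
  x *m s (i + 1) + y *m bc_diff Z i (i + 1) = 0 ->
  (row_mx x y <= block_mx (- bc_diff W i (i + 1)) (s i) 0 (bc_diff Z (i - 1) i))%MS.
Proof.
move=> /qisP[si ss] xd xy; apply/row_subP=> j; rewrite row_row_mx.
have {}xd : row j x *m bc_diff W (i + 1) (i + 1 + 1) = 0 by rewrite -row_mul xd row0.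
have {}xy : row j x *m s (i + 1) + row j y *m bc_diff Z i (i + 1) = 0.
  by rewrite -!row_mul -linearD /= xy row0.
move: (row j x) (row j y) xd xy => {}x {}y xd xy.
have /submxP[x' Ex] : (x <= bc_diff W i (i + 1))%MS.
  rewrite -coboundariesS; apply: si; first exact/sub_kermxP.
  by rewrite coboundariesS -[_ *m _]opprK (addr0_eq xy) -mulNmx submxMl.
have [|w Zw /submxP[z Ez]] := ss i (y + x' *m s i).
  apply/sub_kermxP; rewrite mulmxDl -mulmxA cm_comm mulmxA -Ex.
  by rewrite [LHS]addrC.
apply/submxP; exists (row_mx (w - x') z).
rewrite mul_row_block mulmx0 addr0; congr row_mx.
  by rewrite mulmxN mulmxBl (sub_kermxP Zw) sub0r opprK.
by rewrite -/(coboundaries Z i) -Ez mulmxBl [RHS]addrC addrA subrK addrK.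
Qed.

(** The map [g] and the homotopy are built together, downwards by degree, as a lift along the
    differential of the acyclic cone of [s]. Above degree [a] the lift can be chosen equivariant by
    projectivity; from degree [a] down it is unique, hence equivariant. *)
Lemma nice_lift (a : int) X W Z (s : chain_map W Z) (f : chain_map X Z) :
  nice a X -> below a W -> below a Z -> quasi_iso s ->
  exists g : chain_map X W, homotopic (chain_comp s g) f.
Proof.
move=> [_ pX] bW bZ qs.
have [b Xb] := bc_bounded X.
(* A candidate in degree [i] is a component of [g] together with the homotopy out of [X i]. The
   latter ranges over all targets [j], although only [j = i - 1] matters, to avoid casts. *)
pose T i : Type := ('M[k]_(rdegree (X i), rdegree (W i)) *
                    (forall j, 'M[k]_(rdegree (X i), rdegree (Z j))))%type.
pose Hom i (t : T i) := module_hom t.1 /\ forall j, module_hom (t.2 j).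
(* These are the cocycle conditions that make the step down to degree [j] solvable. *)
pose Q i (t : T i) := Hom i t /\ forall j, j + 1 = i ->
  bc_diff X j i *m t.1 *m bc_diff W i (i + 1) = 0 /\
  bc_diff X j i *m (t.1 *m s i - f i - t.2 j *m bc_diff Z j i) = 0.
pose R i (t : T i) (t' : T (i + 1)) := Hom i t /\
  t.1 *m bc_diff W i (i + 1) = bc_diff X i (i + 1) *m t'.1 /\
  t.1 *m s i - f i = bc_diff X i (i + 1) *m t'.2 i + t.2 (i - 1) *m bc_diff Z (i - 1) i.
have triv i (t : T i) : rdegree (X i) = 0%N -> Hom i t.
  by move=> X0; split=> [|j] g _; exact: zero_rows.
have triv' i (t : T i) t' : rdegree (X i) = 0%N -> R i t t'.
  by move=> X0; split; [exact: triv | split; exact: zero_rows].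
have X0 (i : int) : b%:Z < i \/ i < - b%:Z -> rdegree (X i) = 0%N.
  by move=> H; apply: Xb; lia.
have [||||t Ht] := @descending_choice T Q R (- b%:Z) (b%:Z + 1).
- move=> i; exists (0, fun j => 0) => bi; split.
    by apply: triv; apply: X0; lia.
  move=> j _; rewrite mulmx0 mul0mx; split=> //.
  have -> : f i = 0 by apply: zero_rows; apply: X0; lia.
  by rewrite !mul0mx !subr0 mulmx0.
- by move=> i x y _ bi; apply: triv'; apply: X0; lia.
- by move=> i x y ia; apply: triv'; apply: X0; lia.
- move=> i [g h] [[/= Hg Hh] /(_ i erefl)[/= gd hd]].
  (* The equations for degree [i] say that [D] sends [(g^i, - h^i)] to [(x, y)]. *)
  pose D := block_mx (- bc_diff W i (i + 1)) (s i) 0 (bc_diff Z (i - 1) i).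
  pose x := - (bc_diff X i (i + 1) *m g).
  pose y := f i + bc_diff X i (i + 1) *m h i.
  pose WZ := dadd_grepr (W i) (Z (i - 1)).
  pose WZ' := dadd_grepr (W (i + 1)) (Z i).
  have HD : @module_hom k gT G WZ WZ' D.
    move=> u Gu; rewrite /= !mulmx_block !(mulmx0, mul0mx, addr0, add0r).
    by rewrite mulmxN mulNmx !bc_diff_hom // cm_hom.
  have Hxy : @module_hom k gT G (X i) WZ' (row_mx x y).
    move=> u Gu; rewrite /= mul_mx_row mul_row_block !(mulmx0, mul0mx, addr0, add0r).
    have Hx : module_hom x by apply/module_homN/module_homM => //; exact: bc_diff_hom.
    have Hy : module_hom y.
      by apply/module_homD/module_homM => //; [exact: cm_hom | exact: bc_diff_hom].
    by rewrite Hx ?Hy.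
  have sxy : (row_mx x y <= D)%MS.
    apply: qis_cone_exact => //; first by rewrite mulNmx gd oppr0.
    rewrite /x /y mulNmx mulmxDl cm_comm -!mulmxA -mulmxDr.
    by move/eqP: hd; rewrite -addrA -opprD mulmxBr subr_eq0 => /eqP ->; rewrite addNr.
  suff [u Hu Eu] : exists2 u, @module_hom k gT G (X i) WZ u & u *m D = row_mx x y.
    move: Eu; rewrite -[u]hsubmxK mul_row_block mulmx0 addr0 => /eq_row_mx[E1 E2].
    pose t2 j : 'M[k]_(rdegree (X i), rdegree (Z j)) :=
      if j == i - 1 then conform_mx 0 (- rsubmx u) else 0.
    have Hul : module_hom (lsubmx u).
      move=> v Gv; have := Hu v Gv; rewrite -[u]hsubmxK /= mul_mx_row mul_row_block.
      by rewrite !mulmx0 addr0 add0r hsubmxK => /eq_row_mx[].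
    have Hur : module_hom (rsubmx u).
      move=> v Gv; have := Hu v Gv; rewrite -[u]hsubmxK /= mul_mx_row mul_row_block.
      by rewrite !mulmx0 addr0 add0r hsubmxK => /eq_row_mx[].
    have Hom_u : Hom i (lsubmx u, t2).
      split=> //= j; rewrite /t2; case: eqP => [->|_]; last exact: module_hom0.
      by rewrite conform_mx_id; apply: module_homN.
    have E1' : lsubmx u *m bc_diff W i (i + 1) = bc_diff X i (i + 1) *m g.
      by rewrite -[LHS]opprK -mulmxN E1 /x opprK.
    have E2' : lsubmx u *m s i - f i
        = bc_diff X i (i + 1) *m h i + t2 (i - 1) *m bc_diff Z (i - 1) i.
      rewrite /t2 eqxx conform_mx_id mulNmx; apply/eqP.
      by rewrite subr_eq eq_sym addrAC subr_eq E2 /y addrC.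
    exists (lsubmx u, t2); split; last by split.
    split=> // j ji /=; rewrite -mulmxA E1' mulmxA bc_diff_sq mul0mx; split=> //.
    have {ji}-> : j = i - 1 by rewrite -ji addrK.
    by rewrite E2' addrK mulmxA bc_diff_sq mul0mx.
  have [ai|ai] := boolP (a < i); first exact: projective_lift (pX i ai) HD Hxy sxy.
  have [u Eu] := submxP sxy; exists u => //.
  (* Below degree [a] the matrix [D] is injective. *)
  have D_inj r (v w : 'M[k]_(r, _)) : v *m D = w *m D -> v = w.
    move=> vw; apply/eqP; rewrite -subr_eq0; set z := v - w.
    have : z *m D = 0 by rewrite mulmxBl vw subrr.
    have Z0 : rdegree (Z (i - 1)) = 0%N by apply: bZ; lia.
    have W0 : rdegree (W (i - 1)) = 0%N by apply: bW; lia.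
    rewrite -[z]hsubmxK mul_row_block mulmx0 addr0 mulmxN -[0]row_mx0 => /eq_row_mx[zd zs].
    rewrite (zero_cols (rsubmx z) 0) // mul0mx addr0 in zs *.
    suff -> : lsubmx z = 0 by rewrite row_mx0.
    apply/row_matrixP => j; rewrite row0; apply/eqP; rewrite -submx0.
    have [si _] := proj1 (qisP s) qs.
    have : (row j (lsubmx z) <= coboundaries W i)%MS.
      apply: si; last by rewrite -row_mul zs row0 sub0mx.
      by apply/sub_kermxP; rewrite -row_mul -[_ *m _]opprK zd oppr0 row0.
    by move/submx_trans; apply; rewrite /coboundaries (zero_rows (bc_diff _ _ _) 0 W0) sub0mx.
  by move=> v Gv; apply: D_inj; rewrite -mulmxA -Eu (Hxy v Gv) Eu -!mulmxA HD.
have tC i : (t i).1 *m bc_diff W i (i + 1) = bc_diff X i (i + 1) *m (t (i + 1)).1.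
  by have [_ []] := Ht i.
pose g := ChainMap (fun i => proj1 (proj1 (Ht i))) (comm_of_succ tC).
exists g, (fun i => (t i).2); split=> [i|i]; first exact: (proj2 (proj1 (Ht i))).
by have [_ []] := Ht i.
Qed.

End Lifting.
(** * Induced modules and projective covers *)

Section Induction.

Variables (k : fieldType) (gT : finGroupType) (G H : {group gT}).
Hypothesis sHG : H \subset G.
Implicit Types (M L : representation k H).

Let t := #|rcosets H G|.
Let rep (c : 'I_t) : gT := repr (enum_val c).

Let rep_coset c : (rep c \in G) && (H :* rep c == enum_val c)%g.
Proof.
rewrite /rep; have /rcosetsP[x Gx ->] := enum_valP c.
rewrite rcoset_repr eqxx andbT; case: repr_rcosetP => y Hy.
by rewrite groupM // (subsetP sHG).
Qed.

Let repG c : rep c \in G. Proof. by case/andP: (rep_coset c). Qed.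

Let rep_exists u : u \in G -> exists2 c, (u * (rep c)^-1)%g \in H
  & forall c', (u * (rep c')^-1)%g \in H -> c' = c.
Proof.
move=> Gu; have HuG : (H :* u)%g \in rcosets H G by rewrite mem_rcosets (subsetP (mulG_subr _ _)).
have e c : (u * (rep c)^-1 \in H)%g = (enum_val c == H :* u)%g.
  have /andP[_ /eqP <-] := rep_coset c.
  by rewrite -mem_rcoset eq_sym (sameP rcoset_eqP eqP).
exists (enum_rank_in HuG (H :* u)%g); first by rewrite e enum_rankK_in.
by move=> c'; rewrite e => /eqP ec; apply: enum_val_inj; rewrite ec enum_rankK_in.
Qed.

(** Extension by zero from [H] to the whole group: the coset sums below then have a single nonzero
    term, and induced matrices need no case distinction. *)
Definition extend0 M (x : gT) := if x \in H then M x else 0.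

Lemma sum_extend0 M u m (F : 'I_t -> 'M[k]_(rdegree M, m)) w : u \in G ->
  (forall c, (u * (rep c)^-1)%g \in H -> M (u * (rep c)^-1)%g *m F c = w) ->
  \sum_c extend0 M (u * (rep c)^-1)%g *m F c = w.
Proof.
move=> /rep_exists[c Hc uc] HF; rewrite (bigD1 c) //= big1 ?addr0 => [|c' nc].
  by rewrite /extend0 Hc HF.
rewrite /extend0; case: ifP => [/uc c'c|]; last by rewrite mul0mx.
by rewrite c'c eqxx in nc.
Qed.

Lemma extend0M M x y : x \in H -> extend0 M (x * y)%g = M x *m extend0 M y.
Proof.
move=> Hx; rewrite /extend0 groupMl //; case: ifP => Hy; last by rewrite mulmx0.
by rewrite repr_mxM.
Qed.

Lemma extend0Mr M x y : y \in H -> extend0 M (x * y)%g = extend0 M x *m M y.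
Proof.
move=> Hy; rewrite /extend0 groupMr //; case: ifP => Hx; last by rewrite mul0mx.
by rewrite repr_mxM.
Qed.

(** Only the coset of [u] contributes. This identity yields the multiplicativity of [ind_mx] and the
    products with [ind_ev] and [ind_in]. *)
Lemma conv_extend0 M u v : u \in G ->
  \sum_c extend0 M (u * (rep c)^-1)%g *m extend0 M (rep c * v)%g = extend0 M (u * v)%g.
Proof.
by move=> Gu; apply: sum_extend0 => // c Hc; rewrite -extend0M // !mulgA mulgKV.
Qed.

Lemma extend0_rep M c c' : extend0 M (rep c * (rep c')^-1)%g = if c == c' then 1%:M else 0.
Proof.
case: eqP => [->|cc']; first by rewrite mulgV /extend0 group1 repr_mx1.
rewrite /extend0; case: ifP => // Hc; case: cc'.
have [d _ ud] := rep_exists (repG c).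
by rewrite (ud c) ?mulgV // (ud c').
Qed.

Definition ind_mx M (x : gT) : 'M[k]_(\sum_(c < t) rdegree M) :=
  \mxblock_(c < t, c' < t) extend0 M (rep c * x * (rep c')^-1)%g.

Lemma ind_mx_repr M : mx_repr G (ind_mx M).
Proof.
split=> [|x y Gx Gy].
  rewrite /ind_mx -[RHS]mxdiagZ; apply: eq_mxblock => c c'.
  by rewrite mulg1 extend0_rep conform_mx_id.
rewrite /ind_mx mul_mxblock; apply: eq_mxblock => c c'.
under eq_bigr do rewrite -[(rep _ * y * _)%g]mulgA.
by rewrite conv_extend0 ?groupM ?repG // !mulgA.
Qed.

Definition ind_module M : representation k G := Representation (MxRepresentation (ind_mx_repr M)).

Definition ind_map M L (f : 'M[k]_(rdegree M, rdegree L)) :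
    'M[k]_(rdegree (ind_module M), rdegree (ind_module L)) :=
  \mxblock_(c < t, c' < t) (if c == c' then f else 0).

Lemma ind_map0 M L : @ind_map M L 0 = 0.
Proof. by rewrite /ind_map -[RHS]mxblock0; apply: eq_mxblock => c c'; rewrite if_same. Qed.

Lemma ind_mapM M L K (f : 'M[k]_(rdegree M, rdegree L)) (g : 'M[k]_(rdegree L, rdegree K)) :
  ind_map (f *m g) = ind_map f *m ind_map g.
Proof.
rewrite /ind_map mul_mxblock; apply: eq_mxblock => c c'.
rewrite (bigD1 c) //= eqxx big1 ?addr0 => [|d /negPf dc].
  by case: eqP => // _; rewrite mulmx0.
by rewrite eq_sym dc mul0mx.
Qed.

Lemma extend0_hom M L (f : 'M[k]_(rdegree M, rdegree L)) x :
  module_hom f -> extend0 M x *m f = f *m extend0 L x.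
Proof.
by move=> Hf; rewrite /extend0; case: ifP => Hx; rewrite ?mul0mx ?mulmx0 ?Hf.
Qed.

Lemma ind_map_hom M L (f : 'M[k]_(rdegree M, rdegree L)) :
  module_hom f -> module_hom (ind_map f).
Proof.
move=> Hf x Gx; rewrite /ind_map /= /ind_mx !mul_mxblock; apply: eq_mxblock => c c'.
rewrite (bigD1 c') //= eqxx big1 ?addr0 => [|d /negPf dc]; last by rewrite dc mulmx0.
rewrite [RHS](bigD1 c) //= eqxx big1 ?addr0 => [|d /negPf dc]; last by rewrite eq_sym dc mul0mx.
exact: extend0_hom.
Qed.

(** [ind_ev] projects onto the block of the coset [H] and [ind_in] includes it. Both are
    [H]-equivariant and exhibit [M] as a summand of the restriction of its induced module. *)
Definition ind_ev M : 'M[k]_(rdegree (ind_module M), rdegree M) :=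
  \mxcol_(c < t) extend0 M (rep c).

Definition ind_in M : 'M[k]_(rdegree M, rdegree (ind_module M)) :=
  \mxrow_(c < t) extend0 M (rep c)^-1%g.

Lemma mul_ind_ev M x : x \in G ->
  ind_module M x *m ind_ev M = \mxcol_(c < t) extend0 M (rep c * x)%g.
Proof.
move=> Gx; rewrite /ind_ev /= /ind_mx mul_mxblock_mxrow; apply: eq_mxcol => c.
under eq_bigr do rewrite -[X in _ *m extend0 _ X]mulg1.
by rewrite conv_extend0 ?mulg1 // groupM.
Qed.

Lemma mul_ind_in M x :
  ind_in M *m ind_module M x = \mxrow_(c < t) extend0 M (x * (rep c)^-1)%g.
Proof.
rewrite /ind_in /= /ind_mx mul_mxrow_mxblock; apply: eq_mxrow => c.
under eq_bigr do rewrite -[(_^-1)%g]mul1g -mulgA.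
by rewrite conv_extend0 // mul1g.
Qed.

Lemma ind_inK M : ind_in M *m ind_ev M = 1%:M.
Proof.
rewrite /ind_in /ind_ev mul_mxrow_mxcol.
under eq_bigr do rewrite -[(_^-1)%g]mul1g -[X in _ *m extend0 _ X]mulg1.
by rewrite conv_extend0 // /extend0 mulg1 group1 repr_mx1.
Qed.

Lemma ind_in_map M L (f : 'M[k]_(rdegree M, rdegree L)) :
  module_hom f -> ind_in M *m ind_map f = f *m ind_in L.
Proof.
move=> Hf; rewrite /ind_in /ind_map mul_mxrow_mxblock mul_mxrow; apply: eq_mxrow => c.
rewrite (bigD1 c) //= eqxx big1 ?addr0 => [|d /negPf ->]; last by rewrite mulmx0.
exact: extend0_hom.
Qed.

Lemma ind_map_ev M L (f : 'M[k]_(rdegree M, rdegree L)) :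
  module_hom f -> ind_map f *m ind_ev L = ind_ev M *m f.
Proof.
move=> Hf; rewrite /ind_ev /ind_map mul_mxblock_mxrow mxcol_mul; apply: eq_mxcol => c.
rewrite (bigD1 c) //= eqxx big1 ?addr0 => [|d /negPf dc]; last by rewrite eq_sym dc mul0mx.
by rewrite extend0_hom.
Qed.

Lemma ind_ev_hom M : {in H, forall x, ind_module M x *m ind_ev M = ind_ev M *m M x}.
Proof.
move=> x Hx; rewrite mul_ind_ev ?(subsetP sHG) // mxcol_mul; apply: eq_mxcol => c.
exact: extend0Mr.
Qed.

Lemma ind_in_hom M : {in H, forall x, M x *m ind_in M = ind_in M *m ind_module M x}.
Proof.
move=> x Hx; rewrite mul_ind_in mul_mxrow; apply: eq_mxrow => c.
by rewrite extend0M.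
Qed.

Definition ind_counit (M : representation k G) :
    'M[k]_(rdegree (ind_module (res_module sHG M)), rdegree M) :=
  \mxcol_(c < t) M (rep c).

Lemma ind_counit_hom (M : representation k G) : module_hom (ind_counit M).
Proof.
move=> x Gx; rewrite /= /ind_mx mul_mxblock_mxrow mxcol_mul; apply: eq_mxcol => c.
apply: (@sum_extend0 (res_module sHG M) (rep c * x)%g _ (fun c => M (rep c))).
  by rewrite groupM.
move=> c' Hc'.
by rewrite /= -!repr_mxM ?groupM ?groupV // mulgKV.
Qed.

Lemma ind_counit_full (M : representation k G) : row_full (ind_counit M).
Proof.
apply/row_fullP; exists (ind_in (res_module sHG M)).
rewrite /ind_in mul_mxrow_mxcol.
under eq_bigr do rewrite -[(_^-1)%g]mul1g.
apply: (@sum_extend0 (res_module sHG M) 1%g _ (fun c => M (rep c))) => // c Hc.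
by rewrite /= -repr_mxM ?groupM ?groupV // mulgKV repr_mx1.
Qed.

End Induction.

Section FreeCover.

Variables (k : fieldType) (gT : finGroupType) (G : {group gT}).

(** [ind_ev *m ind_in] is the projection onto one block. The cosets of the trivial group are the
    elements of [G], so its conjugates are the projections onto all blocks, once each, and they sum
    to the identity. *)
Lemma ind1_projective (M : representation k 1%G) : projective (ind_module (sub1G G) M).
Proof.
pose s1 := sub1G G; exists (ind_ev s1 M *m ind_in s1 M).
have ext1 x : extend0 M x = if x == 1%g then 1%:M else 0.
  by rewrite /extend0 inE; case: eqP => // ->; rewrite repr_mx1.
transitivity (\sum_(g in G) \mxblock_(c < #|rcosets 1 G|, c' < #|rcosets 1 G|)
  (extend0 M (repr (enum_val c) * g^-1)%g *m extend0 M (g * (repr (enum_val c'))^-1)%g)).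
  apply: eq_bigr => g Gg; rewrite mulmxA mul_ind_ev ?groupV // -mulmxA mul_ind_in.
  by rewrite mul_mxcol_mxrow.
rewrite -mxblock_sum -[RHS]mxdiagZ; apply: eq_mxblock => c c'.
rewrite conform_mx_id; set x := repr _; set y := repr _.
have Gx : x \in G.
  rewrite /x; have /rcosetsP[z Gz ->] := enum_valP c.
  by case: repr_rcosetP => w /set1P ->; rewrite mul1g.
have xy : (c == c') = (x == y).
  rewrite -(inj_eq enum_val_inj) /x /y.
  have /rcosetsP[z Gz ->] := enum_valP c; have /rcosetsP[z' Gz' ->] := enum_valP c'.
  apply/eqP/eqP => [-> //|e].
  by rewrite -(rcoset_repr 1%G z) -(rcoset_repr 1%G z') e.
rewrite (bigD1 x) //= big1 ?addr0 => [|g /andP[_ gx]].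
  by rewrite !ext1 mulgV eqxx mul1mx xy -eq_mulgV1.
rewrite !ext1 -eq_mulgV1 (eq_sym x) (negPf gx) mul0mx //.
Qed.

(** The source is induced from the trivial group, hence free: a projective module mapping onto [M],
    in general larger than a minimal cover. *)
Lemma projective_cover (M : representation k G) : exists (P : representation k G)
  (f : 'M[k]_(rdegree P, rdegree M)), [/\ projective P, module_hom f & row_full f].
Proof.
exists (ind_module (sub1G G) (res_module (sub1G G) M)), (ind_counit (sub1G G) M).
by split; [exact: ind1_projective | exact: ind_counit_hom | exact: ind_counit_full].
Qed.

End FreeCover.
(** * Truncated projective resolutions *)

Section Resolutions.

Variables (k : fieldType) (gT : finGroupType) (G : {group gT}).
Implicit Types X Y Z W V : bcomplex k G.

Lemma module_hom_cancel (M L K : representation k G) (f : 'M[k]_(rdegree M, rdegree L))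
    (i : 'M[k]_(rdegree L, rdegree K)) :
  row_free i -> @module_hom k gT G L K i -> @module_hom k gT G M K (f *m i) ->
  @module_hom k gT G M L f.
Proof.
move=> fi Hi Hfi x Gx; apply: (row_free_inj fi).
by rewrite /= -[LHS]mulmxA Hfi // -[LHS]mulmxA -[RHS]mulmxA Hi.
Qed.

(** Boundedness is asked of [U] and not of [E]: in [resolve_step] the ambient module contains [P] in
    every degree. The rows of [U i] merely generate the submodule, which is why [<<U i>>] replaces
    them. *)
Lemma subcomplex (E : int -> representation k G)
    (D : forall i j, 'M[k]_(rdegree (E i), rdegree (E j)))
    (m : int -> nat) (U : forall i, 'M[k]_(m i, rdegree (E i))) :
  (forall i j, module_hom (D i j)) -> (forall i j, j != i + 1 -> D i j = 0) ->
  (forall i j l, D i j *m D j l = 0) ->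
  (forall i, {in G, forall x, (U i *m E i x <= U i)%MS}) ->
  (forall i j, (U i *m D i j <= U j)%MS) ->
  (exists b : nat, forall i, (b < `|i|)%N -> U i = 0) ->
  exists (S : bcomplex k G) (inc : forall i, 'M[k]_(rdegree (S i), rdegree (E i))),
    [/\ forall i, module_hom (inc i), forall i, row_free (inc i),
        forall i, (inc i :=: U i)%MS
      & forall i j, bc_diff S i j *m inc j = inc i *m D i j].
Proof.
move=> HD shD sqD mU UD [b Ub].
pose V i := <<U i>>%MS.
have modV i : mxmodule (E i) (V i).
  apply/mxmoduleP=> x Gx; rewrite genmxE; apply: submx_trans (mU i x Gx).
  by rewrite submxMr // genmxE.
pose S i := Representation (submod_repr (modV i)).
pose inc i : 'M_(rdegree (S i), rdegree (E i)) := @val_submod _ _ (V i) _ 1%:M.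
pose d i j : 'M_(rdegree (S i), rdegree (S j)) := in_submod (V j) (inc i *m D i j).
have incV i : (inc i :=: V i)%MS by exact: val_submod1.
have finc i : row_free (inc i).
  by rewrite /row_free (incV i).
have dinc i j : d i j *m inc j = inc i *m D i j.
  rewrite -val_submodE in_submodK // genmxE; apply: submx_trans (UD i j).
  by rewrite submxMr // (eqmx_trans (incV i) (genmxE _)).
have Hinc i : module_hom (inc i).
  by move=> x Gx; rewrite -val_submodE -[S i x]mul1mx val_submodJ.
have Hd i j : module_hom (d i j).
  by apply: module_hom_cancel (finc j) (Hinc j) _; rewrite dinc; apply: module_homM.
have shd i j : j != i + 1 -> d i j = 0.
  by move=> ij; apply: (row_free_inj (finc j)); rewrite /= dinc shD // mulmx0 mul0mx.
have sqd i j l : d i j *m d j l = 0.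
  apply: (row_free_inj (finc l)).
  by rewrite /= -mulmxA dinc mulmxA dinc -mulmxA sqD mulmx0 mul0mx.
have bS : exists b : nat, forall i, (b < `|i|)%N -> rdegree (S i) = 0%N.
  by exists b => i /Ub U0; rewrite /= genmxE U0 mxrank0.
exists (BComplex Hd shd sqd bS), inc; split=> // i.
exact: eqmx_trans (incV i) (genmxE _).
Qed.

Definition biject (M L : representation k G) (f : 'M[k]_(rdegree M, rdegree L)) :=
  exists r, [/\ @module_hom k gT G L M r, f *m r = 1%:M & r *m f = 1%:M].

(* The degree-[i0] term becomes a projective cover [P -> X i0] and the term below
   it becomes the pullback of [X (i0 - 1) -> X i0 <- P]. *)
Lemma resolve_step X (i0 : int) : exists V (q : chain_map V X),
  [/\ quasi_iso q, forall i, row_full (q i), projective (V i0)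
    & forall i, i != i0 -> i != i0 - 1 -> biject (q i)].
Proof.
have [P [f [pP Hf ff]]] := projective_cover (X i0).
pose E i := dadd_grepr (X i) P.
pose e i j : 'M[k]_(rdegree P) := if (i == i0 - 1) && (j == i0) then 1%:M else 0.
(* [X] is enlarged by the contractible complex [P = P] in degrees [i0 - 1] and [i0]; the copies of
   [P] in other degrees are removed by [K]. *)
pose D i j : 'M[k]_(rdegree (E i), rdegree (E j)) := block_mx (bc_diff X i j) 0 0 (e i j).
pose g i : 'M[k]_(rdegree (X i), rdegree (X i0)) :=
  if i == i0 then conform_mx 0 (1%:M : 'M[k]_(rdegree (X i0))) else bc_diff X i i0.
have g0 : g i0 = 1%:M by rewrite /g eqxx conform_mx_id.
have g1 i : i = i0 - 1 -> g i = bc_diff X i i0.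
  by rewrite /g; case: eqP => // ->; lia.
have Hg i : module_hom (g i).
  rewrite /g; case: eqP => [->|_]; last exact: bc_diff_hom.
  by rewrite conform_mx_id; apply: module_hom1.
pose act i := (i == i0) || (i == i0 - 1).
(* The kernel of [K] is the graph of [f] in degree [i0], which is a copy of [P]; the pullback in
   degree [i0 - 1]; and [X i] elsewhere. *)
pose K i : 'M[k]_(rdegree (E i), rdegree (X i0) + rdegree P) :=
  if act i then block_mx (g i) 0 (- f) 0 else block_mx 0 0 0 1%:M.
pose U i := kermx (K i).
have memU i r (x : 'M[k]_(r, _)) p :
    (row_mx x p <= U i)%MS = if act i then x *m g i == p *m f else p == 0.
  rewrite /U /K; apply/sub_kermxP/idP; case: ifP => _; rewrite mul_row_block.
  - rewrite !mulmx0 addr0 -[X in _ = X]row_mx0 => /eq_row_mx[+ _].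
    by rewrite mulmxN => /eqP; rewrite subr_eq0.
  - by rewrite !mulmx0 !add0r mulmx1 -[X in _ = X]row_mx0 => /eq_row_mx[_ ->].
  - by move=> /eqP ->; rewrite mulmxN subrr !mulmx0 addr0 row_mx0.
  - by move=> /eqP ->; rewrite !mulmx0 !mul0mx !addr0 row_mx0.
have He i j : @module_hom k gT G P P (e i j).
  by rewrite /e; case: ifP => _; [exact: module_hom1 | exact: module_hom0].
have HD i j : module_hom (D i j).
  move=> x Gx; rewrite /= !mulmx_block !(mulmx0, mul0mx, addr0, add0r).
  by rewrite bc_diff_hom // He.
have shD i j : j != i + 1 -> D i j = 0.
  move=> ij; rewrite /D bc_diff_shape // /e; case: ifP => [|_]; last exact: block_mx0.
  by case/andP=> /eqP Ei /eqP Ej; rewrite Ei Ej subrK eqxx in ij.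
have sqD i j l : D i j *m D j l = 0.
  rewrite /D mulmx_block !(mulmx0, mul0mx, addr0, add0r) bc_diff_sq.
  rewrite (_ : e i j *m e j l = 0) ?block_mx0 // /e.
  case: ifP => [/andP[_ /eqP ->]|_]; last by rewrite mul0mx.
  by rewrite (_ : (i0 == i0 - 1) = false) ?mulmx0 //; apply/eqP; lia.
have mulD i j r (x : 'M[k]_(r, _)) p :
    row_mx x p *m D i j = row_mx (x *m bc_diff X i j) (p *m e i j).
  by rewrite mul_row_block !mulmx0 addr0 add0r.
have splitU i : exists x p, U i = row_mx x p /\ (row_mx x p <= U i)%MS.
  by exists (lsubmx (U i)), (rsubmx (U i)); rewrite hsubmxK submx_refl.
have mU i : {in G, forall x, (U i *m E i x <= U i)%MS}.
  move=> u Gu; have [x [p [EU]]] := splitU i.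
  rewrite [X in (X *m _ <= _)%MS]EU /= mul_row_block !mulmx0 addr0 add0r !memU.
  case: ifP => _ /eqP xp; last by rewrite xp mul0mx.
  by rewrite -mulmxA Hg // mulmxA xp -!mulmxA Hf.
have UD i j : (U i *m D i j <= U j)%MS.
  have [Ej|/shD->] := eqVneq j (i + 1); last by rewrite mulmx0 sub0mx.
  have [x [p [EU]]] := splitU i; rewrite [X in (X *m _ <= _)%MS]EU mulD !memU /e.
  have [Ej0|nj0] := eqVneq j i0.
    rewrite Ej0 in Ej *; have Ei : i = i0 - 1 by lia.
    have ai : act i by rewrite /act Ei eqxx orbT.
    by rewrite ai g0 (g1 i Ei) /act eqxx (introT eqP Ei) /= !mulmx1.
  rewrite andbF mulmx0 mul0mx => _; case: ifP => // /orP[|/eqP Ej1].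
    by rewrite (negPf nj0).
  by rewrite g1 // -mulmxA bc_diff_sq mulmx0.
have bU : exists b : nat, forall i, (b < `|i|)%N -> U i = 0.
  have [b Xb] := bc_bounded X; exists (b + `|i0|.+1)%N => i bi.
  have ai : act i = false by apply/negbTE/norP; split; apply/eqP; lia.
  have := submx_refl (U i); rewrite -{1}[U i]hsubmxK memU ai => /eqP p0.
  rewrite -[LHS]hsubmxK p0 (zero_cols (lsubmx _) 0) ?row_mx0 //.
  by apply: Xb; lia.
have [V [inc [Hinc finc incU Dinc]]] := subcomplex HD shD sqD mU UD bU.
have getU i r (x : 'M[k]_(r, _)) p : (row_mx x p <= U i)%MS ->
    exists v, v *m inc i = row_mx x p.
  by rewrite -(incU i) => /submxP[v ->]; exists v.
have getp i r (x : 'M[k]_(r, rdegree (X i))) : exists p, (row_mx x p <= U i)%MS.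
  rewrite /U; case ai: (act i); last by exists 0; rewrite memU ai.
  have /row_fullP[f' f'f] := ff; exists (x *m g i *m f').
  by rewrite memU ai -mulmxA f'f mulmx1.
pose pr i : 'M[k]_(rdegree (E i), rdegree (X i)) := col_mx 1%:M 0.
have Hpr i : module_hom (pr i).
  by move=> x Gx; rewrite /= mul_block_col mul_col_mx !(mulmx0, mul0mx, addr0, mulmx1, mul1mx).
have prE i r (x : 'M[k]_(r, rdegree (X i))) (p : 'M[k]_(r, rdegree P)) :
    row_mx x p *m pr i = x.
  by rewrite mul_row_col mulmx1 mulmx0 addr0.
have Hq i : module_hom (inc i *m pr i) by apply: module_homM.
have qC i : inc i *m pr i *m bc_diff X i (i + 1)
    = bc_diff V i (i + 1) *m (inc (i + 1) *m pr (i + 1)).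
  rewrite mulmxA Dinc -!mulmxA; congr (_ *m _).
  by rewrite /pr /D mul_block_col mul_col_mx !(mulmx0, mul0mx, addr0, mulmx1, mul1mx).
pose q := ChainMap Hq (comm_of_succ qC).
have incE i : exists x p, inc i = row_mx x p /\ (row_mx x p <= U i)%MS.
  exists (lsubmx (inc i)), (rsubmx (inc i)); rewrite hsubmxK; split=> //.
  by rewrite (incU i).
exists V, q; split.
- apply/qisP; split=> i.
  + move=> v /sub_kermxP Zv /submxP[y Ey].
    have [x [p [Ev xpU]]] : exists x p, v *m inc i = row_mx x p /\ (row_mx x p <= U i)%MS.
      exists (lsubmx (v *m inc i)), (rsubmx (v *m inc i)); rewrite hsubmxK; split=> //.
      by rewrite -(incU i) submxMl.
    have Ex : x = y *m bc_diff X (i - 1) i.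
      by rewrite -Ey /= mulmxA Ev prE.
    (* The primitive [y] in [X] must be completed by some [p'] mapped to [p]. For [i = i0] this is
       [p] itself; otherwise [p = 0], in degree [i0 - 1] because [v] is a cocycle. *)
    suff [p' yp' p'e] : exists2 p', (row_mx y p' <= U (i - 1))%MS & p' *m e (i - 1) i = p.
      have [u Eu] := getU _ _ _ _ yp'; apply/submxP; exists u.
      apply: (row_free_inj (finc i)); rewrite /= -mulmxA Dinc mulmxA Eu mulD.
      by rewrite -Ex p'e.
    have [Ei|ni] := eqVneq i i0.
      subst i; exists p; last by rewrite /e !eqxx mulmx1.
      rewrite memU /act eqxx orbT g1 // -Ex.
      by move: xpU; rewrite memU /act eqxx /= g0 mulmx1.
    have p0 : p = 0.
      move: xpU; rewrite memU; case: ifP => [|_ /eqP //].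
      rewrite /act (negPf ni) => /eqP Ei _.
      have : v *m inc i *m D i (i + 1) = 0.
        by rewrite -mulmxA -Dinc mulmxA Zv mul0mx.
      rewrite Ev mulD -[X in _ = X]row_mx0 => /eq_row_mx[_].
      by rewrite /e Ei subrK !eqxx mulmx1.
    have [p' Hp'] := getp (i - 1) _ y; exists p' => //.
    by rewrite /e (negPf ni) andbF mulmx0 p0.
  + move=> x /sub_kermxP Zx.
    suff [p xpU pe] : exists2 p, (row_mx x p <= U i)%MS & p *m e i (i + 1) = 0.
      have [v Ev] := getU _ _ _ _ xpU; exists v; last first.
        by rewrite /= mulmxA Ev prE subrr sub0mx.
      apply/sub_kermxP/(row_free_inj (finc (i + 1))).
      by rewrite /= -mulmxA Dinc mulmxA Ev mulD Zx pe row_mx0 mul0mx.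
    (* In degree [i0 - 1] the completion must be a cocycle, which forces [p = 0]; the pair lies in
       the pullback because [x] is a cocycle. *)
    have [Ei|ni] := eqVneq i (i0 - 1).
      exists 0; last by rewrite mul0mx.
      have Ei' : i0 = i + 1 by lia.
      have ai : act i by rewrite /act Ei eqxx orbT.
      by rewrite memU ai g1 // mul0mx Ei' Zx.
    have [p Hp] := getp i _ x; exists p => //.
    by rewrite /e (negPf ni) mulmx0.
- move=> i; have [p Hp] := getp i _ 1%:M; have [v Ev] := getU _ _ _ _ Hp.
  by apply/row_fullP; exists v; rewrite /= mulmxA Ev prE.
- have [|b Eb] := getU i0 _ f 1%:M; first by rewrite memU /act eqxx /= g0 mulmx1 mul1mx.
  pose a : 'M[k]_(rdegree (V i0), rdegree P) := inc i0 *m col_mx 0 1%:M.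
  have Ha : @module_hom k gT G (V i0) P a.
    apply: (@module_homM _ _ _ _ (E i0)) => // x Gx.
    by rewrite /= mul_block_col mul_col_mx !(mulmx0, mul0mx, add0r, mulmx1, mul1mx).
  apply: (@projective_retract _ _ _ (V i0) P a b) => //.
    apply: module_hom_cancel (finc i0) (Hinc i0) _; rewrite Eb => x Gx.
    by rewrite /= mul_mx_row mul_row_block Hf // !mulmx0 addr0 add0r mulmx1 mul1mx.
  apply: (row_free_inj (finc i0)); rewrite /= -mulmxA Eb /a mul1mx.
  have [x [p [-> ]]] := incE i0; rewrite memU /act eqxx /= g0 mulmx1 => /eqP ->.
  by rewrite mul_row_col mulmx0 add0r mulmx1 mul_mx_row mulmx1.
- move=> i ni ni1; have ai : act i = false by rewrite /act (negPf ni) (negPf ni1).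
  have [|r Er] := getU i _ 1%:M 0; first by rewrite memU ai.
  exists r; split.
  + apply: module_hom_cancel (finc i) (Hinc i) _; rewrite Er => x Gx.
    by rewrite /= mul_mx_row mul_row_block !(mulmx0, mul0mx, addr0) mulmx1 mul1mx.
  + apply: (row_free_inj (finc i)); rewrite /= -mulmxA Er mul1mx.
    have [x [p [-> ]]] := incE i; rewrite memU ai => /eqP ->.
    by rewrite prE mul_mx_row mulmx1 mulmx0.
  + by rewrite /= mulmxA Er prE.
Qed.

End Resolutions.

(** * Truncated resolutions of a complex, and maps out of them *)

Section Models.

Variables (k : fieldType) (gT : finGroupType) (G : {group gT}).
Implicit Types X Y Z W V : bcomplex k G.

Lemma biject1 (M : representation k G) : @biject k gT G M M 1%:M.
Proof. by exists 1%:M; rewrite mulmx1; split=> //; exact: module_hom1. Qed.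

Lemma bijectM (M L K : representation k G) f g :
  @biject k gT G M L f -> @biject k gT G L K g -> @biject k gT G M K (f *m g).
Proof.
case=> r [Hr fr rf] [s [Hs gs sg]]; exists (s *m r); split.
- exact: module_homM.
- by rewrite mulmxA -(mulmxA f) gs mulmx1.
- by rewrite mulmxA -(mulmxA s) rf mulmx1.
Qed.

Lemma biject_zero (M L : representation k G) f :
  @biject k gT G M L f -> rdegree L = 0%N -> rdegree M = 0%N.
Proof.
case=> r [_ fr _] L0; have /row_freeP : exists r, f *m r = 1%:M by exists r.
by rewrite /row_free => /eqP <-; apply/eqP; rewrite -leqn0 -L0 rank_leq_col.
Qed.

Lemma row_full_mul m n p (A : 'M[k]_(m, n)) (B : 'M[k]_(n, p)) :
  row_full A -> row_full B -> row_full (A *m B).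
Proof.
move=> /row_fullP[A' AK] /row_fullP[B' BK]; apply/row_fullP; exists (B' *m A').
by rewrite mulmxA -(mulmxA B') AK mulmx1.
Qed.

(** [resolve_step] is applied in degrees [b], [b - 1], and so on. Each application also replaces the
    next lower term by a pullback, so degree [b - n] is claimed neither projective nor unchanged. *)
Lemma resolution X (b : int) (n : nat) : (forall i, b < i -> projective (X i)) ->
  exists V (q : chain_map V X),
  [/\ quasi_iso q, forall i, row_full (q i),
      forall i, b - n%:Z < i -> projective (V i)
    & forall i, b < i \/ i < b - n%:Z -> biject (q i)].
Proof.
move=> pX; elim: n => [|n [V [q [qq fq pV bq]]]].
  exists X, (chain_id X); split=> //= [|i|i|i _].
  - exact: chain_id_qis.
  - by rewrite row_full_unit unitmx1.
  - by rewrite subr0; exact: pX.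
  - exact: biject1.
have [V' [s [qs fs ps bs]]] := resolve_step V (b - n%:Z).
exists V', (chain_comp q s); split=> [|i|i bi|i bi].
- exact: chain_comp_qis.
- exact: row_full_mul.
- have [->|ni] := eqVneq i (b - n%:Z); first exact: ps.
  have [r [Hr sr rs]] : biject (s i) by apply: bs => //; apply/eqP; lia.
  apply: projective_retract Hr sr _; first exact: cm_hom.
  by apply: pV; move/eqP: ni; lia.
- apply: bijectM; first by apply: bs; apply/eqP; lia.
  by apply: bq; lia.
Qed.

Lemma below_le (a a' : int) X : a' <= a -> below a X -> below a' X.
Proof. by move=> aa' bX i ia; apply: bX; lia. Qed.

Lemma below_ex X : exists a0 : int, forall a, a <= a0 -> below a X.
Proof. by have [b Xb] := bc_bounded X; exists (- b%:Z) => a ab i ia; apply: Xb; lia. Qed.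

Lemma nice_model X : exists a0 : int, forall a, a <= a0 ->
  below a X /\ exists V (q : chain_map V X), nice a V /\ quasi_iso q.
Proof.
have [b Xb] := bc_bounded X; exists (- b%:Z) => a ab.
have bX : below a X by move=> i ia; apply: Xb; lia.
split=> //; have [|V [q [qq _ pV bq]]] := @resolution X b%:Z `|b%:Z - a|%N.
  by move=> i bi; apply: projective_zero; apply: Xb; lia.
exists V, q; split=> //; split=> i ia; last by apply: pV; lia.
by apply: (biject_zero (bq i _)); [lia | exact: bX].
Qed.

Lemma nice_extend (a a' : int) X : nice a X -> a' <= a -> exists V (q : chain_map V X),
  [/\ nice a' V, quasi_iso q, forall i, row_full (q i) & forall i, a < i -> biject (q i)].
Proof.
move=> [bX pX] aa'; have [V [q [qq fq pV bq]]] := @resolution X a `|a - a'|%N pX.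
exists V, q; split=> //; last by move=> i ai; apply: bq; left.
split=> i ia; last by apply: pV; lia.
by apply: (biject_zero (bq i _)); [lia | apply: bX; lia].
Qed.

(* [K^b -> D^b] is faithful on [Hom(X, Z)]. *)
Lemma nice_faithful (a : int) X Z W (f : chain_map X Z) (u : chain_map W X) :
  nice a X -> below a Z -> quasi_iso u -> null_homotopic (chain_comp f u) ->
  null_homotopic f.
Proof.
move=> nX bZ qu fu0; have [a0 bW] := below_ex W.
(* [W] may reach below degree [a], so a longer resolution [V] of [X] is used to lift along [u]. *)
pose a' := Order.min a a0; have a'a : a' <= a by rewrite /a'; lia.
have [V [q [nV qq fq bq]]] := nice_extend nX a'a.
have [l Hl] : exists l, homotopic (chain_comp u l) q.
  apply: nice_lift nV _ _ qu; first by apply: bW; rewrite /a'; lia.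
  by apply: below_le a'a _; case: nX.
have [h [Hh Eh]] : null_homotopic (chain_comp f q).
  have := nullB (null_mull l fu0) (null_mulr f Hl).
  by apply: null_ext => i /=; rewrite mulmxBl mulmxA opprB addrC subrK.
have {}Eh i : q i *m f i = bc_diff V i (i + 1) *m h (i + 1) i
    + h i (i - 1) *m bc_diff Z (i - 1) i by exact: Eh.
have [r Hr] : exists r : forall i, 'M[k]_(rdegree (X i), rdegree (V i)),
    forall i, a < i -> [/\ module_hom (r i), q i *m r i = 1%:M & r i *m q i = 1%:M].
  apply: (@dependent_choice_int _ (fun i r => a < i ->
    [/\ module_hom r, q i *m r = 1%:M & r *m q i = 1%:M])) => i.
  have [/bq[r Hr]|ai] := boolP (a < i); first by exists r.
  by exists 0 => ai'; case/negP: ai.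
(* Above degree [a] the homotopy is transported through the inverse of [q]. From degree [a] down its
   component would land in a zero term of [Z]. *)
exists (fun i j => if a < i then r i *m h i j else 0); split=> [i j|i].
  case: ifP => ai; last exact: module_hom0.
  by apply: module_homM (Hh i j); case: (Hr i ai).
have rd : a < i -> r i *m bc_diff V i (i + 1) = bc_diff X i (i + 1) *m r (i + 1).
  move=> ai; have [_ qr rq] := Hr i ai; have [|_ qr' _] := Hr (i + 1); first by lia.
  by rewrite -[LHS]mulmx1 -qr' mulmxA -(mulmxA (r i)) -cm_comm (mulmxA (r i)) rq mul1mx.
have [ai|ai] := boolP (a < i).
  have ai1 : a < i + 1 by lia.
  have [_ _ rq] := Hr i ai; rewrite ai1 -[f i]mul1mx -rq -mulmxA Eh mulmxDr.
  by rewrite !mulmxA rd.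
have [ia|ia] := boolP (i < a).
  by apply: zero_cols; apply: bZ.
(* In degree [a] the map [q] is only known to be surjective, so the equation is checked after
   composing with it. *)
apply: (row_full_inj (fq i)); rewrite [LHS]Eh mul0mx addr0 ifT; last by lia.
have -> : bc_diff Z (i - 1) i = 0 by apply: zero_rows; apply: bZ; lia.
have [|_ qr _] := Hr (i + 1); first by lia.
rewrite mulmx0 addr0 /= 2!mulmxA cm_comm -(mulmxA (bc_diff V _ _)).
by rewrite qr mulmx1.
Qed.

End Models.
(** * Isomorphism in the derived category *)

Section Equivalence.

Variables (k : fieldType) (gT : finGroupType) (G : {group gT}).
Implicit Types X Y Z W V E A B : bcomplex k G.

Definition qequiv X Y := exists (W : bcomplex k G) (s : chain_map W X) (t : chain_map W Y),
  quasi_iso s /\ quasi_iso t.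

(** On cohomology the hypothesis reads [H(g) H(f) = 1], so [H(f)] is injective and [H(g)]
    surjective. Denominators are quasi-isomorphisms, so this passes to the numerators. *)
Lemma comp_id_inj X Y (f : roof X Y) (g : roof Y X) :
  is_comp g f (roof_id X) -> coh_inj (roof_num f) /\ coh_surj (roof_num g).
Proof.
case=> W [s [t [qs [H [W' [u1 [u2 [qu1 H1 H2]]]]]]]].
have qu2 : quasi_iso u2.
  apply: (qis_right (t := chain_comp (roof_den f) s)).
    exact: qis_homotopic H1 qu1.
  by apply: chain_comp_qis => //; exact: roof_qis.
have qgt : quasi_iso (chain_comp (roof_num g) t).
  by apply: (qis_left (s := u2)) => //; exact: qis_homotopic H2 qu1.
have [gti gts] := proj1 (qisP _) qgt; split; last exact: coh_surj_comp gts.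
apply: (coh_inj_left (s := s)) => //.
apply: coh_inj_homotopic (homotopic_sym H) _ => i v Zv /=; rewrite mulmxA => Bv.
have [di _] := proj1 (qisP _) (@roof_qis _ _ _ _ _ g).
by apply: (coh_inj_comp gti) => //; apply: di => //; exact: cocycles_map.
Qed.

Lemma inverse_num_qis X Y (f : roof X Y) (g : roof Y X) :
  mutually_inverse f g -> quasi_iso (roof_num f).
Proof.
by case=> /comp_id_inj[fi _] /comp_id_inj[_ fs]; apply/qisP.
Qed.

Lemma comp_swap X Y W (s : chain_map W X) (t : chain_map W Y) (qs : quasi_iso s)
    (qt : quasi_iso t) :
  is_comp (Roof s qt) (Roof t qs) (roof_id X).
Proof.
exists W, (chain_id W), (chain_id W), (@chain_id_qis _ _ _ W); split.
  exact: homotopic_refl.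
exists W, s, (chain_id W); split.
- by apply: qis_homotopic qs; apply: homotopic_ext => i /=; rewrite mulmx1.
- by apply: homotopic_ext => i /=; rewrite mulmx1 !mul1mx.
- by apply: homotopic_ext => i /=; rewrite mulmx1 !mul1mx.
Qed.

Lemma num_qis_inverse X Y (f : roof X Y) :
  quasi_iso (roof_num f) -> exists g, mutually_inverse f g.
Proof.
case: f => W s t qs /= qt; exists (Roof s qt); split; exact: comp_swap.
Qed.

Lemma D_isoP X Y : D_iso X Y <-> qequiv X Y.
Proof.
split=> [[f [g fg]]|[W [s [t [qs qt]]]]].
  exists (roof_apex f), (roof_den f), (roof_num f); split; first exact: roof_qis.
  exact: inverse_num_qis fg.
by exists (Roof t qs), (Roof s qt); split; exact: comp_swap.
Qed.

Lemma qequiv_qis X Y (s : chain_map X Y) : quasi_iso s -> qequiv X Y.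
Proof. by exists X, (chain_id X), s; split=> //; exact: chain_id_qis. Qed.

Lemma qequiv_sym X Y : qequiv X Y -> qequiv Y X.
Proof. by case=> W [s [t [qs qt]]]; exists W, t, s. Qed.

Lemma qequiv_refl X : qequiv X X.
Proof. exact: qequiv_qis (@chain_id_qis _ _ _ X). Qed.

Lemma common_below X Y Z : exists a0 : int, forall a, a <= a0 ->
  [/\ below a X, below a Y & below a Z].
Proof.
have [[a aX] [b bY] [c cZ]] := And3 (below_ex X) (below_ex Y) (below_ex Z).
exists (Order.min a (Order.min b c)) => d da.
by split; [apply: aX | apply: bY | apply: cZ]; lia.
Qed.

(** A truncated resolution of [Y] lifts to both apexes and serves as the new apex, in place of a
    homotopy pullback. *)
Lemma qequiv_trans X Y Z : qequiv X Y -> qequiv Y Z -> qequiv X Z.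
Proof.
case=> W [s [t [qs qt]]] [W' [s' [t' [qs' qt']]]].
have [a0 H0] := common_below W W' Y; have [a1 H1] := nice_model Y.
pose a := Order.min a0 a1.
have [bW bW' bY] := H0 a ltac:(rewrite /a; lia).
have [_ [V [q [nV qq]]]] := H1 a ltac:(rewrite /a; lia).
have [l Hl] := nice_lift q nV bW bY qt; have [l' Hl'] := nice_lift q nV bW' bY qs'.
have ql : quasi_iso l by apply: qis_right qt; apply: qis_homotopic (homotopic_sym Hl) qq.
have ql' : quasi_iso l' by apply: qis_right qs'; apply: qis_homotopic (homotopic_sym Hl') qq.
by exists V, (chain_comp s l), (chain_comp t' l'); split; exact: chain_comp_qis.
Qed.

Lemma iso_qis X Y (f : chain_map X Y) :
  (forall i, row_free (f i)) -> (forall i, row_full (f i)) -> quasi_iso f.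
Proof.
move=> ff Ff; apply/qisP; split=> i.
  move=> v _ /submxP[u Eu]; have /row_fullP[r rf] := Ff (i - 1).
  apply/submxP; exists (u *m r); apply: (row_free_inj (ff i)).
  rewrite /= Eu -[RHS]mulmxA -cm_comm mulmxA -(mulmxA u) rf mulmx1 //.
move=> w Zw; have /row_fullP[r rf] := Ff i; exists (w *m r).
  apply/sub_kermxP/(row_free_inj (ff (i + 1))).
  rewrite /= mul0mx -(mulmxA (w *m r)) -cm_comm mulmxA -(mulmxA w) rf mulmx1.
  exact/sub_kermxP.
by rewrite -mulmxA rf mulmx1 subrr sub0mx.
Qed.

Lemma qis_coh0 X Y (s : chain_map X Y) i : quasi_iso s ->
  cohomology_zero X i <-> cohomology_zero Y i.
Proof.
move=> /qisP[si ss]; split=> H; apply/rV_subP => v Zv.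
  have [w Zw Bw] := ss i v Zv; rewrite -(subrK (w *m s i) v) addmx_sub //.
  by apply: coboundaries_map; apply: submx_trans H.
by apply: si => //; apply: submx_trans H; exact: cocycles_map.
Qed.

Lemma qequiv_coh0 X Y i : qequiv X Y -> cohomology_zero X i -> cohomology_zero Y i.
Proof. by case=> W [s [t [/qis_coh0 H /qis_coh0 H']]] /H /H'. Qed.

Lemma acyclic_zero : acyclic (bc_zero k G).
Proof. by move=> i; rewrite /cohomology_zero (zero_rows (cocycles _ _) 0) ?sub0mx. Qed.

Lemma qequiv0P X : qequiv X (bc_zero k G) <-> acyclic X.
Proof.
split=> [/qequiv_sym H i|aX]; first exact: qequiv_coh0 H (acyclic_zero i).
apply: (qequiv_qis (s := chain_zero _ _)); apply/qisP; split=> i.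
  by move=> v Zv _; apply: submx_trans (aX i).
by move=> w _; exists 0; [exact: sub0mx | rewrite (zero_cols (w - _) 0) ?sub0mx].
Qed.

Lemma qis_null_acyclic X Y (f : chain_map X Y) :
  quasi_iso f -> null_homotopic f -> acyclic Y.
Proof.
move=> /qisP[fi fs] f0 i; apply/rV_subP => w Zw; have [v Zv Bv] := fs i w Zw.
by rewrite -(subrK (v *m f i) w) addmx_sub // (null_coh f0).
Qed.

Section SumMaps.

Variables (X Y Z : bcomplex k G) (f : chain_map X Z) (g : chain_map Y Z).

Lemma sum_out_hom i : @module_hom k gT G (bc_sum X Y i) (Z i) (col_mx (f i) (g i)).
Proof.
move=> x Gx; rewrite /= mul_block_col mul_col_mx !mul0mx addr0 add0r.
by rewrite !cm_hom.
Qed.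

Lemma sum_out_comm i j :
  col_mx (f i) (g i) *m bc_diff Z i j = bc_diff (bc_sum X Y) i j *m col_mx (f j) (g j).
Proof. by rewrite /= mul_block_col mul_col_mx !mul0mx addr0 add0r !cm_comm. Qed.

Definition sum_out : chain_map (bc_sum X Y) Z := ChainMap sum_out_hom sum_out_comm.

End SumMaps.

Section SumMaps2.

Variables (X Y Z : bcomplex k G) (f : chain_map X Y) (g : chain_map X Z).

Lemma sum_in_hom i : @module_hom k gT G (X i) (bc_sum Y Z i) (row_mx (f i) (g i)).
Proof.
move=> x Gx; rewrite /= mul_row_block mul_mx_row !mulmx0 addr0 add0r.
by rewrite !cm_hom.
Qed.

Lemma sum_in_comm i j :
  row_mx (f i) (g i) *m bc_diff (bc_sum Y Z) i j = bc_diff X i j *m row_mx (f j) (g j).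
Proof. by rewrite /= mul_row_block mul_mx_row !mulmx0 addr0 add0r !cm_comm. Qed.

Definition sum_in : chain_map X (bc_sum Y Z) := ChainMap sum_in_hom sum_in_comm.

End SumMaps2.

Definition sum_inl X Y : chain_map X (bc_sum X Y) := sum_in (chain_id X) (chain_zero X Y).
Definition sum_inr X Y : chain_map Y (bc_sum X Y) := sum_in (chain_zero Y X) (chain_id Y).
Definition sum_fst X Y : chain_map (bc_sum X Y) X := sum_out (chain_id X) (chain_zero Y X).
Definition sum_snd X Y : chain_map (bc_sum X Y) Y := sum_out (chain_zero X Y) (chain_id Y).
Definition sum_map X Y X' Y' (f : chain_map X X') (g : chain_map Y Y') :=
  sum_in (chain_comp f (sum_fst X Y)) (chain_comp g (sum_snd X Y)).

Lemma sum_mapE X Y X' Y' (f : chain_map X X') (g : chain_map Y Y') i :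
  sum_map f g i = block_mx (f i) 0 0 (g i).
Proof. by rewrite /= !mul_col_mx !mul1mx !mul0mx block_mxEh. Qed.

Lemma sub_row_diag m n p q r (x : 'M[k]_(r, m)) (y : 'M[k]_(r, n))
    (A : 'M[k]_(p, m)) (B : 'M[k]_(q, n)) :
  (row_mx x y <= block_mx A 0 0 B)%MS = (x <= A)%MS && (y <= B)%MS.
Proof.
apply/submxP/andP=> [[u]|[/submxP[u ->] /submxP[v ->]]].
  rewrite -[u]hsubmxK mul_row_block !mulmx0 addr0 add0r => /eq_row_mx[-> ->].
  by rewrite !submxMl.
by exists (row_mx u v); rewrite mul_row_block !mulmx0 addr0 add0r.
Qed.

Lemma sum_cocycle X Y i r (x : 'M[k]_(r, rdegree (X i))) (y : 'M[k]_(r, rdegree (Y i))) :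
  (row_mx x y <= cocycles (bc_sum X Y) i)%MS = (x <= cocycles X i)%MS && (y <= cocycles Y i)%MS.
Proof.
apply/sub_kermxP/andP; rewrite /= mul_row_block !mulmx0 addr0 add0r.
  by rewrite -[X in _ = X]row_mx0 => /eq_row_mx[xd yd]; split; apply/sub_kermxP.
by case=> /sub_kermxP -> /sub_kermxP ->; rewrite row_mx0.
Qed.

Lemma sum_coh0 X Y i :
  cohomology_zero (bc_sum X Y) i <-> cohomology_zero X i /\ cohomology_zero Y i.
Proof.
split=> [H|[HX HY]].
  split; apply/rV_subP => v Zv.
    have : (row_mx v (0 : 'rV_(rdegree (Y i))) <= coboundaries (bc_sum X Y) i)%MS.
      by apply: submx_trans H; rewrite sum_cocycle Zv sub0mx.
    by rewrite sub_row_diag => /andP[].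
  have : (row_mx (0 : 'rV_(rdegree (X i))) v <= coboundaries (bc_sum X Y) i)%MS.
    by apply: submx_trans H; rewrite sum_cocycle Zv sub0mx.
  by rewrite sub_row_diag => /andP[].
apply/rV_subP => v; rewrite -[v]hsubmxK sum_cocycle sub_row_diag.
by case/andP=> /submx_trans -> // /submx_trans ->.
Qed.

Lemma sum_map_qis X Y X' Y' (f : chain_map X X') (g : chain_map Y Y') :
  quasi_iso f -> quasi_iso g -> quasi_iso (sum_map f g).
Proof.
move=> /qisP[fi fs] /qisP[gi gs]; apply/qisP; split=> i v.
  rewrite sum_mapE -[v]hsubmxK mul_row_block !mulmx0 addr0 add0r.
  rewrite sum_cocycle !sub_row_diag => /andP[Zl Zr] /andP[Bl Br].
  by rewrite fi ?gi.
rewrite -[v]hsubmxK sum_cocycle => /andP[/fs[x Zx Bx] /gs[y Zy By]].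
exists (row_mx x y); first by rewrite sum_cocycle Zx.
rewrite sum_mapE mul_row_block !mulmx0 addr0 add0r opp_row_mx add_row_mx.
by rewrite sub_row_diag Bx.
Qed.

Lemma qequiv_sum X Y X' Y' : qequiv X X' -> qequiv Y Y' -> qequiv (bc_sum X Y) (bc_sum X' Y').
Proof.
case=> W [s [t [qs qt]]] [W' [s' [t' [qs' qt']]]].
by exists (bc_sum W W'), (sum_map s s'), (sum_map t t'); split; exact: sum_map_qis.
Qed.

Lemma qequiv_split E A B (i : chain_map A E) (j : chain_map B E) :
  (forall n, row_free (col_mx (i n) (j n))) -> (forall n, row_full (col_mx (i n) (j n))) ->
  qequiv (bc_sum A B) E.
Proof. by move=> H1 H2; apply: (qequiv_qis (s := sum_out i j)); exact: iso_qis. Qed.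

Lemma mulmx_rV_id n (A : 'M[k]_n) : (forall v : 'rV_n, v *m A = v) -> A = 1%:M.
Proof. by move=> H; apply/row_matrixP => i; rewrite rowE H row1. Qed.

Lemma qequiv_inverse X Y (f : chain_map X Y) (g : chain_map Y X) :
  (forall i (v : 'rV_(rdegree (X i))), v *m f i *m g i = v) ->
  (forall i (v : 'rV_(rdegree (Y i))), v *m g i *m f i = v) -> qequiv X Y.
Proof.
move=> fg gf; apply: (qequiv_qis (s := f)); apply: iso_qis => i.
  by apply/row_freeP; exists (g i); apply: mulmx_rV_id => v; rewrite mulmxA fg.
by apply/row_fullP; exists (g i); apply: mulmx_rV_id => v; rewrite mulmxA gf.
Qed.

Lemma qequiv_sumC A B : qequiv (bc_sum A B) (bc_sum B A).
Proof.
apply: (qequiv_inverse (f := sum_out (sum_inr B A) (sum_inl B A))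
                       (g := sum_out (sum_inr A B) (sum_inl A B))) => i v;
  rewrite -[v]hsubmxK /=;
  by rewrite !(mul_mx_row, mul_row_col, mulmx0, mulmx1, addr0, add0r, add_row_mx).
Qed.

Lemma qequiv_sumA A B Z : qequiv (bc_sum (bc_sum A B) Z) (bc_sum A (bc_sum B Z)).
Proof.
pose f := sum_out (sum_out (sum_inl A (bc_sum B Z)) (chain_comp (sum_inr A _) (sum_inl B Z)))
  (chain_comp (sum_inr A _) (sum_inr B Z)).
pose g := sum_out (chain_comp (sum_inl _ Z) (sum_inl A B))
  (sum_out (chain_comp (sum_inl _ Z) (sum_inr A B)) (sum_inr (bc_sum A B) Z)).
apply: (qequiv_inverse (f := f) (g := g)) => i v; rewrite -[v]hsubmxK.
  rewrite -[lsubmx v]hsubmxK /=.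
  by rewrite !(mul_mx_row, mul_row_col, mulmx0, mul0mx, mulmx1, addr0, add0r, add_row_mx, mulmxA).
rewrite -[rsubmx v]hsubmxK /=.
by rewrite !(mul_mx_row, mul_row_col, mulmx0, mul0mx, mulmx1, addr0, add0r, add_row_mx, mulmxA).
Qed.

(** The complement is the kernel of [p], taken as a subcomplex. *)
Lemma qequiv_retract Y E (i : chain_map Y E) (p : chain_map E Y) :
  (forall n, i n *m p n = 1%:M) -> exists Z, qequiv (bc_sum Y Z) E.
Proof.
move=> ip.
have [||||||S [inc [Hinc finc incU Dinc]]] :=
    @subcomplex k gT G E (bc_diff E) _ (fun n => kermx (p n)).
- exact: bc_diff_hom.
- exact: bc_diff_shape.
- exact: bc_diff_sq.
- move=> n x Gx; apply/sub_kermxP; rewrite -mulmxA cm_hom // mulmxA mulmx_ker mul0mx //.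
- by move=> n m; apply/sub_kermxP; rewrite -mulmxA -cm_comm mulmxA mulmx_ker mul0mx.
- by have [b Eb] := bc_bounded E; exists b => n bn; apply: zero_rows; exact: Eb.
have cinc n m : inc n *m bc_diff E n m = bc_diff S n m *m inc m by rewrite Dinc.
pose j := ChainMap Hinc cinc.
have jp n : inc n *m p n = 0 by apply/sub_kermxP; rewrite incU.
exists S; apply: (qequiv_split (i := i) (j := j)) => n.
  rewrite -kermx_eq0 -submx0; apply/rV_subP => v /sub_kermxP.
  rewrite -[v]hsubmxK mul_row_col; set x := lsubmx v; set y := rsubmx v => xy.
  have x0 : x = 0.
    have : (x *m i n + y *m j n) *m p n = 0 by rewrite xy mul0mx.
    by rewrite mulmxDl -!mulmxA ip jp mulmx1 mulmx0 addr0.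
  rewrite x0 mul0mx add0r in xy.
  have y0 : y = 0 by apply: (row_free_inj (finc n)); rewrite /= xy mul0mx.
  by rewrite x0 y0 row_mx0 sub0mx.
have /submxP[z Ez] : (1%:M - p n *m i n <= inc n)%MS.
  by rewrite incU; apply/sub_kermxP; rewrite mulmxBl mul1mx -mulmxA ip mulmx1 subrr.
apply/row_fullP; exists (row_mx (p n) z); rewrite mul_row_col -Ez.
by rewrite addrC subrK.
Qed.

End Equivalence.
(** * Fitting's lemma *)

Section Fitting.

Variables (k : fieldType) (gT : finGroupType) (G : {group gT}).
Implicit Types X Y Z W V : bcomplex k G.

(** The map lifts up to homotopy along the quasi-isomorphism from the zero complex. *)
Lemma null_acyclic (a : int) X Z (f : chain_map X Z) :
  nice a X -> below a Z -> acyclic Z -> null_homotopic f.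
Proof.
move=> nX bZ aZ; have q0 : quasi_iso (chain_zero (bc_zero k G) Z).
  apply/qisP; split=> i v; first by rewrite (zero_cols v 0) ?sub0mx.
  by move=> Zv; exists 0; [exact: sub0mx | rewrite mul0mx subr0; exact: submx_trans (aZ i)].
have b0 : below a (bc_zero k G) by [].
have [g] := nice_lift f nX b0 bZ q0.
by move=> /nullN; apply: null_ext => i /=; rewrite mulmx0 sub0r opprK.
Qed.

Lemma factor_through V E B (f : chain_map V E) (j : chain_map B E) :
  (forall i, row_free (j i)) -> (forall i, (f i <= j i)%MS) ->
  exists g : chain_map V B, forall i, g i *m j i = f i.
Proof.
move=> fj sfj; pose g i := f i *m pinvmx (j i).
have gj i : g i *m j i = f i by rewrite mulmxKpV.
have Hg i : module_hom (g i).
  by apply: module_hom_cancel (fj i) (cm_hom j i) _; rewrite gj; exact: cm_hom.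
have Cg m n : g m *m bc_diff B m n = bc_diff V m n *m g n.
  apply: (row_free_inj (fj n)).
  by rewrite /= -[RHS]mulmxA gj -[LHS]mulmxA -cm_comm mulmxA gj cm_comm.
by exists (ChainMap Hg Cg).
Qed.

Lemma sum_inr_qis X Y : acyclic X -> quasi_iso (sum_inr X Y).
Proof.
move=> aX; apply/qisP; split=> i v.
  by move=> _; rewrite /= mul_mx_row mulmx0 mulmx1 sub_row_diag => /andP[].
rewrite -[v]hsubmxK sum_cocycle => /andP[Zl Zr]; exists (rsubmx v) => //.
rewrite /= mul_mx_row mulmx0 mulmx1 opp_row_mx add_row_mx subr0 subrr.
by rewrite sub_row_diag sub0mx andbT; apply: submx_trans (aX i).
Qed.

Lemma noninc_stable (f : nat -> nat) : (forall n, f n.+1 <= f n)%N ->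
  exists n, forall m, (n <= m)%N -> f m = f n.
Proof.
move=> Hf; have mono m n : (m <= n)%N -> (f n <= f m)%N.
  by move=> /subnK <-; elim: (n - m)%N => // d IH; apply: leq_trans (Hf _) IH.
suff H v : forall n, (f n <= v)%N -> exists n,
    forall m, (n <= m)%N -> f m = f n by exact: H (leqnn (f 0%N)).
elim: v => [|v IH] n fn.
  exists n => m nm; apply/eqP; rewrite eqn_leq mono //=; lia.
have [[m [nm fm]]|H] := classic (exists m, (n <= m)%N /\ f m != f n).
  by apply: (IH m); have := mono _ _ nm; move: fm; lia.
exists n => m nm; apply/eqP/negPn/negP => fm; apply: H; by exists m.
Qed.

Fixpoint iterc X (f : chain_map X X) n : chain_map X X :=
  if n is n'.+1 then chain_comp f (iterc f n') else chain_id X.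

Lemma iterc_add X (f : chain_map X X) m n i : iterc f (m + n)%N i = iterc f m i *m iterc f n i.
Proof.
elim: n => [|n IH]; first by rewrite addn0 mulmx1.
by rewrite addnS /= IH mulmxA.
Qed.

(** By boundedness the ranks of the iterates stabilise in all degrees at once, so [V] splits as a
    complex into kernel and image of a high power [F]. Indecomposability makes one of them acyclic.
    If it is the kernel, [f] is a quasi-isomorphism; if it is the image, [F] factors through an
    acyclic complex. *)
Lemma fitting (a : int) V (f : chain_map V V) : nice a V -> D_indecomposable V ->
  quasi_iso f \/ exists n, null_homotopic (iterc f n).
Proof.
move=> nV [_ indV].
have [n Hn] : exists n, forall i m, (n <= m)%N -> \rank (iterc f m i) = \rank (iterc f n i).
  have stab i : exists n, forall m, (n <= m)%N -> \rank (iterc f m i) = \rank (iterc f n i).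
    by apply: noninc_stable => n; apply: mxrankM_maxl.
  have [b Vb] := bc_bounded V.
  suff [n Hn] : exists n, forall i : int, (`|i| < b.+1)%N -> forall m, (n <= m)%N ->
      \rank (iterc f m i) = \rank (iterc f n i).
    exists n => i m nm; have [ib|ib] := ltnP `|i| b.+1; first exact: Hn.
    have V0 := Vb i ib; apply: etrans (_ : 0%N = _).
      by apply/eqP; rewrite -leqn0 -V0 rank_leq_row.
    by apply/esym/eqP; rewrite -leqn0 -V0 rank_leq_row.
  elim: b.+1 => [|c [n0 IH]]; first by exists 0%N.
  have [n1 H1] := stab c%:Z; have [n2 H2] := stab (- c%:Z).
  exists (n0 + n1 + n2)%N => i ic m nm.
  have [ic'|ic'] := ltnP `|i| c; first by rewrite (IH i) ?[RHS](IH i) //; lia.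
  have [->|->] : i = c%:Z \/ i = - c%:Z by lia.
    by rewrite H1 ?[RHS]H1 //; lia.
  by rewrite H2 ?[RHS]H2 //; lia.
(* The positive exponent lets one factor [f] be split off [F] at either end. *)
pose F := iterc f n.+1.
have FF i : \rank (F i *m F i) = \rank (F i).
  by rewrite -iterc_add !(Hn i) //; lia.
have cap0 i : (F i :&: kermx (F i) = 0)%MS.
  have := mxrank_mul_ker (F i) (F i); rewrite FF => /eqP.
  by rewrite -[X in _ == X]addn0 eqn_add2l mxrank_eq0 => /eqP.
have bsub (m : int -> nat) (U : forall i, 'M[k]_(m i, rdegree (V i))) :
    exists b : nat, forall i, (b < `|i|)%N -> U i = 0.
  by have [b Vb] := bc_bounded V; exists b => i bi; apply: zero_cols; exact: Vb.
have [|||A [iA [HiA fiA eiA DA]]] := @subcomplex k gT G V (bc_diff V) _ (fun i => kermx (F i))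
    (@bc_diff_hom _ _ _ V) (@bc_diff_shape _ _ _ V) (@bc_diff_sq _ _ _ V).
- by move=> i x Gx; apply/sub_kermxP; rewrite -mulmxA cm_hom // mulmxA mulmx_ker mul0mx.
- by move=> i j; apply/sub_kermxP; rewrite -mulmxA -cm_comm mulmxA mulmx_ker mul0mx.
- exact: bsub.
have [|||B [iB [HiB fiB eiB DB]]] := @subcomplex k gT G V (bc_diff V) _ (fun i => F i)
    (@bc_diff_hom _ _ _ V) (@bc_diff_shape _ _ _ V) (@bc_diff_sq _ _ _ V).
- by move=> i x Gx; rewrite -cm_hom // submxMl.
- by move=> i j; rewrite cm_comm submxMl.
- exact: bsub.
pose jA := ChainMap HiA (fun i j => esym (DA i j)).
pose jB := ChainMap HiB (fun i j => esym (DB i j)).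
have rkAB i : \rank (col_mx (jA i) (jB i)) = rdegree (V i).
  rewrite -addsmxE (adds_eqmx (eiA i) (eiB i)) addsmxC mxrank_disjoint_sum //.
  by rewrite mxrank_ker subnKC // rank_leq_row.
have frAB i : row_free (col_mx (jA i) (jB i)).
  rewrite /row_free rkAB; have := fiA i; have := fiB i; rewrite /row_free eiA eiB.
  by move=> /eqP <- /eqP <-; rewrite mxrank_ker subnK // rank_leq_row.
have fuAB i : row_full (col_mx (jA i) (jB i)) by rewrite /row_full rkAB.
have VAB : qequiv V (bc_sum A B) by apply: qequiv_sym; apply: (qequiv_split (i := jA) (j := jB)).
have [F' EF'] : exists F' : chain_map V B, forall i, F' i *m jB i = F i.
  by apply: factor_through => // i; rewrite eiB.
have [/D_isoP/qequiv0P aA|/D_isoP/qequiv0P aB] := indV A B (proj2 (D_isoP _ _) VAB).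
  left; have qjB : quasi_iso jB.
    apply: (@qis_homotopic _ _ _ _ _ (chain_comp (sum_out jA jB) (sum_inr A B))).
      by apply: homotopic_ext => i /=; rewrite mul_row_col mul0mx add0r mul1mx.
    by apply: chain_comp_qis; [exact: iso_qis | exact: sum_inr_qis].
  have qF' : quasi_iso F'.
    apply: (qis_left (s := jB)) => //.
    have fr i : row_free (jB i *m F' i).
      rewrite -kermx_eq0 -submx0; apply/rV_subP => v /sub_kermxP vF.
      have : (v *m jB i <= F i :&: kermx (F i))%MS.
        rewrite sub_capmx -{1}(eiB i) submxMl; apply/sub_kermxP.
        by rewrite -EF' mulmxA -(mulmxA v) vF mul0mx.
      rewrite cap0 !submx0 => /eqP vB.
      by apply/eqP; apply: (row_free_inj (fiB i)); rewrite /= vB mul0mx.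
    by apply: iso_qis => i; rewrite ?row_full_unit -?row_free_unit; exact: fr.
  have qF : quasi_iso F.
    apply: (@qis_homotopic _ _ _ _ _ (chain_comp jB F')); last exact: chain_comp_qis.
    by apply: homotopic_ext => i; rewrite -EF'.
  have [_ Fs] := proj1 (qisP _) qF; apply/qisP; split; last exact: coh_surj_comp Fs.
  have : quasi_iso (chain_comp (iterc f n) f).
    apply: qis_homotopic qF; apply: homotopic_ext => i.
    by rewrite /F -(add1n n) iterc_add /= mul1mx.
  by move=> /qisP[/coh_inj_comp].
right; exists n.+1; have [bV _] := nV.
apply: null_ext (null_mulr jB (null_acyclic F' nV _ aB)) => // i ia.
have := fiB i; rewrite /row_free eiB => /eqP <-.
by apply/eqP; rewrite -leqn0 -(bV i ia) rank_leq_row.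
Qed.

End Fitting.
(** * Roofs, shifts and restriction on truncated resolutions *)

Section Roofs.

Variables (k : fieldType) (gT : finGroupType) (G : {group gT}).
Implicit Types X Y Z W V : bcomplex k G.

Lemma roof_eq_zero X Y V (r : roof X Y) (s : chain_map V X) (l : chain_map V (roof_apex r)) :
  quasi_iso s -> homotopic (chain_comp (roof_den r) l) s ->
  null_homotopic (chain_comp (roof_num r) l) -> roof_eq r (roof_zero X Y).
Proof.
move=> qs H N; exists V, l, s; split.
- exact: qis_homotopic (homotopic_sym H) qs.
- by apply: homotopic_trans H _; apply: homotopic_ext => i /=; rewrite mulmx1.
- by apply: null_ext N => i /=; rewrite mulmx0 subr0.
Qed.

Lemma roof_zero_null (a : int) X Z (f : chain_map X Z) : nice a X -> below a Z ->
  roof_eq (roof_of_chain f) (roof_zero X Z) -> null_homotopic f.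
Proof.
move=> nX bZ [W [u1 [u2 [qu _ H]]]].
have qu1 : quasi_iso u1 by apply: qis_homotopic qu; apply: homotopic_ext => i /=; rewrite mulmx1.
apply: (nice_faithful nX bZ qu1); apply: null_ext H => i /=.
by rewrite mulmx0 subr0.
Qed.

Lemma division_qis (a : int) X (f : chain_map X X) : nice a X -> D_End_division X ->
  ~ null_homotopic f -> quasi_iso f.
Proof.
move=> nX [_ dX] f0; have [|g fg] := dX (roof_of_chain f); last exact: inverse_num_qis fg.
by move=> r0; apply: f0; exact: roof_zero_null nX (proj1 nX) r0.
Qed.

(** Lifting the identity gives a right inverse [g] of [f], which is again a quasi-isomorphism and so
    has a right inverse [h]; then [h] agrees with [f] up to homotopy. *)
Lemma nice_whitehead (a : int) X Y (f : chain_map X Y) : nice a X -> nice a Y -> quasi_iso f ->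
  exists g : chain_map Y X, homotopic (chain_comp f g) (chain_id Y) /\
    homotopic (chain_comp g f) (chain_id X).
Proof.
move=> nX nY qf; have [bX _] := nX; have [bY _] := nY.
have [g fg] := nice_lift (chain_id Y) nY bX bY qf.
have qg : quasi_iso g.
  by apply: qis_right qf; apply: qis_homotopic (homotopic_sym fg) (@chain_id_qis _ _ _ Y).
have [h gh] := nice_lift (chain_id X) nX bY bX qg; exists g; split=> //.
have hf : homotopic h f.
  have H1 := homotopic_comp gh (homotopic_refl f).
  have H2 := homotopic_comp (homotopic_refl h) fg.
  apply: (@homotopic_trans _ _ _ _ _ _ (chain_comp (chain_comp f g) h)).
    apply: homotopic_trans _ (homotopic_sym H2).
    by apply: homotopic_ext => i /=; rewrite mulmx1.
  apply: homotopic_trans (_ : homotopic _ (chain_comp f (chain_comp g h))) _.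
    by apply: homotopic_ext => i /=; rewrite mulmxA.
  by apply: homotopic_trans H1 _; apply: homotopic_ext => i /=; rewrite mul1mx.
apply: homotopic_trans (homotopic_comp (homotopic_sym hf) (homotopic_refl g)) gh.
Qed.

Lemma projective_sum (M L : representation k G) :
  projective M -> projective L -> projective (dadd_grepr M L).
Proof.
move=> [e He] [e' He'].
pose p1 : 'M[k]_(rdegree (dadd_grepr M L), rdegree M) := col_mx 1%:M 0.
pose p2 : 'M[k]_(rdegree (dadd_grepr M L), rdegree L) := col_mx 0 1%:M.
pose i1 : 'M[k]_(rdegree M, rdegree (dadd_grepr M L)) := row_mx 1%:M 0.
pose i2 : 'M[k]_(rdegree L, rdegree (dadd_grepr M L)) := row_mx 0 1%:M.
have H1 : module_hom p1.
  by move=> x Gx; rewrite /= mul_block_col mul_col_mx !(mulmx0, mul0mx, addr0, mulmx1, mul1mx).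
have H2 : module_hom p2.
  by move=> x Gx; rewrite /= mul_block_col mul_col_mx !(mulmx0, mul0mx, add0r, mulmx1, mul1mx).
have H3 : module_hom i1.
  by move=> x Gx; rewrite /= mul_row_block mul_mx_row !(mulmx0, mul0mx, addr0, mulmx1, mul1mx).
have H4 : module_hom i2.
  by move=> x Gx; rewrite /= mul_row_block mul_mx_row !(mulmx0, mul0mx, add0r, mulmx1, mul1mx).
exists (p1 *m e *m i1 + p2 *m e' *m i2).
have tD (u v : 'M[k]_(rdegree (dadd_grepr M L))) :
    @rtrace _ _ _ (dadd_grepr M L) (dadd_grepr M L) G (u + v) = rtrace G u + rtrace G v.
  by rewrite -big_split; apply: eq_bigr => g _; rewrite mulmxDr mulmxDl.
rewrite tD -(@rtraceMr _ _ _ (dadd_grepr M L) M _ G (p1 *m e) i1 H3).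
rewrite -(@rtraceMr _ _ _ (dadd_grepr M L) L _ G (p2 *m e') i2 H4).
rewrite -(@rtraceMl _ _ _ M M _ G p1 e H1) -(@rtraceMl _ _ _ L L _ G p2 e' H2) He He'.
rewrite !mulmx1 /p1 /p2 /i1 /i2 !mul_col_mx !mul0mx !mul1mx add_col_mx add0r addr0.
by rewrite -[LHS]block_mxEv -scalar_mx_block.
Qed.

(** Turns a summand in the derived category into a retract up to homotopy. The bound [a0] is fixed
    before the model [X'] is chosen, so one [X'] can serve several summands. *)
Lemma summand_model X Y : D_summand Y X -> exists a0 : int, forall a, a <= a0 ->
  forall X' (q : chain_map X' X), nice a X' -> quasi_iso q ->
  exists V (s : chain_map V Y) (i : chain_map V X') (p : chain_map X' V),
    [/\ nice a V, quasi_iso s & homotopic (chain_comp p i) (chain_id V)].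
Proof.
case=> Z /D_isoP[W [s [t [qs qt]]]].
have [a1 H1] := common_below X W (bc_sum Y Z).
have [a2 H2] := nice_model Y; have [a3 H3] := nice_model Z.
exists (Order.min a1 (Order.min a2 a3)) => a ha X' q nX' qq.
have [|bX bW bYZ] := H1 a; first by lia.
have [|bY [V [v [nV qv]]]] := H2 a; first by lia.
have [|bZ [U [u [nU qu]]]] := H3 a; first by lia.
have nVU : nice a (bc_sum V U).
  have [[bV pV] [bU pU]] := (nV, nU).
  split=> j ja /=; first by rewrite bV ?bU.
  by apply: projective_sum; [exact: pV | exact: pU].
have [l Hl] := nice_lift (sum_map v u) nVU bW bYZ qt.
have ql : quasi_iso l.
  apply: qis_right qt; apply: qis_homotopic (homotopic_sym Hl) _.
  exact: sum_map_qis.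
have [bX' _] := nX'; have [f Hf] := nice_lift (chain_comp s l) nVU bX' bX qq.
have qf : quasi_iso f.
  by apply: qis_right qq; apply: qis_homotopic (homotopic_sym Hf) _; exact: chain_comp_qis.
have [g [_ gf]] := nice_whitehead nVU nX' qf.
exists V, v, (chain_comp f (sum_inl V U)), (chain_comp (sum_fst V U) g); split=> //.
have H := homotopic_comp (homotopic_comp (homotopic_refl (sum_inl V U)) gf)
  (homotopic_refl (sum_fst V U)).
apply: homotopic_trans (homotopic_trans _ H) _; apply: homotopic_ext => j.
  by rewrite /= !mulmxA.
by rewrite /= !mulmx1 mul_row_col mulmx1 mul0mx addr0.
Qed.

End Roofs.

(** * Shifts of chain maps and homotopies *)

Section Shifts.

Variables (k : fieldType) (gT : finGroupType) (G : {group gT}) (n : int).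
Implicit Types X Y Z W V : bcomplex k G.

Lemma shift_map_hom X Y (f : chain_map X Y) i :
  @module_hom _ _ _ (bc_shift X n i) (bc_shift Y n i) (f (i + n)).
Proof. by move=> g Gg; exact: (cm_hom f (i + n) Gg). Qed.

Lemma shift_map_comm X Y (f : chain_map X Y) i j :
  f (i + n) *m bc_diff (bc_shift Y n) i j = bc_diff (bc_shift X n) i j *m f (j + n).
Proof. by rewrite /= -scalemxAl -scalemxAr cm_comm. Qed.

Definition shift_map X Y (f : chain_map X Y) : chain_map (bc_shift X n) (bc_shift Y n) :=
  ChainMap (shift_map_hom f) (shift_map_comm f).

Lemma sub_scale_sign r m p (v : 'M[k]_(r, p)) (A : 'M[k]_(m, p)) :
  (v <= (-1) ^+ `|n|%N *: A)%MS = (v <= A)%MS.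
Proof. by rewrite (eqmx_scale A) // signr_eq0. Qed.

(** The sign does not change the row space. The source degrees [i - 1 + n] and [i + n - 1] are equal
    only propositionally, so the degree is generalised before rewriting. *)
Lemma shift_coboundaries X i r (v : 'M[k]_(r, rdegree (X (i + n)))) :
  (v <= coboundaries (bc_shift X n) i)%MS = (v <= coboundaries X (i + n))%MS.
Proof.
rewrite /coboundaries sub_scale_sign.
suff H j l : j = l -> (v <= bc_diff X j (i + n))%MS = (v <= bc_diff X l (i + n))%MS.
  by apply: H; rewrite addrAC.
by move=> ->.
Qed.

Lemma shift_cocycles X i r (v : 'M[k]_(r, rdegree (X (i + n)))) :
  (v <= cocycles (bc_shift X n) i)%MS = (v <= cocycles X (i + n))%MS.
Proof.
rewrite !(sameP sub_kermxP eqP) /= -scalemxAr scaler_eq0 signr_eq0 /=.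
suff H j l : j = l -> (v *m bc_diff X (i + n) j == 0) = (v *m bc_diff X (i + n) l == 0).
  by apply: H; rewrite addrAC.
by move=> ->.
Qed.

Lemma shift_map_qis X Y (f : chain_map X Y) : quasi_iso f -> quasi_iso (shift_map f).
Proof.
move=> /qisP[fi fs]; apply/qisP; split=> i v.
  by rewrite !shift_cocycles !shift_coboundaries; exact: fi.
rewrite shift_cocycles => /fs[w Zw Bw]; exists w; first by rewrite shift_cocycles.
by rewrite shift_coboundaries.
Qed.

(** The shifted differential carries the sign [(-1)^n]; giving the homotopy the same sign makes the
    two cancel. *)
Lemma shift_null X Y (f : forall i, 'M[k]_(rdegree (X i), rdegree (Y i))) : null_homotopic f ->
  @null_homotopic k gT G (bc_shift X n) (bc_shift Y n) (fun i => f (i + n)).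
Proof.
case=> h [Hh Eh]; exists (fun i j => (-1) ^+ `|n|%N *: h (i + n) (j + n)); split=> [i j g Gg|i].
  by rewrite -scalemxAl -scalemxAr Hh.
rewrite /= -!scalemxAl -!scalemxAr !scalerA -expr2 sqrr_sign !scale1r.
have H j l : j = i + n + 1 -> l = i + n - 1 ->
    f (i + n) = bc_diff X (i + n) j *m h j (i + n) + h (i + n) l *m bc_diff Y l (i + n).
  by move=> -> ->; exact: Eh.
by apply: H; rewrite addrAC.
Qed.

End Shifts.

(** * Restriction of truncated resolutions *)

Section RestrictedComplexes.

Variables (k : fieldType) (gT : finGroupType) (G N : {group gT}) (sNG : N \subset G).
Implicit Types X Y Z W V : bcomplex k G.

(** Transitivity of the trace: every [g] in [G] is uniquely [t h] with [t] in a transversal [T] and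
    [h] in [N], and the conjugates of [e] by [T] are summed first. *)
Lemma rtrace_sub (M : representation k G) (e : 'M[k]_(rdegree M)) :
  exists e' : 'M[k]_(rdegree M), @rtrace _ _ _ M M N e' = @rtrace _ _ _ M M G e.
Proof.
pose r x := repr (x *: N)%g.
have rE x : exists2 h, h \in N & x = (r x * h)%g.
  have := mem_repr x (lcoset_refl N x); rewrite mem_lcoset => H.
  exists ((r x)^-1 * x)%g; last by rewrite mulKVg.
  by rewrite -groupV invMg invgK.
have rM x h : h \in N -> r (x * h)%g = r x.
  by move=> Nh; rewrite /r; congr repr; apply/lcoset_eqP; rewrite mem_lcoset mulKg.
pose T := [set r x | x in G].
exists (\sum_(t in T) M t^-1%g *m e *m M t).
have TG t : t \in T -> t \in G.
  case/imsetP=> x Gx ->; have [h Nh Ex] := rE x.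
  by rewrite -(groupMr _ (subsetP sNG h Nh)) -Ex.
pose F g := M g^-1%g *m e *m M g.
rewrite /rtrace [RHS](partition_big r (mem T)) /=; last by move=> x Gx; apply: imset_f.
under eq_bigr => h Nh do rewrite mulmx_sumr mulmx_suml.
rewrite exchange_big /=; apply: eq_bigr => t Tt; have Gt := TG t Tt.
rewrite [RHS](reindex_onto (fun h => (t * h)%g) (fun g => (t^-1 * g)%g)) /=; last first.
  by move=> g _; rewrite mulKVg.
apply: eq_big => [h|h Nh].
  rewrite mulKg eqxx andbT; apply/idP/andP=> [Nh|[_ /eqP rt]].
    rewrite groupM // ?(subsetP sNG) // rM //; split=> //; apply/eqP.
    have /imsetP[x Gx Et] := Tt; rewrite Et; have [h' Nh' Ex] := rE x.
    by rewrite {2}Ex rM.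
  by have [h' Nh' /eqP] := rE (t * h)%g; rewrite rt (inj_eq (mulgI t)) => /eqP ->.
have Gh := subsetP sNG h Nh.
by rewrite invMg !repr_mxM ?groupV // !mulmxA.
Qed.

Lemma projective_res (M : representation k G) : projective M -> projective (res_module sNG M).
Proof. by case=> e He; have [e' He'] := rtrace_sub e; exists e'; rewrite -He -He'. Qed.

Lemma nice_res (a : int) X : nice a X -> nice a (bc_res sNG X).
Proof. by case=> bX pX; split=> // i ai; apply: projective_res; exact: pX. Qed.

Lemma res_map_hom X Y (f : chain_map X Y) i :
  @module_hom _ _ _ (bc_res sNG X i) (bc_res sNG Y i) (f i).
Proof. by move=> x /(subsetP sNG)/(cm_hom f i). Qed.

Definition res_map X Y (f : chain_map X Y) : chain_map (bc_res sNG X) (bc_res sNG Y) :=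
  ChainMap (res_map_hom f) (@cm_comm _ _ _ _ _ f).

Lemma res_map_qis X Y (f : chain_map X Y) : quasi_iso f -> quasi_iso (res_map f).
Proof. by []. Qed.

Lemma qequiv_res X Y : qequiv X Y -> qequiv (bc_res sNG X) (bc_res sNG Y).
Proof. by case=> W [s [t [qs qt]]]; exists (bc_res sNG W), (res_map s), (res_map t). Qed.

End RestrictedComplexes.
(** * Descent along p-power index *)

Section CyclicQuotient.

Variables (gT : finGroupType) (p : nat).
Hypothesis p_pr : prime p.
Implicit Types H M K : {group gT}.

(** In the [p]-group [K / H] a maximal subgroup is normal of index [p]. *)
Lemma p_index_normal H K : (H <| K)%g -> H :!=: K -> p.-nat #|K : H|%g ->
  exists M : {group gT}, [/\ (H <| M)%g, (M <| K)%g, M \proper K & #|K : M|%g = p].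
Proof.
move=> nHK neHK pHK; have [sHK nKH] := andP nHK.
have [HK|[M maxM sHM]] := maximal_exists sHK; first by rewrite HK eqxx in neHK.
have sMK := maxgroupp maxM; have nHM : (H <| M)%g.
  by apply: normalS nHK => //; exact: proper_sub.
have pQ : (p.-group (K / H))%g by rewrite /pgroup card_quotient.
have maxQ : maximal (M / H) (K / H) by rewrite quotient_maximal.
exists M; split=> //.
  by rewrite -(quotientGK nHM) -(quotientGK nHK) cosetpre_normal (p_maximal_normal pQ maxQ).
rewrite -(p_maximal_index pQ maxQ) index_quotient_eq //; last exact: proper_sub.
by rewrite (setIidPr _) // subIset // sHM orbT.
Qed.

Lemma prime_index_cosets M K : (M <| K)%g -> #|K : M|%g = p ->
  exists g, [/\ g \in K, (g ^+ p)%g \in M,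
    (forall x, x \in K -> exists2 y, y \in M & exists j, x = (y * g ^+ j)%g)
    & forall (V : nmodType) (F : gT -> V),
      \sum_(x in K) F x = \sum_(j < p) \sum_(y in M) F (y * g ^+ j)%g].
Proof.
move=> nMK iMK; have [sMK nKM] := andP nMK.
have [g Kg Mg] : exists2 g, g \in K & g \notin M.
  apply/subsetPn/negP => sKM; have /eqP eMK : M == K by rewrite -val_eqE eqEsubset sMK.
  by move: p_pr; rewrite -iMK eMK indexgg.
have cp : #|(K / M)%g| = p by rewrite card_quotient.
have og : #[coset M g]%g = p.
  have gp : (#[coset M g]%g %| p)%N by rewrite -cp order_dvdG // mem_quotient.
  move/primeP: p_pr => [_ /(_ _ gp)/orP[|/eqP //]].
  rewrite order_eq1 => /eqP c1; case/negP: Mg; apply: coset_idr => //.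
  exact: subsetP nKM g Kg.
have nMg : g \in 'N(M)%g by exact: subsetP nKM g Kg.
pose h (u : gT * 'I_p) := (u.1 * g ^+ u.2)%g.
pose D := setX M [set: 'I_p].
have injh : {in D &, injective h}.
  move=> [y i] [y' j]; rewrite !inE /= !andbT => My My' /= e.
  have e1 : (coset M g ^+ i = coset M g ^+ j)%g.
    have hc z n : z \in M -> coset M (z * g ^+ n)%g = (coset M g ^+ n)%g.
      by move=> Mz; rewrite coset_kerl // morphX.
    by rewrite -(hc y) // -(hc y') //; exact: congr1 e.
  have ij : i = j.
    apply/val_inj/eqP; move/eqP: e1; rewrite eq_expg_mod_order og.
    by rewrite !modn_small.
  by move: e; rewrite /h /= ij => /mulIg ->.
have EK : h @: D = K.
  have cK : #|K| = (#|M| * p)%N by rewrite -iMK Lagrange.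
  apply/eqP; rewrite eqEcard card_in_imset // cardsX cardsT card_ord cK leqnn andbT.
  apply/subsetP=> x /imsetP[[y i]]; rewrite !inE andbT /= => My ->.
  by rewrite /h groupM ?groupX // (subsetP sMK).
exists g; split=> //.
- by apply: coset_idr; rewrite ?groupX // morphX // -og expg_order.
- move=> x; rewrite -EK => /imsetP[[y i]]; rewrite !inE andbT /= => My ->.
  by exists y => //; exists (val i).
move=> V F; rewrite -EK big_imset //= exchange_big /=.
rewrite (pair_big (mem M) xpredT (fun y (j : 'I_p) => F (y * g ^+ j)%g)) /=.
by apply: eq_bigl => u; rewrite !inE.
Qed.

End CyclicQuotient.

(** * Powers of [c - 1] in characteristic [p] *)

Section FrobeniusOperator.

Variables (k : fieldType) (p : nat) (V : lmodType k) (c : V -> V).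
Hypothesis hp : p \in [pchar k].
Hypothesis cB : forall u v, c (u - v) = c u - c v.

Let D v := c v - v.

(** Evaluation of a polynomial at [c]: the operator identities are read off from identities in
    [{poly k}], where the Frobenius endomorphism is available. *)
Let act (q : {poly k}) v := \sum_(i < size q) q`_i *: iter i c v.

Let actE n (q : {poly k}) v : (size q <= n)%N -> act q v = \sum_(i < n) q`_i *: iter i c v.
Proof.
move=> qn; rewrite /act (big_ord_widen n (fun i => q`_i *: iter i c v) qn) [RHS]big_mkcond /=.
rewrite big_mkcond; apply: eq_bigr => i _; case: ltnP => // /leq_sizeP -> //.
by rewrite scale0r.
Qed.

Let iterB n u v : iter n c (u - v) = iter n c u - iter n c v.
Proof. by elim: n => //= n ->. Qed.

Let actB q u v : act q (u - v) = act q u - act q v.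
Proof. by rewrite /act -sumrB; apply: eq_bigr => i _; rewrite iterB scalerBr. Qed.

Let act_subp q r v : act (q - r) v = act q v - act r v.
Proof.
pose n := maxn (size q) (size r).
have qrn : (size (q - r)%R <= n)%N by rewrite (leq_trans (size_polyD _ _)) // size_polyN.
rewrite !(@actE n) ?leq_maxl ?leq_maxr // -sumrB; apply: eq_bigr => i _.
by rewrite coefB scalerBl.
Qed.

Let actMX q v : act (q * 'X) v = act q (c v).
Proof.
rewrite (@actE (size q).+1) ?(leq_trans (size_polyMleq _ _)) ?size_polyX ?addn2 //.
rewrite big_ord_recl coefMX eqxx scale0r add0r /act; apply: eq_bigr => i _.
by rewrite coefMX /= -iterSr.
Qed.

Let act_iter n v : act (('X - 1) ^+ n) v = iter n D v.
Proof.
elim: n v => [|n IH] v.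
  by rewrite expr0 /act size_poly1 big_ord1 coef1 scale1r.
by rewrite exprSr mulrBr mulr1 act_subp actMX -actB IH -iterSr.
Qed.

Let actXn n v : act 'X^n v = iter n c v.
Proof.
rewrite /act size_polyXn big_ord_recr /= coefXn eqxx scale1r big1 ?add0r // => i _.
by rewrite coefXn ltn_eqF // scale0r.
Qed.

Let act1 v : act 1 v = v. Proof. exact: (actXn 0). Qed.

Lemma iter_sub_pchar v : iter p D v = iter p c v - v.
Proof.
rewrite -act_iter -(pFrobenius_autE (_ : p \in [pchar {poly k}])) ?pchar_poly //.
move=> hp'; rewrite pFrobenius_autB_comm; last exact: commr1.
by rewrite pFrobenius_aut1 pFrobenius_autE act_subp actXn act1.
Qed.

(** Multiplied by [X - 1], both [(X - 1)^(p - 1)] and [1 + X + ... + X^(p - 1)] become [X^p - 1],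
    and [X - 1] can be cancelled. *)
Lemma iter_sub_pred_pchar v : iter p.-1 D v = \sum_(j < p) iter j c v.
Proof.
have p0 : (0 < p)%N by rewrite prime_gt0 // (pcharf_prime hp).
have hp' : p \in [pchar {poly k}] by rewrite pchar_poly.
have E : ('X - 1) ^+ p.-1 = \sum_(j < p) 'X^j :> {poly k}.
  have X1 : 'X - 1 != 0 :> {poly k} by rewrite -[1]/(1%:P) polyXsubC_eq0.
  apply: (mulfI X1); rewrite -exprS prednK // -subrX1.
  rewrite -(pFrobenius_autE hp') pFrobenius_autB_comm; last exact: commr1.
  by rewrite pFrobenius_aut1 pFrobenius_autE.
rewrite -act_iter E.
have -> n : act (\sum_(j < n) 'X^j) v = \sum_(j < n) act 'X^j v.
  have act0 : act 0 v = 0 by rewrite /act size_poly0 big_ord0.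
  elim: n => [|n IH]; first by rewrite !big_ord0.
  rewrite !big_ord_recr /= -IH -['X^n in LHS]opprK act_subp -[- 'X^n]sub0r act_subp.
  by rewrite act0 sub0r opprK.
by apply: eq_bigr => j _; rewrite actXn.
Qed.

End FrobeniusOperator.

(** * From maps equivariant for a subgroup to maps equivariant for a larger group *)

Section TraceDescent.

Variables (k : fieldType) (p : nat) (gT : finGroupType) (G : {group gT}).
Hypothesis hp : p \in [pchar k].
Variables X Z : bcomplex k G.
Implicit Types H M K : {group gT}.

Local Notation graded := (forall i : int, 'M[k]_(rdegree (X i), rdegree (Z i))).

Definition equivariant (H : {set gT}) i j (u : 'M[k]_(rdegree (X i), rdegree (Z j))) :=
  {in H, forall x, X i x *m u = u *m Z j x}.

(** Maps equivariant for the various subgroups are all families between the same complexes of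
    [G]-modules, so changing the subgroup needs no restriction functor. *)
Definition graded_map (H : {set gT}) (f : graded) :=
  (forall i, equivariant H (f i)) /\
  (forall i, f i *m bc_diff Z i (i + 1) = bc_diff X i (i + 1) *m f (i + 1)).

Definition boundary (h : forall i j, 'M[k]_(rdegree (X i), rdegree (Z j))) i :=
  bc_diff X i (i + 1) *m h (i + 1) i + h i (i - 1) *m bc_diff Z (i - 1) i.

Definition graded_null (H : {set gT}) (f : graded) :=
  exists h : forall i j, 'M[k]_(rdegree (X i), rdegree (Z j)),
    (forall i j, equivariant H (h i j)) /\ forall i, f i = boundary h i.

Definition conj_mx (g : gT) i j (u : 'M[k]_(rdegree (X i), rdegree (Z j))) :=
  X i g^-1%g *m u *m Z j g.

(** The element [g - 1] of the group ring acting on linear maps; the descent rests on its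
    nilpotency. *)
Definition conj_sub (g : gT) i j (u : 'M[k]_(rdegree (X i), rdegree (Z j))) :=
  conj_mx g u - u.

Lemma equivariant_sub (H K : {set gT}) i j (u : 'M[k]_(rdegree (X i), rdegree (Z j))) :
  H \subset K -> equivariant K u -> equivariant H u.
Proof. by move=> /subsetP sHK Ku x /sHK; exact: Ku. Qed.

Lemma equivariantB (H : {set gT}) i j (u v : 'M[k]_(rdegree (X i), rdegree (Z j))) :
  equivariant H u -> equivariant H v -> equivariant H (u - v).
Proof. by move=> Hu Hv x Hx; rewrite mulmxBr mulmxBl Hu ?Hv. Qed.

Lemma graded_null_sub (H K : {set gT}) f : H \subset K -> graded_null K f -> graded_null H f.
Proof.
move=> sHK [h [Hh Eh]]; exists h; split=> // i j; exact: equivariant_sub (Hh i j).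
Qed.

Lemma graded_null_ext H (f g : graded) :
  (forall i, f i = g i) -> graded_null H f -> graded_null H g.
Proof. by move=> fg [h [Hh Eh]]; exists h; split=> // i; rewrite -fg. Qed.

Lemma graded_null0 H (f : graded) : (forall i, f i = 0) -> graded_null H f.
Proof.
move=> f0; exists (fun _ _ => 0); split=> [i j x _|i]; first by rewrite mulmx0 mul0mx.
by rewrite f0 /boundary mulmx0 mul0mx addr0.
Qed.

Lemma boundaryB h h' i : boundary (fun i j => h i j - h' i j) i = boundary h i - boundary h' i.
Proof. by rewrite /boundary mulmxBr mulmxBl addrACA opprD. Qed.

Lemma graded_nullB H (f g : graded) :
  graded_null H f -> graded_null H g -> graded_null H (fun i => f i - g i).
Proof.
case=> h [Hh Eh] [h' [Hh' Eh']]; exists (fun i j => h i j - h' i j); split.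
  by move=> i j; apply: equivariantB.
by move=> i; rewrite Eh Eh' boundaryB.
Qed.

Lemma graded_nullD H (f g : graded) :
  graded_null H f -> graded_null H g -> graded_null H (fun i => f i + g i).
Proof.
move=> Hf Hg; have H0 : graded_null H (fun i => 0) by exact: graded_null0.
apply: graded_null_ext (graded_nullB Hf (graded_nullB H0 Hg)) => i.
by rewrite sub0r opprK.
Qed.

Lemma conj_mx_equivariant H g i j (u : 'M[k]_(rdegree (X i), rdegree (Z j))) :
  H \subset G -> g \in G -> (g \in 'N(H))%g -> equivariant H u -> equivariant H (conj_mx g u).
Proof.
move=> sHG Gg nHg Hu x Hx; have Gx := subsetP sHG x Hx.
have Hy : (x ^ g^-1)%g \in H by rewrite memJ_norm ?groupV.
have Gy := subsetP sHG _ Hy.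
rewrite /conj_mx !mulmxA -repr_mxM ?groupV //.
have -> : (x * g^-1 = g^-1 * (x ^ g^-1))%g by rewrite conjgE invgK !mulgA mulVg mul1g.
rewrite repr_mxM ?groupV // -(mulmxA (X i _) (X i _) u) Hu // -!mulmxA -!repr_mxM //.
by congr (_ *m (_ *m Z j _)); rewrite conjgE invgK !mulgA mulgKV.
Qed.

Lemma conj_sub_equivariant H g i j (u : 'M[k]_(rdegree (X i), rdegree (Z j))) :
  H \subset G -> g \in G -> (g \in 'N(H))%g -> equivariant H u -> equivariant H (conj_sub g u).
Proof. by move=> *; apply: equivariantB => //; apply: conj_mx_equivariant. Qed.

Lemma boundary_conj g h i : g \in G ->
  boundary (fun i j => conj_sub g (h i j)) i = conj_sub g (boundary h i).
Proof.
move=> Gg; rewrite boundaryB /conj_sub; congr (_ - _).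
rewrite /boundary /conj_mx mulmxDr mulmxDl !mulmxA -(bc_diff_hom X) ?groupV //.
by rewrite -!mulmxA bc_diff_hom.
Qed.

Lemma graded_map_conj H g f : H \subset G -> g \in G -> (g \in 'N(H))%g ->
  graded_map H f -> graded_map H (fun i => conj_sub g (f i)).
Proof.
move=> sHG Gg nHg [Hf Cf]; split=> i; first exact: conj_sub_equivariant.
rewrite /conj_sub /conj_mx mulmxBl mulmxBr Cf; congr (_ - _).
by rewrite -!mulmxA bc_diff_hom // (mulmxA (f i)) Cf !mulmxA bc_diff_hom ?groupV.
Qed.

Lemma graded_null_conj H g f : H \subset G -> g \in G -> (g \in 'N(H))%g ->
  graded_null H f -> graded_null H (fun i => conj_sub g (f i)).
Proof.
move=> sHG Gg nHg [h [Hh Eh]]; exists (fun i j => conj_sub g (h i j)); split.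
  by move=> i j; exact: conj_sub_equivariant.
by move=> i; rewrite boundary_conj // Eh.
Qed.

Lemma conj_subB g i j (u v : 'M[k]_(rdegree (X i), rdegree (Z j))) :
  conj_sub g (u - v) = conj_sub g u - conj_sub g v.
Proof.
rewrite /conj_sub /conj_mx mulmxBr mulmxBl !opprB addrACA [RHS]addrACA.
by congr (_ + _); exact: addrC.
Qed.

Lemma conj_mxB g i j (u v : 'M[k]_(rdegree (X i), rdegree (Z j))) :
  conj_mx g (u - v) = conj_mx g u - conj_mx g v.
Proof. by rewrite /conj_mx mulmxBr mulmxBl. Qed.

Lemma iter_conj_mx g n i j (u : 'M[k]_(rdegree (X i), rdegree (Z j))) : g \in G ->
  iter n (@conj_mx g i j) u = conj_mx (g ^+ n)%g u.
Proof.
move=> Gg; elim: n => [|n IH] /=.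
  by rewrite /conj_mx invg1 !repr_mx1 mulmx1 mul1mx.
rewrite IH /conj_mx expgSr invMg !repr_mxM ?groupV ?groupX //.
by rewrite !mulmxA.
Qed.

Lemma iter_conj_subB g n i j (u v : 'M[k]_(rdegree (X i), rdegree (Z j))) :
  iter n (@conj_sub g i j) (u - v)
  = iter n (@conj_sub g i j) u - iter n (@conj_sub g i j) v.
Proof. by elim: n => //= n ->; rewrite conj_subB. Qed.

(* [conj_sub g] iterated [p - 1] times is the relative trace, because
   (x - 1)^(p - 1) = 1 + x + ... + x^(p - 1) in characteristic p. *)
Lemma iter_conj_sub_trace H K g i j (u : 'M[k]_(rdegree (X i), rdegree (Z j))) :
  H \subset K -> K \subset G -> g \in K -> (g \in 'N(H))%g ->
  (forall (V : nmodType) (F : gT -> V),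
      \sum_(x in K) F x = \sum_(l < p) \sum_(y in H) F (y * g ^+ l)%g) ->
  projective (X i) -> equivariant K u ->
  exists2 v, equivariant H v & iter p.-1 (@conj_sub g i j) v = u.
Proof.
move=> sHK sKG Kg nHg sumK [e He] Ku.
have [e' He'] := rtrace_sub sKG e; rewrite He in He'.
have Gg := subsetP sKG g Kg; have sHG := subset_trans sHK sKG.
(* [w] is the trace of [e'] from the trivial group to [H], so its trace from [H] to [K] is the
   identity. *)
pose w := @rtrace _ _ _ (X i) (X i) H e'.
have Hw : {in H, forall x, X i x *m w = w *m X i x} by exact: rtrace_hom.
exists (w *m u).
  move=> x Hx; rewrite mulmxA Hw // -mulmxA (Ku x) ?mulmxA //.
  exact: subsetP sHK x Hx.
rewrite /conj_sub (iter_sub_pred_pchar hp); last by move=> *; exact: conj_mxB.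
transitivity (\sum_(l < p) X i (g ^+ l)^-1%g *m w *m X i (g ^+ l)%g *m u).
  apply: eq_bigr => l _; rewrite iter_conj_mx // /conj_mx.
  by rewrite !mulmxA -(mulmxA _ u) -Ku ?groupX // !mulmxA.
rewrite -mulmx_suml -[RHS]mul1mx -He' /rtrace sumK; congr (_ *m _).
apply: eq_bigr => l _; rewrite /w /rtrace mulmx_sumr mulmx_suml.
apply: eq_bigr => y Hy; have Gy := subsetP sHG y Hy.
by rewrite invMg !repr_mxM ?groupV ?groupX // !mulmxA.
Qed.

(** A homotopy has components [X i -> Z (i - 1)], so each of them is a relative trace or zero. *)
Hypothesis projX : forall i, projective (X i) \/ rdegree (Z (i - 1)) = 0%N.

(** [V] is not assumed closed under homotopy; hence the member [f] of [V] and the [K]-map [phi]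
    homotopic to it are kept apart. *)
Definition descends (V : graded -> Prop) (H K : {set gT}) := exists f phi : graded,
  [/\ V f, graded_map H f, graded_map K phi, ~ graded_null K phi
    & graded_null H (fun i => f i - phi i)].

(** Let [D = g - 1]. An [H]-map is fixed by [g^p], which lies in [H], so [D^p = g^p - 1] kills it,
    and the last nonzero iterate of [D] is fixed by [g] and thus a [K]-map. The difficulty is that
    this iterate may be null-homotopic. *)
Lemma descent_step H K (V : graded -> Prop) (f : graded) :
  (H <| K)%g -> K \subset G -> #|K : H|%g = p ->
  (forall v g, g \in K -> graded_map H v -> V v -> V (fun i => conj_sub g (v i))) ->
  graded_map H f -> V f -> ~ graded_null H f -> descends V H K.
Proof.
move=> nHK sKG iHK VD Hf Vf f0; have [sHK nKH] := andP nHK.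
have sHG := subset_trans sHK sKG; have p_pr := pcharf_prime hp.
have [g [Kg Hgp genK sumK]] := prime_index_cosets p_pr nHK iHK.
have Gg := subsetP sKG g Kg; have nHg := subsetP nKH g Kg.
pose D i j := @conj_sub g i j.
have iterV n v : graded_map H v -> V v ->
    graded_map H (fun i => iter n (@D i i) (v i)) /\ V (fun i => iter n (@D i i) (v i)).
  move=> Hv Vv; elim: n => [//|n [IH1 IH2]]; split.
    exact: graded_map_conj sHG Gg nHg IH1.
  exact: VD IH2.
have iter_null n v : graded_null H v -> graded_null H (fun i => iter n (@D i i) (v i)).
  by move=> v0; elim: n => [//|n IH]; apply: graded_null_conj sHG Gg nHg IH.
(* [v] stays in [V], while [w] is a homotopic map corrected by boundaries until its last iterate is
   not null-homotopic; [l] bounds the nilpotency of [D] on [w]. *)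
suff main l : (l <= p)%N -> forall w v, graded_map H w -> graded_map H v -> V v ->
    graded_null H (fun i => v i - w i) -> ~ graded_null H w ->
    (forall i, iter l (@D i i) (w i) = 0) -> descends V H K.
  apply: (main p (leqnn p) f f) => //.
    by apply: graded_null0 => i; rewrite subrr.
  move=> i; rewrite /D /conj_sub (iter_sub_pchar hp); last by move=> *; exact: conj_mxB.
  rewrite iter_conj_mx //; apply/eqP; rewrite subr_eq0 /conj_mx -mulmxA -(proj1 Hf i _ Hgp).
  by rewrite mulmxA -repr_mxM ?groupV ?groupX // mulVg repr_mx1 mul1mx.
(* If the [K]-map [phi] is null-homotopic, its homotopy is a trace, that is, an
   iterate of [D], and [w] can be corrected by a boundary to lower [l]. *)
elim: l => [|l IH] lp w v Hw Hv Vv vw w0 Dw; first by case: w0; exact: graded_null0.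
pose phi i := iter l (@D i i) (w i).
have Hphi : graded_map H phi.
  rewrite /phi; elim: (l) => [//|n IHn]; exact: graded_map_conj sHG Gg nHg IHn.
have Kphi : graded_map K phi.
  split; last by case: Hphi.
  move=> i x /genK[y Hy [n ->]]; have Gy := subsetP sHG y Hy.
  have cg : X i g *m phi i = phi i *m Z i g.
    have /eqP := Dw i; rewrite /= -/(phi i) {1}/D /conj_sub subr_eq0 => /eqP {1}<-.
    by rewrite /conj_mx !mulmxA -repr_mxM ?groupV // mulgV repr_mx1 mul1mx.
  rewrite !repr_mxM ?groupX // mulmxA -(proj1 Hphi i y Hy) -!mulmxA; congr (_ *m _).
  elim: n => [|n IHn]; first by rewrite expg0 !repr_mx1 mulmx1 mul1mx.
  by rewrite expgS !repr_mxM ?groupX // -mulmxA IHn !mulmxA cg.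
have [phi0|phi0] := classic (graded_null K phi); last first.
  exists (fun i => iter l (@D i i) (v i)), phi; have [H1 H2] := iterV l v Hv Vv.
  split=> //; apply: graded_null_ext (iter_null l _ vw) => i.
  exact: iter_conj_subB.
have [h [Kh Eh]] := phi0.
(* Only the entries with [j + 1 = i] enter a boundary, and for those [projX] applies. *)
have [h' Hh'] : exists h' : forall i, forall j, 'M[k]_(rdegree (X i), rdegree (Z j)),
    forall i, (forall j, equivariant H (h' i j)) /\
    forall j, j + 1 = i -> iter p.-1 (@D i j) (h' i j) = h i j.
  apply: (@dependent_choice_int (fun i => forall j, 'M[k]_(rdegree (X i), rdegree (Z j)))
    (fun i t => (forall j, equivariant H (t j)) /\
       forall j, j + 1 = i -> iter p.-1 (@D i j) (t j) = h i j)) => i.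
  have [pX|Z0] := projX i; last first.
    exists (fun j => 0); split=> [j x _|j ji]; first by rewrite mulmx0 mul0mx.
    by apply: zero_cols; rewrite -Z0 -ji addrK.
  have [t Ht] : exists t : forall j, 'M[k]_(rdegree (X i), rdegree (Z j)),
      forall j, equivariant H (t j) /\ iter p.-1 (@D i j) (t j) = h i j.
    apply: (@dependent_choice_int (fun j => 'M[k]_(rdegree (X i), rdegree (Z j)))
      (fun j t => equivariant H t /\ iter p.-1 (@D i j) t = h i j)) => j.
    have [t Ht Et] := iter_conj_sub_trace sHK sKG Kg nHg sumK pX (Kh i j).
    by exists t.
  by exists t; split=> j; case: (Ht j).
(* The exponent is chosen so that [D^l h2 = D^(p - 1) h' = h] on the entries that matter. Then [D^l]
   kills [w] minus the boundary of [h2]. *)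
pose h2 i j := iter (p.-1 - l)%N (@D i j) (h' i j).
have Hh2 i j : equivariant H (h2 i j).
  rewrite /h2; elim: (_ - _)%N => [|n IHn]; first by case: (Hh' i).
  exact: conj_sub_equivariant sHG Gg nHg IHn.
have iterb n (u : forall i j, 'M[k]_(rdegree (X i), rdegree (Z j))) i :
    boundary (fun i j => iter n (@D i j) (u i j)) i = iter n (@D i i) (boundary u i).
  by elim: n => [//|n IHn]; rewrite /= -IHn; exact: boundary_conj.
have p0 : (0 < p)%N by exact: prime_gt0.
have Hb2 : graded_null H (boundary h2) by exists h2.
apply: (IH (ltnW lp) (fun i => w i - boundary h2 i) v) => //.
- split=> i.
    apply: equivariantB; first by case: Hw.
    move=> x Hx; have Gx := subsetP sHG x Hx.
    rewrite /boundary mulmxDr mulmxDl; congr (_ + _).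
      by rewrite mulmxA bc_diff_hom // -[LHS]mulmxA Hh2 // mulmxA.
    by rewrite mulmxA Hh2 // -[LHS]mulmxA bc_diff_hom // mulmxA.
  rewrite mulmxBl mulmxBr (proj2 Hw); congr (_ - _).
  rewrite /boundary mulmxDl mulmxDr -(mulmxA (h2 _ _)) bc_diff_sq mulmx0 addr0.
  by rewrite mulmxA bc_diff_sq mul0mx add0r addrK mulmxA.
- apply: graded_null_ext (graded_nullD vw Hb2) => i.
  by rewrite opprB [RHS]addrA addrAC.
- move=> w2; apply: w0; apply: graded_null_ext (graded_nullD w2 Hb2) => i.
  by rewrite subrK.
move=> i; rewrite iter_conj_subB -/(phi i) Eh.
rewrite -iterb; apply/eqP; rewrite subr_eq0; apply/eqP.
have E m j : j + 1 = m -> h m j = iter l (@D m j) (h2 m j).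
  move=> /(proj2 (Hh' m)) <-; rewrite /h2 -iterD subnKC //.
  by rewrite -ltnS prednK.
by rewrite /boundary (E (i + 1) i) // (E i (i - 1)) // subrK.
Qed.

Lemma descent H K (V : graded -> Prop) (f : graded) :
  (H <| K)%g -> K \subset G -> p.-nat #|K : H|%g ->
  (forall v g, g \in K -> graded_map H v -> V v -> V (fun i => conj_sub g (v i))) ->
  graded_map H f -> V f -> ~ graded_null H f -> descends V H K.
Proof.
have [n] := ubnP #|K|; elim: n K => // n IH K Kn nHK sKG pHK VD Hf Vf f0.
have [EHK|neHK] := eqVneq (H : {set gT}) K.
  exists f, f; rewrite -EHK; split=> //.
  by apply: graded_null0 => i; rewrite subrr.
have p_pr := pcharf_prime hp.
have [M [nHM nMK ltMK iMK]] := p_index_normal nHK neHK pHK.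
have [sHK nKH] := andP nHK; have sMK := proper_sub ltMK.
have sMG := subset_trans sMK sKG; have sHM := normal_sub nHM.
have sHG := subset_trans sHK sKG.
have [|||f1 [phi1 [Vf1 Hf1 Mphi1 phi10 fphi1]]] := IH M _ nHM sMG _ _ Hf Vf f0.
- by apply: leq_trans (proper_card ltMK) _; rewrite -ltnS.
- by apply: pnat_dvd pHK; apply: indexSg.
- by move=> v g /(subsetP sMK); exact: VD.
(* The class passed from [H] to [M]: maps that are [H]-homotopic to an [H]-map in [V]. *)
pose V' phi := exists v, [/\ V v, graded_map H v & graded_null H (fun i => v i - phi i)].
have V'phi1 : V' phi1 by exists f1.
have [|f2 [phi2 [[v [Vv Hv vf2]] Mf2 Kphi2 phi20 fphi2]]] :=
    @descent_step M K V' phi1 nMK sKG iMK _ Mphi1 V'phi1 phi10.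
  move=> u g Kg Mu [v [Vv Hv vu]]; have Gg := subsetP sKG g Kg.
  have nHg := subsetP nKH g Kg.
  exists (fun i => conj_sub g (v i)); split.
  - exact: VD.
  - exact: graded_map_conj.
  - apply: graded_null_ext (graded_null_conj sHG Gg nHg vu) => i.
    exact: conj_subB.
exists v, phi2; split=> //.
apply: graded_null_ext (graded_nullD vf2 (graded_null_sub sHM fphi2)) => i.
by rewrite addrA subrK.
Qed.

End TraceDescent.
(** * The radical of the endomorphism ring *)

Section Radical.

Variables (k : fieldType) (p : nat) (gT : finGroupType) (G N : {group gT}).
Hypothesis hp : p \in [pchar k].
Hypothesis nNG : (N <| G)%g.
Hypothesis hidx : p.-nat #|G : N|%g.
Let sNG := normal_sub nNG.
Implicit Types X Z : bcomplex k G.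

Lemma nice_projective_or (a : int) X Z : nice a X -> below a Z ->
  forall i, projective (X i) \/ rdegree (Z (i - 1)) = 0%N.
Proof.
move=> [_ pX] bZ i; have [ai|ai] := boolP (a < i); first by left; exact: pX.
by right; apply: bZ; lia.
Qed.

Lemma chain_of_graded X Z f : graded_map (X := X) (Z := Z) G f ->
  exists F : chain_map X Z, forall i, F i = f i.
Proof. by case=> Hf Cf; exists (ChainMap Hf (comm_of_succ Cf)). Qed.

Lemma res_chain_of_graded X Z f : graded_map (X := X) (Z := Z) N f ->
  exists F : chain_map (bc_res sNG X) (bc_res sNG Z), forall i, F i = f i.
Proof.
case=> Hf Cf.
have Cf' := @comm_of_succ _ _ _ (bc_res sNG X) (bc_res sNG Z) f Cf.
by exists (@ChainMap _ _ _ (bc_res sNG X) (bc_res sNG Z) f Hf Cf').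
Qed.

Lemma graded_of_res_chain X Z (F : chain_map (bc_res sNG X) (bc_res sNG Z)) :
  graded_map (X := X) (Z := Z) N F.
Proof. by split=> i; [exact: (cm_hom F i) | exact: (cm_comm F i (i + 1))]. Qed.

(** Descent for the class of all maps: an [N]-map that is not null-homotopic would produce such a
    [G]-map. *)
Lemma res_null (a : int) X Z : nice a X -> below a Z ->
  (forall f : chain_map X Z, null_homotopic f) ->
  forall f, graded_map (X := X) (Z := Z) N f -> graded_null (X := X) (Z := Z) N f.
Proof.
move=> nX bZ H0 f Hf; apply: NNPP => f0.
have [|f' [phi [_ _ /chain_of_graded[F EF] phi0 _]]] :=
  descent (V := fun=> True) hp (nice_projective_or nX bZ) nNG (subxx _) hidx _ Hf I f0; first by [].
by apply: phi0; apply: graded_null_ext EF (H0 F).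
Qed.

Definition chain_sub (K : {group gT}) (X Z : bcomplex k K) (f g : chain_map X Z) : chain_map X Z.
Proof.
apply: (@ChainMap _ _ _ X Z (fun i => f i - g i)).
  by move=> i; apply: module_homB; exact: cm_hom.
by move=> i j; rewrite mulmxBl mulmxBr !cm_comm.
Defined.

(** The witness is [1 + y + ... + y^(n - 1)], with sums written as double differences through
    [chain_sub]. *)
Lemma geometric_inverse (K : {group gT}) (X : bcomplex k K) (y : chain_map X X) n :
  exists a : chain_map X X, forall i, a i *m (1%:M - y i) = 1%:M - iterc y n i.
Proof.
elim: n => [|n [a Ha]]; first by exists (chain_zero X X) => i; rewrite mul0mx subrr.
exists (chain_sub (chain_id X) (chain_sub (chain_zero X X) (chain_comp y a))) => i /=.
rewrite sub0r opprK mulmxDl mul1mx.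
have -> : a i *m y i *m (1%:M - y i) = a i *m (1%:M - y i) *m y i.
  by rewrite -!mulmxA mulmxBl mulmxBr mul1mx mulmx1.
by rewrite Ha mulmxBl mul1mx addrA subrK.
Qed.

Section EndomorphismRing.

Variable X : bcomplex k G.
Let R := bc_res sNG X.
Local Notation graded := (forall i : int, 'M[k]_(rdegree (X i), rdegree (X i))).

(* Membership in the Jacobson radical of the endomorphism ring of [Res X]. *)
Definition in_radical (f : graded) := forall psi : chain_map R R,
  exists a : chain_map R R,
  @null_homotopic k gT N R R (fun i => a i *m (1%:M - psi i *m f i) - 1%:M).

(** If [a] is a left inverse of [1 - psi f], then [a (1 - psi (f - g))] is homotopic to
    [1 + a psi g], which has a left inverse [b] because [g] is in the radical; so [b a] works
    (products in matrix order). *)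
Lemma radicalB f g : in_radical f -> in_radical g -> in_radical (fun i => f i - g i).
Proof.
move=> Jf Jg psi; have [a Ha] := Jf psi.
have [b Hb] := Jg (chain_sub (chain_zero R R) (chain_comp psi a)).
exists (chain_comp a b); apply: null_ext (nullD (null_mull b Ha) Hb) => i /=.
rewrite sub0r mulNmx opprK mulmxBr mulmx1 addrA; congr (_ - _).
rewrite [b i *m (1%:M + _)]mulmxDr mulmx1 addrA subrK -mulmxDr -[RHS]mulmxA; congr (_ *m _).
rewrite -(mulmxA (a i)) -mulmxDr; congr (_ *m _).
by rewrite mulmxBr opprB addrA addrAC.
Qed.

Lemma conj_mx1 g i : g \in G -> conj_mx g (1%:M : 'M_(rdegree (X i))) = 1%:M.
Proof. by move=> Gg; rewrite /conj_mx mulmx1 -repr_mxM ?groupV // mulVg repr_mx1. Qed.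

Lemma conj_mxM g i (u v : 'M_(rdegree (X i))) : g \in G ->
  conj_mx g (u *m v) = conj_mx g u *m conj_mx (X := X) (Z := X) (i := i) (j := i) g v.
Proof.
move=> Gg; rewrite /conj_mx !mulmxA; congr (_ *m _ *m _).
by rewrite -[RHS]mulmxA -repr_mxM ?groupV // mulgV repr_mx1 mulmx1.
Qed.

Lemma res_conj g (f : chain_map R R) : g \in G ->
  exists F : chain_map R R, forall i, F i = conj_mx (X := X) (Z := X) (i := i) (j := i) g (f i).
Proof.
move=> Gg; have nNg := subsetP (normal_norm nNG) g Gg.
have [F EF] := res_chain_of_graded (graded_map_conj sNG Gg nNg (graded_of_res_chain f)).
exists (chain_sub F (chain_sub (chain_zero R R) f)) => i /=.
by rewrite EF sub0r opprK /conj_sub subrK.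
Qed.

Lemma radical_conj g f : g \in G -> in_radical f -> in_radical (fun i => conj_mx g (f i)).
Proof.
move=> Gg Jf psi; have Gg' : (g^-1)%g \in G by rewrite groupV.
have nNg := subsetP (normal_norm nNG) g Gg.
have [psi' Epsi'] := res_conj psi Gg'; have [a Ha] := Jf psi'.
have [a' Ea'] := res_conj a Gg; exists a'.
(* [graded_null_conj] speaks of [g - 1]; adding [Ha] back gives the conjugate itself. *)
have Hc := graded_nullD (graded_null_conj sNG Gg nNg Ha) Ha.
apply: graded_null_ext Hc => i; rewrite /conj_sub subrK conj_mxB conj_mx1 //.
rewrite conj_mxM // conj_mxB conj_mx1 // conj_mxM // Ea' Epsi'; congr (_ *m (_ - _ *m _) - _).
rewrite /conj_mx invgK !mulmxA -repr_mxM // mulVg repr_mx1 mul1mx.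
by rewrite -mulmxA -repr_mxM // mulVg repr_mx1 mulmx1.
Qed.

(* A nonzero radical would have a nonzero element represented by a [G]-map, which
   is impossible since such an element is invertible. *)
Lemma radical_null (a : int) (f : chain_map R R) : nice a X ->
  (forall phi : chain_map X X, ~ null_homotopic phi -> quasi_iso phi) ->
  in_radical f -> null_homotopic f.
Proof.
move=> nX divX Jf; apply: NNPP => f0; have [bX _] := nX.
have [|f' [phi [Jf' Hf' /chain_of_graded[F EF] phi0 fphi]]] :=
  descent (V := in_radical) hp (nice_projective_or nX bX) nNG (subxx _) hidx _
    (graded_of_res_chain f) Jf f0.
  move=> v g Gg _ Jv; exact: radicalB (radical_conj Gg Jv) Jv.
have qF : quasi_iso F.
  by apply: divX => F0; apply: phi0; apply: graded_null_ext EF F0.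
have [th Hth] := nice_lift (chain_id X) nX bX bX qF.
have Hth' : @null_homotopic k gT N R R (fun i => th i *m F i - 1%:M).
  exact: (graded_null_sub (X := X) (Z := X) sNG Hth).
(* Testing the radical at the inverse [th] makes [b] a left inverse of the null-homotopic map
   [1 - th f'], so the identity is null-homotopic. *)
have [b Hb] := Jf' (res_map sNG th).
have H1 : @null_homotopic k gT N R R (fun i => 1%:M - th i *m f' i).
  have fphi' : @null_homotopic k gT N R R (fun i => f' i - phi i) by exact: fphi.
  have H2 := null_mull (res_map sNG th) fphi'.
  apply: null_ext (nullN (nullD H2 Hth')) => i /=.
  by rewrite EF mulmxBr addrA subrK opprB.
have H3 : @null_homotopic k gT N R R (fun i => 1%:M).
  apply: null_ext (nullB (null_mull b H1) Hb) => i.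
  by rewrite opprB addrC subrK.
by apply: f0; apply: null_ext (null_mull f H3) => i; rewrite mulmx1.
Qed.

(** The map [i2 f p1] is shown to lie in the radical. For any [psi], put [u = p1 psi i2]. If neither
    [f u] nor [u f] were nilpotent up to homotopy, Fitting would make both quasi-isomorphisms, and
    then [f] too. So one is nilpotent, hence so is the product of [i2 f p1] with [psi], and a
    geometric sum inverts 1 minus that product. *)
Lemma summand_hom_null (a : int) (V1 V2 : bcomplex k N) (f : chain_map V1 V2)
    (i1 : chain_map V1 R) (p1 : chain_map R V1) (i2 : chain_map V2 R) (p2 : chain_map R V2) :
  nice a X -> (forall phi : chain_map X X, ~ null_homotopic phi -> quasi_iso phi) ->
  nice a V1 -> nice a V2 -> D_indecomposable V1 -> D_indecomposable V2 ->
  homotopic (chain_comp p1 i1) (chain_id V1) -> homotopic (chain_comp p2 i2) (chain_id V2) ->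
  ~ quasi_iso f -> null_homotopic f.
Proof.
move=> nX divX nV1 nV2 ind1 ind2 pi1 pi2 nqf.
have H : homotopic (chain_comp (chain_comp p2 i2) (chain_comp f (chain_comp p1 i1))) f.
  apply: homotopic_trans (homotopic_comp (homotopic_comp pi1 (homotopic_refl f)) pi2) _.
  by apply: homotopic_ext => i /=; rewrite mul1mx mulmx1.
suff phi0 : null_homotopic (chain_comp i2 (chain_comp f p1)).
  have := nullB (null_mulr p2 (null_mull i1 phi0)) H.
  by apply: null_ext => i /=; rewrite !mulmxA opprB addrC subrK.
apply: (radical_null nX divX) => psi.
pose u := chain_comp p1 (chain_comp psi i2).
pose y := chain_comp (chain_comp i2 (chain_comp f p1)) psi.
have iy n i : iterc y n.+1 i = psi i *m p1 i *m f i *m iterc (chain_comp f u) n i *m i2 i.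
  elim: n => [|n IH]; first by rewrite /= mul1mx mulmx1 !mulmxA.
  by rewrite [LHS]/= -[iterc y n i *m _]/(iterc y n.+1 i) IH /= !mulmxA.
have fu n i : f i *m iterc (chain_comp f u) n i = iterc (chain_comp u f) n i *m f i.
  elim: n => [|n IH]; first by rewrite mulmx1 mul1mx.
  by rewrite /= mulmxA IH !mulmxA.
have [n yn] : exists n, null_homotopic (iterc y n).
  have [q2|[n Hn]] := fitting (chain_comp f u) nV2 ind2; last first.
    exists n.+1; have := null_mulr i2 (null_mull (chain_comp f (chain_comp p1 psi)) Hn).
    by apply: null_ext => i; rewrite iy /= ?mulmxA.
  have [q1|[n Hn]] := fitting (chain_comp u f) nV1 ind1; last first.
    exists n.+1; have := null_mulr (chain_comp i2 f) (null_mull (chain_comp p1 psi) Hn).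
    by apply: null_ext => i; rewrite iy -(mulmxA _ (f i)) fu /= ?mulmxA.
  case: nqf; apply/qisP; split.
    by case/qisP: q1 => /coh_inj_comp.
  by case/qisP: q2 => _ /coh_surj_comp.
have [b Hb] := geometric_inverse y n; exists b.
apply: null_ext (nullN yn) => i.
by rewrite [RHS](_ : _ = b i *m (1%:M - y i) - 1%:M) // Hb addrC addKr.
Qed.

End EndomorphismRing.

End Radical.
(** * Generation *)

Section Generation.

Variables (k : fieldType) (gT : finGroupType) (G : {group gT}).
Implicit Types X Y Z W A B : bcomplex k G.

Definition coh_dim X i := \rank (cocycles X i *m cokermx (coboundaries X i)).

Lemma coh_dim_eq0 X i : coh_dim X i = 0%N <-> cohomology_zero X i.
Proof.
rewrite /coh_dim /cohomology_zero submxE -mxrank_eq0; split; first by move=> ->.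
by move/eqP.
Qed.

(** Rank-nullity for the cocycles of [X] mapped into [Y] modulo coboundaries: surjectivity on
    cohomology identifies the image with [H^i(Y)], injectivity identifies the kernel with the
    coboundaries of [X]. *)
Lemma coh_dim_map X Y (s : chain_map X Y) i : quasi_iso s ->
  (coh_dim Y i + \rank (coboundaries X i) = \rank (cocycles X i))%N.
Proof.
move=> /qisP[si ss]; set c := cokermx (coboundaries Y i).
have cB r (v : 'M[k]_(r, rdegree (Y i))) : (v *m c == 0) = (v <= coboundaries Y i)%MS.
  by rewrite submxE.
rewrite -(mxrank_mul_ker (cocycles X i) (s i *m c)); congr (_ + _)%N.
  rewrite /coh_dim -/c mulmxA; apply/eqmx_rank/andP; split; last first.
    by rewrite submxMr //; apply/rV_subP => v /submxP[u ->]; rewrite mulmxA cocycles_map // submxMl.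
  apply/rV_subP => v /submxP[u ->]; rewrite mulmxA.
  have [w Zw] := ss i (u *m cocycles Y i) (submxMl _ _).
  rewrite -cB mulmxBl subr_eq0 => /eqP ->.
  by rewrite -!mulmxA; case/submxP: Zw => z ->; rewrite -!mulmxA submxMl.
apply/eqmx_rank/andP; split.
  rewrite sub_capmx; apply/andP; split.
    by apply/sub_kermxP; rewrite /coboundaries bc_diff_sq.
  by apply/sub_kermxP/eqP; rewrite mulmxA cB /coboundaries -cm_comm submxMl.
apply/rV_subP => v; rewrite sub_capmx => /andP[Zv /sub_kermxP/eqP].
by rewrite mulmxA cB; exact: si.
Qed.

Lemma coh_dimE X i :
  (coh_dim X i + (\rank (bc_diff X (i - 1) i) + \rank (bc_diff X i (i + 1))) = rdegree (X i))%N.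
Proof.
have := coh_dim_map i (@chain_id_qis _ _ _ X); rewrite /cocycles mxrank_ker.
have := rank_leq_row (bc_diff X i (i + 1)); rewrite /coboundaries.
by move=> H1 H2; rewrite addnA H2 subnK.
Qed.

Lemma coh_dim_qis X Y (s : chain_map X Y) i : quasi_iso s -> coh_dim X i = coh_dim Y i.
Proof.
move=> qs; have := coh_dim_map i qs; rewrite -(coh_dim_map i (@chain_id_qis _ _ _ X)).
by move/addIn.
Qed.

Lemma coh_dim_qequiv X Y i : qequiv X Y -> coh_dim X i = coh_dim Y i.
Proof. by case=> W [s [t [/coh_dim_qis <- /coh_dim_qis <-]]]. Qed.

Lemma coh_dim_sum X Y i : coh_dim (bc_sum X Y) i = (coh_dim X i + coh_dim Y i)%N.
Proof.
have := coh_dimE (bc_sum X Y) i; rewrite /= !rank_diag_block_mx.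
have := coh_dimE X i; have := coh_dimE Y i; lia.
Qed.

(** An identity cast between equal degrees, such as [i + 1 - 1] and [i] in the cone of a map out of
    a shift. *)
Definition transport X i j : 'M[k]_(rdegree (X i), rdegree (X j)) :=
  if j == i then conform_mx 0 (1%:M : 'M[k]_(rdegree (X i))) else 0.

Lemma transport_id X i : transport X i i = 1%:M.
Proof. by rewrite /transport eqxx conform_mx_id. Qed.

Lemma transport_hom X i j : module_hom (transport X i j).
Proof.
rewrite /transport; case: eqP => [->|_]; last exact: module_hom0.
by rewrite conform_mx_id; exact: module_hom1.
Qed.

Lemma transportK X i j : i = j -> transport X i j *m transport X j i = 1%:M.
Proof. by move=> <-; rewrite transport_id mulmx1. Qed.

Lemma transport_diff X i j l m : i = j -> l = m ->
  transport X i j *m bc_diff X j m = bc_diff X i l *m transport X l m.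
Proof. by move=> -> ->; rewrite !transport_id mulmx1 mul1mx. Qed.

(** Closure under sums is not among the conditions of [thick]; presenting the sum as a cone on a
    zero map supplies it. *)
Lemma qequiv_cone0 A B : qequiv (bc_cone (chain_zero (bc_shift A (-1)) B)) (bc_sum A B).
Proof.
have e (i : int) : i + 1 - 1 = i by rewrite addrK.
pose C := bc_cone (chain_zero (bc_shift A (-1)) B).
pose f i : 'M[k]_(rdegree (C i), rdegree (bc_sum A B i)) :=
  block_mx (transport A (i + 1 - 1) i) 0 0 1%:M.
pose g i : 'M[k]_(rdegree (bc_sum A B i), rdegree (C i)) :=
  block_mx (transport A i (i + 1 - 1)) 0 0 1%:M.
have Hf i : module_hom (f i).
  move=> x Gx; rewrite /= !mulmx_block !(mulmx0, mul0mx, addr0, add0r, mul1mx, mulmx1).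
  by rewrite transport_hom.
have dC i : bc_diff C i (i + 1)
    = block_mx (bc_diff A (i + 1 - 1) (i + 1 + 1 - 1)) 0 0 (bc_diff B i (i + 1)).
  by rewrite /= eqxx conform_mx_id scaleN1r opprK.
have Cf i : f i *m bc_diff (bc_sum A B) i (i + 1) = bc_diff C i (i + 1) *m f (i + 1).
  rewrite dC /= !mulmx_block !(mulmx0, mul0mx, addr0, add0r, mul1mx, mulmx1).
  by rewrite (@transport_diff A (i + 1 - 1) i (i + 1 + 1 - 1)).
apply: (qequiv_qis (s := ChainMap Hf (comm_of_succ Cf))); apply: iso_qis => i.
  apply/row_freeP; exists (g i).
  rewrite /= mulmx_block !(mulmx0, mul0mx, addr0, add0r, mul1mx, mulmx1) transportK //.
  by rewrite -scalar_mx_block.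
apply/row_fullP; exists (g i).
rewrite /= mulmx_block !(mulmx0, mul0mx, addr0, add0r, mul1mx, mulmx1) transportK //.
by rewrite -scalar_mx_block.
Qed.

Lemma thick_sum (P : bcomplex k G -> Prop) A B : thick P -> P A -> P B -> P (bc_sum A B).
Proof.
move=> thP PA PB; apply: (thick_iso thP (proj2 (D_isoP _ _) (qequiv_cone0 A B))).
by apply: thick_cone => //; exact: thick_shift.
Qed.

Lemma summand_refl X : D_summand X X.
Proof.
exists (bc_zero k G); apply/D_isoP; apply: qequiv_trans (qequiv_sumC _ _).
exact: qequiv_qis (sum_inr_qis X (@acyclic_zero k gT G)).
Qed.

Lemma summand_iso Y Y' X X' : D_iso Y Y' -> D_iso X X' -> D_summand Y X -> D_summand Y' X'.
Proof.
move=> /D_isoP YY' /D_isoP XX' [Z /D_isoP XYZ]; exists Z; apply/D_isoP.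
apply: qequiv_trans (qequiv_sym XX') (qequiv_trans XYZ _).
exact: qequiv_sum YY' (qequiv_refl Z).
Qed.

Lemma summand_trans A Y X : D_summand A Y -> D_summand Y X -> D_summand A X.
Proof.
move=> [B /D_isoP YAB] [Z /D_isoP XYZ]; exists (bc_sum B Z); apply/D_isoP.
apply: qequiv_trans XYZ (qequiv_trans _ (qequiv_sumA A B Z)).
exact: qequiv_sum YAB (qequiv_refl Z).
Qed.

Lemma summand_coh0 X Y i : D_summand Y X -> cohomology_zero X i -> cohomology_zero Y i.
Proof. by case=> Z /D_isoP H /(qequiv_coh0 H)/sum_coh0[]. Qed.

Lemma D_iso_sym X Y : D_iso X Y -> D_iso Y X.
Proof. by move=> /D_isoP H; apply/D_isoP; exact: qequiv_sym. Qed.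

Lemma D_iso_trans X Y Z : D_iso X Y -> D_iso Y Z -> D_iso X Z.
Proof. by move=> /D_isoP H /D_isoP H'; apply/D_isoP; exact: qequiv_trans H'. Qed.

Lemma indecomposable_iso X Y : D_iso X Y -> D_indecomposable X -> D_indecomposable Y.
Proof.
move=> XY [X0 indX]; split=> [Y0|A B YAB].
  by apply: X0; exact: D_iso_trans XY Y0.
by apply: indX; exact: D_iso_trans XY YAB.
Qed.

(* Descending induction on the dimension of the cohomology replaces
   the Krull-Schmidt decomposition of [X]. *)
Lemma thick_of_indecomposables (P : bcomplex k G -> Prop) X :
  thick P -> (forall i : int, i != -1 -> i != 0 -> cohomology_zero X i) ->
  (forall Y, D_indecomposable Y -> D_summand Y X -> P Y) -> P X.
Proof.
move=> thP cX PX.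
(* Cohomology lives in degrees [-1] and [0], so the sum of these two dimensions vanishes only on
   zero objects, and it is additive. *)
suff H n Y : D_summand Y X -> (coh_dim Y (-1) + coh_dim Y 0 < n)%N -> P Y.
  exact: (H _ X (summand_refl X) (ltnSn _)).
elim: n Y => // n IH Y YX Yn.
have [Y0|Y0] := classic (D_iso Y (bc_zero k G)).
  exact: (thick_iso thP (D_iso_sym Y0) (thick_zero thP)).
have [|indY] := classic (D_indecomposable Y); first by move=> /PX; apply.
have [A [B [YAB A0 B0]]] : exists A B,
    [/\ D_iso Y (bc_sum A B), ~ D_iso A (bc_zero k G) & ~ D_iso B (bc_zero k G)].
  apply: NNPP => nAB; apply: indY; split=> // A B YAB.
  apply: NNPP => H; apply: nAB; exists A, B; split=> // H0; apply: H; by [left|right].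
have AY : D_summand A Y by exists B.
have BY : D_summand B Y.
  exists A; apply: D_iso_trans YAB _; apply/D_isoP; exact: qequiv_sumC.
have AX := summand_trans AY YX; have BX := summand_trans BY YX.
have pos C : D_summand C X -> ~ D_iso C (bc_zero k G) -> (0 < coh_dim C (-1) + coh_dim C 0)%N.
  move=> CX C0; rewrite lt0n; apply/negP; rewrite addn_eq0 => /andP[/eqP c1 /eqP c2].
  apply: C0; apply/D_isoP/qequiv0P => i.
  have [->|i1] := eqVneq i (-1); first exact/coh_dim_eq0.
  have [->|i0] := eqVneq i 0; first exact/coh_dim_eq0.
  exact: summand_coh0 CX (cX i i1 i0).
have := pos A AX A0; have := pos B BX B0.
have /D_isoP YAB' := YAB; move: Yn; rewrite !(coh_dim_qequiv _ YAB') !coh_dim_sum => Yn Bp Ap.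
apply: (thick_iso thP (D_iso_sym YAB)).
by apply: thick_sum => //; apply: IH => //; lia.
Qed.

End Generation.

(** * Restriction of thick subcategories and induction of complexes *)

Section RestrictionGenerates.

Variables (k : fieldType) (gT : finGroupType) (G N : {group gT}) (sNG : N \subset G).
Implicit Types X Y : bcomplex k G.

(* In the next three lemmas the two complexes have convertible matrices and differ
   only in their proof components, so identity matrices typecheck. *)
Lemma res_cone X Y (f : chain_map X Y) :
  qequiv (bc_cone (res_map sNG f)) (bc_res sNG (bc_cone f)).
Proof.
pose A := bc_cone (res_map sNG f); pose B := bc_res sNG (bc_cone f).
have H i : @module_hom k gT N (A i) (B i) 1%:M.
  by move=> x _; exact: etrans (mulmx1 _) (esym (mul1mx _)).
have C i j : 1%:M *m bc_diff B i j = bc_diff A i j *m 1%:M.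
  exact: etrans (mul1mx _) (esym (mulmx1 _)).
by apply: (qequiv_qis (s := @ChainMap _ _ _ A B _ H C)); apply: iso_qis => i;
  rewrite ?row_free_unit ?row_full_unit unitmx1.
Qed.

Lemma res_shift X (n : int) : qequiv (bc_shift (bc_res sNG X) n) (bc_res sNG (bc_shift X n)).
Proof.
pose A := bc_shift (bc_res sNG X) n; pose B := bc_res sNG (bc_shift X n).
have H i : @module_hom k gT N (A i) (B i) 1%:M.
  by move=> x _; exact: etrans (mulmx1 _) (esym (mul1mx _)).
have C i j : 1%:M *m bc_diff B i j = bc_diff A i j *m 1%:M.
  exact: etrans (mul1mx _) (esym (mulmx1 _)).
by apply: (qequiv_qis (s := @ChainMap _ _ _ A B _ H C)); apply: iso_qis => i;
  rewrite ?row_free_unit ?row_full_unit unitmx1.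
Qed.

Lemma res_sum X Y : qequiv (bc_res sNG (bc_sum X Y)) (bc_sum (bc_res sNG X) (bc_res sNG Y)).
Proof.
pose A := bc_res sNG (bc_sum X Y); pose B := bc_sum (bc_res sNG X) (bc_res sNG Y).
have H i : @module_hom k gT N (A i) (B i) 1%:M.
  by move=> x _; exact: etrans (mulmx1 _) (esym (mul1mx _)).
have C i j : 1%:M *m bc_diff B i j = bc_diff A i j *m 1%:M.
  exact: etrans (mul1mx _) (esym (mulmx1 _)).
by apply: (qequiv_qis (s := @ChainMap _ _ _ A B _ H C)); apply: iso_qis => i;
  rewrite ?row_free_unit ?row_full_unit unitmx1.
Qed.

(** Lets the generation hypothesis over [G] be applied to a thick subcategory over [N]. *)
Lemma thick_res (P : bcomplex k N -> Prop) : thick P -> thick (fun X => P (bc_res sNG X)).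
Proof.
move=> thP; split.
- apply: (thick_iso thP _ (thick_zero thP)); apply/D_isoP/qequiv_sym/qequiv0P => i.
  exact: acyclic_zero.
- move=> X Y /D_isoP XY; apply: (thick_iso thP); apply/D_isoP; exact: qequiv_res.
- move=> X Y f PX PY; have := thick_cone thP (res_map sNG f) PX PY.
  apply: (thick_iso thP); apply/D_isoP.
  exact: res_cone.
- move=> X n PX; have := thick_shift thP n PX.
  by apply: (thick_iso thP); apply/D_isoP; exact: res_shift.
- move=> X Y PXY; apply: (thick_summand thP (Y := bc_res sNG Y)).
  by apply: (thick_iso thP) PXY; apply/D_isoP; exact: res_sum.
Qed.

Section InducedComplex.

Variable Y : bcomplex k N.

Lemma ind_complex_shape i j : j != i + 1 -> ind_map sNG (bc_diff Y i j) = 0.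
Proof. by move=> ij; rewrite bc_diff_shape // ind_map0. Qed.

Lemma ind_complex_sq i j l : ind_map sNG (bc_diff Y i j) *m ind_map sNG (bc_diff Y j l) = 0.
Proof. by rewrite -ind_mapM bc_diff_sq ind_map0. Qed.

Lemma ind_complex_bounded : exists b : nat, forall i, (b < `|i|)%N ->
  rdegree (ind_module sNG (Y i)) = 0%N.
Proof.
by have [b Yb] := bc_bounded Y; exists b => i /Yb Y0; rewrite /= big1.
Qed.

Definition ind_complex : bcomplex k G :=
  BComplex (fun i j => ind_map_hom sNG (@bc_diff_hom _ _ _ Y i j)) ind_complex_shape
    ind_complex_sq ind_complex_bounded.

Lemma ind_complex_summand : exists Z, qequiv (bc_sum Y Z) (bc_res sNG ind_complex).
Proof.
pose R := bc_res sNG ind_complex.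
pose i := @ChainMap _ _ _ Y R (fun n => ind_in sNG (Y n)) (fun n => @ind_in_hom _ _ _ _ sNG (Y n))
  (fun m n => ind_in_map sNG (@bc_diff_hom _ _ _ Y m n)).
pose e := @ChainMap _ _ _ R Y (fun n => ind_ev sNG (Y n)) (fun n => @ind_ev_hom _ _ _ _ sNG (Y n))
  (fun m n => esym (ind_map_ev sNG (@bc_diff_hom _ _ _ Y m n))).
apply: (@qequiv_retract _ _ _ Y R i e) => n; exact: ind_inK.
Qed.

End InducedComplex.

End RestrictionGenerates.
(** * Restriction of the collection *)

Section RoofLift.

Variables (k : fieldType) (gT : finGroupType) (G : {group gT}).
Implicit Types X Y Z V T : bcomplex k G.

(** Represents a morphism of the derived category by a chain map [f] between models: [V] is lifted
    first to the apex, then along [t]. *)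
Lemma roof_lift (a : int) Y Z V T (r : roof Y Z) (s : chain_map V Y) (t : chain_map T Z) :
  nice a V -> below a (roof_apex r) -> below a Y -> below a T -> below a Z -> quasi_iso t ->
  exists (l : chain_map V (roof_apex r)) (f : chain_map V T),
    homotopic (chain_comp (roof_den r) l) s /\
    homotopic (chain_comp t f) (chain_comp (roof_num r) l).
Proof.
move=> nV bW bY bT bZ qt.
have [l Hl] := nice_lift s nV bW bY (@roof_qis _ _ _ _ _ r).
have [f Hf] := nice_lift (chain_comp (roof_num r) l) nV bT bZ qt.
by exists l, f.
Qed.

Lemma null_homotopic_homotopic X Z (f g : chain_map X Z) :
  homotopic f g -> null_homotopic f -> null_homotopic g.
Proof.
by move=> fg f0; apply: null_ext (nullB f0 fg) => i; rewrite opprB addrC subrK.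
Qed.

Lemma roof_lift_zero Y Z V T (r : roof Y Z) (s : chain_map V Y) (t : chain_map T Z)
    (l : chain_map V (roof_apex r)) (f : chain_map V T) :
  quasi_iso s -> homotopic (chain_comp (roof_den r) l) s ->
  homotopic (chain_comp t f) (chain_comp (roof_num r) l) ->
  null_homotopic f -> roof_eq r (roof_zero Y Z).
Proof.
move=> qs Hl Hf f0; apply: roof_eq_zero qs Hl _.
apply: null_homotopic_homotopic Hf _; exact: null_mulr.
Qed.

(** Up to homotopy [f] is recovered from [j f q] by composing with [i] and [r]. *)
Lemma homotopic_through_id (X V T : bcomplex k G) (i : chain_map V X) (q : chain_map X V)
    (Z : bcomplex k G) (j : chain_map T Z) (r : chain_map Z T) (f : chain_map V T) :
  homotopic (chain_comp q i) (chain_id V) -> homotopic (chain_comp r j) (chain_id T) ->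
  null_homotopic (chain_comp j (chain_comp f q)) -> null_homotopic f.
Proof.
move=> qi rj f0.
have H : homotopic (chain_comp (chain_comp r j) (chain_comp f (chain_comp q i))) f.
  apply: homotopic_trans (homotopic_comp (homotopic_comp qi (homotopic_refl f)) rj) _.
  by apply: homotopic_ext => n /=; rewrite mul1mx mulmx1.
apply: null_homotopic_homotopic H _.
by apply: null_ext (null_mulr r (null_mull i f0)) => n /=; rewrite !mulmxA.
Qed.

End RoofLift.

Section RestrictedCollection.

Variables (k : fieldType) (p : nat) (gT : finGroupType) (G N : {group gT}).
Hypothesis hp : p \in [pchar k].
Hypothesis nNG : (N <| G)%g.
Hypothesis hidx : p.-nat #|G : N|%g.
Let sNG := normal_sub nNG.
Implicit Types X Z : bcomplex k G.
Variable S : bcomplex k G -> Prop.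
Hypothesis smcS : simple_minded_collection S.
Hypothesis ttS : two_term S.

Local Notation resS := (res_collection sNG S).

Lemma smc_model X : S X -> exists a0 : int, forall a, a <= a0 ->
  exists X' (q : chain_map X' X), [/\ S X', nice a X' & quasi_iso q].
Proof.
move=> SX; have [a0 H] := nice_model X; exists a0 => a /H[_ [X' [q [nX' qq]]]].
exists X', q; split=> //; apply: smc_classes smcS _ _ _ SX.
by apply/D_isoP/qequiv_sym/(qequiv_qis qq).
Qed.

Lemma hom_zero_res (a : int) X Z : nice a X -> below a Z -> D_Hom_zero X Z ->
  forall f, graded_map (X := X) (Z := Z) N f -> graded_null (X := X) (Z := Z) N f.
Proof.
move=> nX bZ XZ; apply: (res_null hp nNG hidx nX bZ) => f.
exact: roof_zero_null nX bZ (XZ _).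
Qed.

Lemma res_summand_iso X X' Y : qequiv X X' -> D_summand Y (bc_res sNG X) ->
  D_summand Y (bc_res sNG X').
Proof.
move=> XX'; apply: summand_iso; first by apply/D_isoP; exact: qequiv_refl.
by apply/D_isoP; exact: qequiv_res.
Qed.

Lemma res_negative Y1 Y2 (n : int) : resS Y1 -> resS Y2 -> n < 0 ->
  D_Hom_zero Y1 (bc_shift Y2 n).
Proof.
move=> [_ [X1 S1 YX1]] [_ [X2 S2 YX2]] n0 r.
have [a1 H1] := summand_model YX1; have [a2 H2] := summand_model YX2.
have [a3 H3] := smc_model S1; have [a4 H4] := smc_model S2.
have [a5 H5] := common_below (roof_apex r) Y1 (bc_shift Y2 n).
pose a := Order.min a1 (Order.min a2 (Order.min a3 (Order.min a4 a5))).
have [|X1' [q1 [SX1' nX1 qq1]]] := H3 a; first by rewrite /a; lia.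
have [|X2' [q2 [SX2' nX2 qq2]]] := H4 a; first by rewrite /a; lia.
have [||V1 [s1 [i1 [p1 [nV1 qs1 pi1]]]]] := H1 a _ _ (res_map sNG q1) (nice_res sNG nX1).
- by rewrite /a; lia.
- exact: res_map_qis.
have [||V2 [s2 [i2 [p2 [nV2 qs2 pi2]]]]] := H2 a _ _ (res_map sNG q2) (nice_res sNG nX2).
- by rewrite /a; lia.
- exact: res_map_qis.
have [|bW bY1 bY2] := H5 a; first by rewrite /a; lia.
(* A shift by [n < 0] moves the terms to higher degrees, so the same bound [a] applies. *)
have bV2 : below a (bc_shift V2 n) by move=> i ia; apply: (proj1 nV2); lia.
have bX2 : below a (bc_shift X2' n) by move=> i ia; apply: (proj1 nX2); lia.
have [l [f [Hl Hf]]] := roof_lift s1 nV1 bW bY1 bV2 bY2 (shift_map_qis n qs2).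
apply: roof_lift_zero qs1 Hl Hf _.
apply: (homotopic_through_id (i := i1) (q := p1) (j := shift_map n i2) (r := shift_map n p2)) => //.
  exact: (shift_null n pi2).
pose phi := chain_comp (shift_map n i2) (chain_comp f p1).
apply: (hom_zero_res nX1 bX2 (smc_negative smcS SX1' SX2' n0) (f := phi)).
by split=> i; [exact: (cm_hom phi i) | exact: (cm_comm phi i (i + 1))].
Qed.

(** Both summands are modelled as retracts of one restricted resolution, as [summand_hom_null]
    requires. It serves orthogonality and, with [Y1 = Y2], the division property. *)
Lemma res_same Y1 Y2 X : S X -> D_indecomposable Y1 -> D_indecomposable Y2 ->
  D_summand Y1 (bc_res sNG X) -> D_summand Y2 (bc_res sNG X) ->
  exists a0 : int, forall a, a <= a0 -> exists V1 V2 (s1 : chain_map V1 Y1) (s2 : chain_map V2 Y2),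
    [/\ nice a V1, nice a V2, quasi_iso s1, quasi_iso s2
      & forall f : chain_map V1 V2, ~ quasi_iso f -> null_homotopic f].
Proof.
move=> SX ind1 ind2 YX1 YX2.
have [a1 H1] := summand_model YX1; have [a2 H2] := summand_model YX2.
have [a3 H3] := smc_model SX; exists (Order.min a1 (Order.min a2 a3)) => a ha.
have [|X' [q [SX' nX qq]]] := H3 a; first by lia.
have [||V1 [s1 [i1 [p1 [nV1 qs1 pi1]]]]] := H1 a _ _ (res_map sNG q) (nice_res sNG nX).
- by lia.
- exact: res_map_qis.
have [||V2 [s2 [i2 [p2 [nV2 qs2 pi2]]]]] := H2 a _ _ (res_map sNG q) (nice_res sNG nX).
- by lia.
- exact: res_map_qis.
exists V1, V2, s1, s2; split=> // f.
apply: (summand_hom_null hp hidx nX _ nV1 nV2 _ _ pi1 pi2).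
- by move=> phi; apply: division_qis nX _; exact: smc_division SX'.
- by apply: indecomposable_iso ind1; apply/D_isoP/qequiv_sym/(qequiv_qis qs1).
- by apply: indecomposable_iso ind2; apply/D_isoP/qequiv_sym/(qequiv_qis qs2).
Qed.

Lemma res_orthogonal Y1 Y2 : resS Y1 -> resS Y2 -> ~ D_iso Y1 Y2 -> D_Hom_zero Y1 Y2.
Proof.
move=> [ind1 [X1 S1 YX1]] [ind2 [X2 S2 YX2]] nY12 r.
have [a5 H5] := common_below (roof_apex r) Y1 Y2.
(* For isomorphic [X1] and [X2] a nonzero map would be an isomorphism of [Y1] with [Y2]; otherwise
   the vanishing descends from [Hom(X1, X2) = 0]. *)
have [/D_isoP X12|nX12] := classic (D_iso X1 X2).
  have [a0 H0] := res_same S1 ind1 ind2 YX1 (res_summand_iso (qequiv_sym X12) YX2).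
  pose a := Order.min a0 a5.
  have [|V1 [V2 [s1 [s2 [nV1 nV2 qs1 qs2 Hf]]]]] := H0 a; first by rewrite /a; lia.
  have [|bW bY1 bY2] := H5 a; first by rewrite /a; lia.
  have [l [f [Hl Hf']]] := roof_lift s1 nV1 bW bY1 (proj1 nV2) bY2 qs2.
  apply: (roof_lift_zero qs1 Hl Hf' (Hf f _)) => qf; apply: nY12; apply/D_isoP.
  exists V1, s1, (chain_comp s2 f); split=> //; exact: (chain_comp_qis qs2 qf).
have [a1 H1] := summand_model YX1; have [a2 H2] := summand_model YX2.
have [a3 H3] := smc_model S1; have [a4 H4] := smc_model S2.
pose a := Order.min a1 (Order.min a2 (Order.min a3 (Order.min a4 a5))).
have [|X1' [q1 [SX1' nX1 qq1]]] := H3 a; first by rewrite /a; lia.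
have [|X2' [q2 [SX2' nX2 qq2]]] := H4 a; first by rewrite /a; lia.
have [||V1 [s1 [i1 [p1 [nV1 qs1 pi1]]]]] := H1 a _ _ (res_map sNG q1) (nice_res sNG nX1).
- by rewrite /a; lia.
- exact: res_map_qis.
have [||V2 [s2 [i2 [p2 [nV2 qs2 pi2]]]]] := H2 a _ _ (res_map sNG q2) (nice_res sNG nX2).
- by rewrite /a; lia.
- exact: res_map_qis.
have [|bW bY1 bY2] := H5 a; first by rewrite /a; lia.
have [l [f [Hl Hf]]] := roof_lift s1 nV1 bW bY1 (proj1 nV2) bY2 qs2.
apply: roof_lift_zero qs1 Hl Hf _; apply: homotopic_through_id pi1 pi2 _.
apply: (hom_zero_res nX1 (proj1 nX2)); last exact: graded_of_res_chain.
apply: smc_orthogonal smcS _ _ SX1' SX2' _ => /D_isoP X12'; apply: nX12; apply/D_isoP.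
exact: qequiv_trans (qequiv_trans (qequiv_sym (qequiv_qis qq1)) X12') (qequiv_qis qq2).
Qed.

Lemma res_division Y : resS Y -> D_End_division Y.
Proof.
move=> [indY [X SX YX]]; split.
  (* If the identity were zero, a quasi-isomorphism onto [Y] would be null-homotopic and [Y] would
     be acyclic. *)
  move=> [W [u1 [u2 [qu _ H]]]]; case: indY => Y0 _; apply: Y0; apply/D_isoP/qequiv0P.
  apply: (qis_null_acyclic qu); apply: null_ext H => i /=.
  by rewrite mulmx0 subr0.
move=> r r0; apply: num_qis_inverse.
have [a5 H5] := common_below (roof_apex r) Y Y.
have [a0 H0] := res_same SX indY indY YX YX.
pose a := Order.min a0 a5.
have [|V1 [V2 [s1 [s2 [nV1 nV2 qs1 qs2 Hf]]]]] := H0 a; first by rewrite /a; lia.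
have [|bW bY _] := H5 a; first by rewrite /a; lia.
have [l [f [Hl Hf']]] := roof_lift s1 nV1 bW bY (proj1 nV2) bY qs2.
have qf : quasi_iso f.
  by apply: NNPP => nqf; apply: r0; exact: roof_lift_zero qs1 Hl Hf' (Hf f nqf).
have ql : quasi_iso l.
  apply: (qis_right (t := roof_den r)); last exact: roof_qis.
  exact: qis_homotopic (homotopic_sym Hl) qs1.
by apply: (qis_left (s := l)) => //; apply: qis_homotopic Hf' _; exact: chain_comp_qis.
Qed.

Lemma res_generates P : thick P -> (forall Y, resS Y -> P Y) -> forall Y, P Y.
Proof.
move=> thP resP Y.
have PG : forall X, P (bc_res sNG X).
  apply: smc_generates smcS _ (thick_res sNG thP) _ => X SX.
  apply: (thick_of_indecomposables thP); first by move=> i; exact: ttS SX i.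
  by move=> Z indZ ZX; apply: resP; split=> //; exists X.
have [Z YZ] := ind_complex_summand sNG Y.
apply: (thick_summand thP (Y := Z)); apply: (thick_iso thP _ (PG (ind_complex sNG Y))).
by apply/D_isoP; exact: qequiv_sym.
Qed.

End RestrictedCollection.

Theorem theorem1p4 (k : fieldType) (p : nat) (hp : p \in [pchar k]%R)
    (gT : finGroupType) (G N : {group gT}) (nNG : (N <| G)%g)
    (hidx : p.-nat #|G : N|%g)
    (X : bcomplex k G -> Prop)
    (hX : simple_minded_collection X) (h2 : two_term X) :
  simple_minded_collection (res_collection (normal_sub nNG) X) /\
  two_term (res_collection (normal_sub nNG) X).
Proof.
split; last first.
  by move=> Y [_ [Z XZ YZ]] i i1 i0; apply: summand_coh0 YZ _; exact: h2 XZ i i1 i0.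
split.
- move=> Y Y' YY' [indY [Z XZ YZ]]; split; first exact: indecomposable_iso YY' indY.
  exists Z => //; apply: summand_iso YY' _ YZ; apply/D_isoP; exact: qequiv_refl.
- exact: (res_division hp hidx hX).
- exact: (res_orthogonal hp hidx hX).
- exact: (res_negative hp hidx hX).
- exact: (res_generates hX h2).
Qed.
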